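(* Let $K, L \subset \mathbb{R}^2$ be convex bodies such that $K$ is in a position of maximal volume in $L$, $0 \in \operatorname{int} K$, and $K$ is in John's position in $L$ with $m$ contact pairs $(u_i, v_i)_{i=1}^{m}$ satisfying $$u_i \notin \operatorname{conv} \{ u_j : j \neq i \} \quad \text{and} \quad v_i \notin \operatorname{conv} \{ v_j : j \neq i\} \quad \text{for every } 1 \leq i \leq m.$$ Let $s$ be the cardinality of the set $\partial L \cap \partial(-2K)$ (possibly $s = \infty$). Then: (1) If $m=3$ and $d_G(K, L)=2$, then $K$ is a triangle or $L$ is a triangle ($L$ not necessarily symmetric). (2) If $m=4$, $s \neq 3$ and $d_G(K, L)=2$, then $K$ is a triangle or $L$ is a triangle ($L$ not necessarily symmetric). (3) If $m=4$, $s=3$, $L$ is additionally centrally symmetric and $d_G(K, L)=2$, then $K$ is a triangle.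
   Context: A convex body in $\mathbb{R}^n$ is a compact convex set with non-empty interior; it is (centrally) symmetric if it has a center of symmetry (not necessarily the origin). $\partial K$ is the boundary of $K$. For a convex body $K$ with $0 \in \operatorname{int} K$, the polar body is $K^{\circ} = \{ x \in \mathbb{R}^n : \langle x, y \rangle \leq 1 \text{ for every } y \in K \}$, with $\langle\cdot,\cdot\rangle$ the usual scalar product. The Grünbaum distance of convex bodies $K, L \subset \mathbb{R}^n$ is $d_G(K, L) = \inf \{ |r| : K' \subset L' \subset rK' \}$, with the infimum over all real $r$ and all non-degenerate affine images $K'$ of $K$ and $L'$ of $L$ for which the inclusions hold (so $r$ may be negative). $K$ is in a position of maximal volume in $L$ if $K \subset L$ and every affine image $K'$ of $K$ contained in $L$ satisfies $\operatorname{vol}(K') \leq \operatorname{vol}(K)$. $K$ is in John's position in $L$ with $m$ contact pairs $(u_i, v_i)_{i=1}^m$ if $K \subset L$ and there are an integer $m>0$, points $u_1,\dots,u_m \in \partial K \cap \partial L$, points $v_1,\dots,v_m \in \partial K^{\circ} \cap \partial L^{\circ}$ and positive numbers $a_1,\dots,a_m$ such that - $x = \sum_{i=1}^{m} a_i \langle x, u_i \rangle v_i$ for every $x \in \mathbb{R}^n$, - $0 = \sum_{i=1}^{m} a_i u_i = \sum_{i=1}^{m} a_i v_i$, - $\langle u_i, v_i \rangle = 1$ for $1 \leq i \leq m$. A triangle means the convex hull of three affinely independent points. *)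

(* Defs.v *)
From HB Require Import structures.
From mathcomp Require Import all_boot all_order all_algebra.
From mathcomp Require Import all_classical all_reals all_analysis.

Set Implicit Arguments.
Unset Strict Implicit.
Unset Printing Implicit Defensive.

Import Order.TTheory GRing.Theory Num.Theory.
Import numFieldNormedType.Exports.

Local Open Scope classical_set_scope.
Local Open Scope ring_scope.

Section ConvexBodies.
Variables (R : realType) (n : nat).
Implicit Types (K L A : set 'rV[R]_n) (x y : 'rV[R]_n).

Definition dotv x y : R := \sum_(i < n) x 0 i * y 0 i.

Definition boundary A : set 'rV[R]_n := closure A `\` interior A.

(* [smallest C A] is the intersection of all sets containing [A] that satisfy
   [C]. *)
Definition convex_hull A : set 'rV[R]_n :=
  smallest (@convex_set R 'rV[R]_n) A.

(* The topology on ['rV[R]_n] is the product topology. *)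
Definition convex_body K : Prop :=
  [/\ compact K, convex_set (K : set (convex_lmodType 'rV[R]_n)) &
      interior K !=set0].

Definition centrally_symmetric K : Prop :=
  exists c, forall x, K x -> K (c *+ 2 - x).

Definition polar K : set 'rV[R]_n := [set x | forall y, K y -> dotv x y <= 1].

Definition dilate (r : R) K : set 'rV[R]_n := [set r *: x | x in K].

Definition is_affine_image K' K : Prop :=
  exists (M : 'M[R]_n) (b : 'rV[R]_n), K' = [set x *m M + b | x in K].

Definition is_nondegenerate_affine_image K' K : Prop :=
  exists (M : 'M[R]_n) (b : 'rV[R]_n),
    M \in unitmx /\ K' = [set x *m M + b | x in K].

Definition grunbaum_distance K L : R :=
  inf [set `|r| | r in [set r : R | exists K' L' : set 'rV[R]_n,
    [/\ is_nondegenerate_affine_image K' K,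
        is_nondegenerate_affine_image L' L,
        K' `<=` L' & L' `<=` dilate r K']]].

Definition john_position K L (m : nat) (u v : 'I_m -> 'rV[R]_n) : Prop :=
  [/\ K `<=` L, (0 < m)%N,
      forall i, (boundary K `&` boundary L) (u i),
      forall i, (boundary (polar K) `&` boundary (polar L)) (v i) &
      exists a : 'I_m -> R,
        [/\ forall i, 0 < a i,
            forall x, x = \sum_(i < m) (a i * dotv x (u i)) *: v i,
            0 = \sum_(i < m) a i *: u i,
            0 = \sum_(i < m) a i *: v i &
            forall i, dotv (u i) (v i) = 1]].

Definition is_triangle K : Prop :=
  exists a b c : 'rV[R]_n,
    row_free (col_mx (b - a) (c - a)) /\ K = convex_hull [set a; b; c].

End ConvexBodies.

Section PlanarVolume.
Variable R : realType.
Implicit Types K L A : set 'rV[R]_2.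

(* Two-dimensional Lebesgue measure, transported along the identification of
   ['rV[R]_2] with [R * R]; it is only evaluated on compact sets below. *)
Definition area A : \bar R :=
  (@lebesgue_measure R \x @lebesgue_measure R)%E
    [set (x 0 0, x 0 1) | x in A].

Definition maximal_volume_position K L : Prop :=
  K `<=` L /\
  forall K' : set 'rV[R]_2, is_affine_image K' K -> K' `<=` L ->
    (area K' <= area K)%E.

End PlanarVolume.

(* Main.v *)
Require Import Defs.
From HB Require Import structures.
From mathcomp Require Import all_boot all_order all_algebra.
From mathcomp Require Import all_classical all_reals all_analysis.
From mathcomp Require Import finmap ring lra.

(** John's identity gives [-z/2 = sum_i (a_i/2) (1 - <z, v_i>) u_i] for every
    [z], a convex combination of the [u_i] when [z] is in [L]; hence
    [K <= L <= -2K]. A contact point [z] of [L] with [-2K] thus lies on the lines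
    [v_i = 1] for all [u_i] outside a common edge of [K].

    If [T x = M x + b] maps [K] into [L] and, for some [c] and every contact
    point [z], the vector [M z - z + c] points from [-z/2] into the interior of
    [K], then [(1 - e) I + e T] for small [e > 0] gives a position of ratio less
    than 2. The map [T] need not be invertible.

    For three pairs, [u_1 u_2 u_3] is a triangle [U] centred at 0 and [L] lies in
    [-2U]. If [K <> U] and [L <> -2U], a translation, a degenerate [T], or first
    replacing [K] by an affine reflection of itself in [U] that stays in [L],
    gives ratio less than 2.

    For four pairs, the matrix [delta_ij - a_j (<u_i, v_j> + 1/2)] has rank one,
    which forces the [u_i] and [v_i] into the same cyclic order. The contact
    points are then among the four vertices of [{v_i <= 1}], each opposite to an
    edge [u_i u_(i+1)] of [K]. With at most two of them a translation or the
    projection of a strip suffices; with all four, [K] and [L] are quadrilaterals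
    and are nested in a normal form. With three of them, the barycentric
    coordinates of the triangle bounded by the three edges define a map [T] from
    [K] to the triangle of contact points with [tr M = 2] and [tr (M^2) >= 2];
    strict inequality is an improvement, and equality makes [K] a triangle as
    soon as [L] is symmetric. *)


Set Implicit Arguments.
Unset Strict Implicit.
Unset Printing Implicit Defensive.

Import Order.TTheory GRing.Theory Num.Theory.
Import numFieldNormedType.Exports.

Local Open Scope classical_set_scope.
Local Open Scope card_scope.
Local Open Scope ring_scope.

(** * Planar convexity *)

Section PlaneGeometry.
Variable R : realFieldType.
Local Notation pt := (R * R)%type.
Implicit Types (K L : pt -> Prop) (p q A B C : pt).

(** The distance hypothesis enters only by contradiction: outside the stated configurations an
    explicit position has ratio below 2. The inclusion of [L] in [-2K] has no slack at a contact
    point, so a perturbation has to gain at all contacts at once. Mixing the identity with [T] keeps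
    [K] inside [L] by convexity; the gain in the outer inclusion is of first order, compactness of
    [L] makes it uniform, and by Cayley-Hamilton the perturbed linear map is inverted with an error
    of second order only. What remains is a finite system of linear inequalities: at a contact on an
    edge of [K] the vector [M z - z + c] must have positive product with the inner normal of that
    edge. The vector [c] is free, because the outer copy may be recentred. With [T] the identity the
    system asks for one direction entering [K] at all contacts. This is impossible for antiparallel
    normals and for three normals that positively span the plane; there [T] has to be a projection
    of [K] to a segment or a triangle of contact points. Affine invariance allows coordinates in
    which each such system is solved by explicit numbers. *)

Definition orient A B C : R :=
  (B.1 - A.1) * (C.2 - A.2) - (B.2 - A.2) * (C.1 - A.1).

Definition conv2 K := forall p q (t : R), K p -> K q -> 0 <= t <= 1 ->
  K ((1 - t) * p.1 + t * q.1, (1 - t) * p.2 + t * q.2).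

Definition near2 p (P : pt -> Prop) := exists d : R, 0 < d /\
  forall q, `|q.1 - p.1| < d -> `|q.2 - p.2| < d -> P q.

Definition int2 K p := near2 p K.

Lemma near2_and p (P Q : pt -> Prop) :
  near2 p P -> near2 p Q -> near2 p (fun q => P q /\ Q q).
Proof.
move=> [d [d0 Pd]] [e [e0 Qe]]; exists (Num.min d e).
split; first by rewrite lt_min d0.
by move=> q; rewrite !lt_min => /andP[? ?] /andP[? ?]; split; [apply: Pd|apply: Qe].
Qed.

Lemma near2_sub p (P Q : pt -> Prop) :
  (forall q, P q -> Q q) -> near2 p P -> near2 p Q.
Proof. by move=> PQ [d [d0 Pd]]; exists d; split=> // q h1 h2; apply/PQ/Pd. Qed.

Lemma near2_orient A B p : 0 < orient A B p ->
  near2 p (fun q => 0 < orient A B q).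
Proof.
move=> o0; set s := 1 + `|B.1 - A.1| + `|B.2 - A.2|.
have s0 : 0 < s.
  by have := normr_ge0 (B.1 - A.1); have := normr_ge0 (B.2 - A.2); rewrite /s; lra.
exists (orient A B p / s); split; first exact: divr_gt0.
move=> q h1 h2.
have e : orient A B q = orient A B p + (B.1 - A.1) * (q.2 - p.2)
   - (B.2 - A.2) * (q.1 - p.1) by rewrite /orient; ring.
set d := orient A B p / s in h1 h2.
have dE : d * s = orient A B p by rewrite /d divfK // gt_eqF.
have d0 : 0 < d by exact: divr_gt0.
have k1 : `|(B.1 - A.1) * (q.2 - p.2)| <= `|B.1 - A.1| * d.
  by rewrite normrM ler_wpM2l // ltW.
have k2 : `|(B.2 - A.2) * (q.1 - p.1)| <= `|B.2 - A.2| * d.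
  by rewrite normrM ler_wpM2l // ltW.
move: k1 k2; rewrite !ler_norml => /andP[k1 _] /andP[_ k2].
move: dE; rewrite /s; lra.
Qed.

Lemma conv3 K A B C (a b c : R) : conv2 K -> K A -> K B -> K C ->
  0 <= a -> 0 <= b -> 0 <= c -> a + b + c = 1 ->
  K (a * A.1 + b * B.1 + c * C.1, a * A.2 + b * B.2 + c * C.2).
Proof.
move=> cK KA KB KC a0 b0 c0 abc.
have [bc0|bc0] := eqVneq (b + c) 0.
  have [-> [-> ->]] : b = 0 /\ c = 0 /\ a = 1 by lra.
  by rewrite !mul0r !addr0 !mul1r -surjective_pairing.
have bcp : 0 < b + c by rewrite lt_def bc0 addr_ge0.
have t1 : 0 <= c / (b + c) <= 1.
  by apply/andP; split; [rewrite divr_ge0 // ltW|rewrite ler_pdivrMr // mul1r lerDr].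
have t2 : 0 <= b + c <= 1 by lra.
have := cK _ _ _ KA (cK _ _ _ KB KC t1) t2.
congr K; rewrite /=; congr pair; have -> : a = 1 - (b + c) by lra.
  by field.
by field.
Qed.

Lemma tri_in K A B C p : conv2 K -> K A -> K B -> K C ->
  0 < orient A B C -> 0 <= orient A B p -> 0 <= orient B C p ->
  0 <= orient C A p -> K p.
Proof.
move=> cK KA KB KC o0 o1 o2 o3.
have on0 : orient A B C != 0 by rewrite gt_eqF.
have := @conv3 K A B C (orient B C p / orient A B C) (orient C A p / orient A B C)
  (orient A B p / orient A B C) cK KA KB KC.
have oi : 0 <= (orient A B C)^-1 by rewrite invr_ge0 ltW.
rewrite !mulr_ge0 // => /(_ isT isT isT).
have e : orient B C p + orient C A p + orient A B p = orient A B C.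
  by rewrite /orient; ring.
rewrite -!mulrDl e divff // => /(_ erefl).
rewrite [X in _ -> K X]surjective_pairing; congr (K (_, _)).
  move: on0; rewrite /orient => ?; by field.
move: on0; rewrite /orient => ?; by field.
Qed.

Lemma tri_int K A B C p : conv2 K -> K A -> K B -> K C ->
  0 < orient A B p -> 0 < orient B C p -> 0 < orient C A p -> int2 K p.
Proof.
move=> cK KA KB KC o1 o2 o3.
have e : orient B C p + orient C A p + orient A B p = orient A B C.
  by rewrite /orient; ring.
have := near2_and (near2_orient o1) (near2_and (near2_orient o2) (near2_orient o3)).
apply: near2_sub => q [h1 [h2 h3]].
by apply: (@tri_in K A B C) => //; [lra|exact: ltW..].
Qed.

Lemma quad_in K A B C D p : conv2 K -> K A -> K B -> K C -> K D ->
  0 < orient A B C -> 0 < orient C D A ->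
  0 <= orient A B p -> 0 <= orient B C p -> 0 <= orient C D p ->
  0 <= orient D A p -> K p.
Proof.
move=> cK KA KB KC KD oB oD o1 o2 o3 o4.
have [h|h] := leP 0 (orient A C p).
  by apply: (@tri_in K C D A) => //.
apply: (@tri_in K A B C) => //.
have -> : orient C A p = - orient A C p by rewrite /orient; ring.
by lra.
Qed.

Lemma quad_int K A B C D p : conv2 K -> K A -> K B -> K C -> K D ->
  0 < orient A B C -> 0 < orient C D A ->
  0 < orient A B p -> 0 < orient B C p -> 0 < orient C D p ->
  0 < orient D A p -> int2 K p.
Proof.
move=> cK KA KB KC KD oB oD o1 o2 o3 o4.
have := near2_and (near2_and (near2_orient o1) (near2_orient o2))
  (near2_and (near2_orient o3) (near2_orient o4)).
apply: near2_sub => q [[h1 h2] [h3 h4]].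
by apply: (@quad_in K A B C D) => //; exact: ltW.
Qed.

(** Near a point strictly between [A] and [B], the triangles [A B C] and [B A D] on the two sides of
    the line cover a full neighbourhood. Read backwards: if such a point is on the boundary of [K],
    then [K] stays on one side of the line. *)
Lemma edge_int K A B C D p (k : R) : conv2 K -> K A -> K B -> K C -> K D ->
  0 < orient A B C -> orient A B D < 0 -> 0 < k < 1 ->
  p = ((1 - k) * A.1 + k * B.1, (1 - k) * A.2 + k * B.2) -> int2 K p.
Proof.
move=> cK KA KB KC KD oC oD k01 pE.
have oD' : 0 < orient B A D by move: oD; rewrite /orient; lra.
have h1 : orient B C p = (1 - k) * orient A B C by rewrite pE /orient /=; ring.
have h2 : orient C A p = k * orient A B C by rewrite pE /orient /=; ring.
have h3 : orient A D p = k * orient B A D by rewrite pE /orient /=; ring.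
have h4 : orient D B p = (1 - k) * orient B A D by rewrite pE /orient /=; ring.
have g1 : 0 < orient B C p by rewrite h1 mulr_gt0 //; lra.
have g2 : 0 < orient C A p by rewrite h2 mulr_gt0 //; lra.
have g3 : 0 < orient A D p by rewrite h3 mulr_gt0 //; lra.
have g4 : 0 < orient D B p by rewrite h4 mulr_gt0 //; lra.
have := near2_and (near2_and (near2_orient g1) (near2_orient g2))
  (near2_and (near2_orient g3) (near2_orient g4)).
apply: near2_sub => q [[f1 f2] [f3 f4]].
have [h|h] := leP 0 (orient A B q).
  by apply: (@tri_in K A B C) => //; exact: ltW.
apply: (@tri_in K B A D) => //; try exact: ltW.
by move: h; rewrite /orient; lra.
Qed.

Lemma pos_eventually (a b : R) : 0 <= a -> 0 < a \/ 0 < b ->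
  exists e0 : R, 0 < e0 /\ forall e, 0 < e -> e <= e0 -> 0 < a + e * b.
Proof.
move=> a0 [ap|bp]; last first.
  by exists 1; split=> // e e0 _; rewrite ltr_wpDl // mulr_gt0.
exists (a / (1 + `|b|)).
have b1 : 0 < 1 + `|b| by rewrite ltr_pwDl.
split; first exact: divr_gt0.
move=> e e0; rewrite ler_pdivlMr // => h.
have : - `|b| <= b by rewrite lerNl ler_normr lexx orbT.
by move=> hb; have : e * - `|b| <= e * b by [rewrite ler_pM2l]; lra.
Qed.

(* First-order criterion: from a point of a triangle, a direction that enters
   strictly through every side containing the point leads to the interior. *)
Lemma ray_int K A B C p (e : pt) : conv2 K -> K A -> K B -> K C ->
  0 <= orient A B p -> 0 <= orient B C p -> 0 <= orient C A p ->
  0 < orient A B p \/ 0 < (B.1 - A.1) * e.2 - (B.2 - A.2) * e.1 ->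
  0 < orient B C p \/ 0 < (C.1 - B.1) * e.2 - (C.2 - B.2) * e.1 ->
  0 < orient C A p \/ 0 < (A.1 - C.1) * e.2 - (A.2 - C.2) * e.1 ->
  exists s : R, 0 < s /\ int2 K (p.1 + s * e.1, p.2 + s * e.2).
Proof.
move=> cK KA KB KC o1 o2 o3 h1 h2 h3.
have [s1 [s1p g1]] := pos_eventually o1 h1.
have [s2 [s2p g2]] := pos_eventually o2 h2.
have [s3 [s3p g3]] := pos_eventually o3 h3.
exists (Num.min s1 (Num.min s2 s3)); set s := Num.min _ _.
have sp : 0 < s by rewrite /s !lt_min s1p s2p s3p.
have [l1 [l2 l3]] : s <= s1 /\ s <= s2 /\ s <= s3.
  by rewrite /s !ge_min !lexx !orbT.
split=> //; apply: (@tri_int K A B C) => //.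
- by have := g1 s sp l1; rewrite /orient /=; congr (0 < _); ring.
- by have := g2 s sp l2; rewrite /orient /=; congr (0 < _); ring.
- by have := g3 s sp l3; rewrite /orient /=; congr (0 < _); ring.
Qed.

Lemma edge_ray K A B C p (k : R) (e : pt) : conv2 K -> K A -> K B -> K C ->
  0 < orient A B C -> 0 < k < 1 ->
  p = ((1 - k) * A.1 + k * B.1, (1 - k) * A.2 + k * B.2) ->
  0 < (B.1 - A.1) * e.2 - (B.2 - A.2) * e.1 ->
  exists s : R, 0 < s /\ int2 K (p.1 + s * e.1, p.2 + s * e.2).
Proof.
move=> cK KA KB KC o0 k01 pE h.
have h0 : orient A B p = 0 by rewrite pE /orient /=; ring.
have h1 : orient B C p = (1 - k) * orient A B C by rewrite pE /orient /=; ring.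
have h2 : orient C A p = k * orient A B C by rewrite pE /orient /=; ring.
have g1 : 0 < orient B C p by rewrite h1 mulr_gt0 //; lra.
have g2 : 0 < orient C A p by rewrite h2 mulr_gt0 //; lra.
apply: (@ray_int K A B C p e) => //; try exact: ltW.
- by rewrite h0.
- by right.
- by left.
- by left.
Qed.

Lemma int2_ray K p (e : pt) : int2 K p ->
  exists s : R, 0 < s /\ int2 K (p.1 + s * e.1, p.2 + s * e.2).
Proof.
move=> [d [d0 Kd]]; set m := 1 + `|e.1| + `|e.2|.
have m0 : 0 < m.
  by have := normr_ge0 e.1; have := normr_ge0 e.2; rewrite /m; lra.
have [s [s0 sE]] : exists s : R, 0 < s /\ s * m = d / 2.
  by exists (d / (2 * m)); rewrite divr_gt0 ?mulr_gt0 //; split=> //; field; rewrite gt_eqF.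
exists s; split=> //.
have n1 : `|s * e.1| <= d / 2.
  rewrite normrM gtr0_norm // -sE ler_pM2l // /m; have := normr_ge0 e.2; lra.
have n2 : `|s * e.2| <= d / 2.
  rewrite normrM gtr0_norm // -sE ler_pM2l // /m; have := normr_ge0 e.1; lra.
exists (d / 2); split; first lra.
move=> q /= h1 h2; apply: Kd.
  rewrite (_ : _ - _ = q.1 - (p.1 + s * e.1) + s * e.1); last ring.
  by apply: le_lt_trans (ler_normD _ _) _; lra.
rewrite (_ : _ - _ = q.2 - (p.2 + s * e.2) + s * e.2); last ring.
by apply: le_lt_trans (ler_normD _ _) _; lra.
Qed.

End PlaneGeometry.

(** * Perturbing a position *)

Section Perturbation.
Variable R : realFieldType.
Local Notation pt := (R * R)%type.
Implicit Types (K L : pt -> Prop) (p q z : pt).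

(* Compactness, as the uniformity principle it is used for. *)
Definition cpt2 L := forall P : R -> pt -> Prop,
  (forall z, L z -> exists d : R, 0 < d /\
     near2 z (fun q => forall s, 0 < s -> s < d -> P s q)) ->
  exists d : R, 0 < d /\ forall s q, 0 < s -> s < d -> L q -> P s q.

Definition aff (a b c d e f : R) p : pt :=
  (a * p.1 + b * p.2 + e, c * p.1 + d * p.2 + f).

Definition isaff (f : pt -> pt) := exists a b c d e g : R,
  a * d - b * c != 0 /\ forall p, f p = aff a b c d e g p.

(** The position is [f K] inside [L] inside [r f K + c], with [r] of either sign. Since [r != 1] the
    outer homothety has a fixed point; moving it to the origin gives the pure dilation that
    [grunbaum_distance] asks for. *)
Definition ratio_lt2 K L := exists (f : pt -> pt) (r : R) (c : pt),
  [/\ isaff f, `|r| < 2, r != 1, forall p, K p -> L (f p) &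
      forall z, L z -> exists p, K p /\
        z = (r * (f p).1 + c.1, r * (f p).2 + c.2)].

End Perturbation.
Section Perturbation2.
Variable R : realFieldType.
Local Notation pt := (R * R)%type.
Implicit Types (K L : pt -> Prop) (p q z : pt).

Lemma conv_int K p q (t : R) : conv2 K -> K p -> int2 K q -> 0 < t -> t <= 1 ->
  int2 K ((1 - t) * p.1 + t * q.1, (1 - t) * p.2 + t * q.2).
Proof.
move=> cK Kp [d [d0 Kd]] t0 t1; exists (t * d); split; first exact: mulr_gt0.
move=> w /= h1 h2.
have tn : t != 0 by rewrite gt_eqF.
pose v : pt := (q.1 + (w.1 - ((1 - t) * p.1 + t * q.1)) / t,
                q.2 + (w.2 - ((1 - t) * p.2 + t * q.2)) / t).
have Kv : K v.
  apply: Kd; rewrite /v /= addrAC subrr add0r normrM normfV (gtr0_norm t0).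
    by rewrite ltr_pdivrMr // [d * t]mulrC.
  by rewrite ltr_pdivrMr // [d * t]mulrC.
have t01 : 0 <= t <= 1 by rewrite ltW.
have := cK _ _ t Kp Kv t01.
by congr K; rewrite /v /= [RHS]surjective_pairing; congr pair; field.
Qed.

(** The uniformity principle is applied to [s * |l q| < 1], true near each point for all small [s];
    the reciprocal of a common [s] is the bound. *)
Lemma cpt2_bounded L (a b c : R) : cpt2 L ->
  exists B : R, 0 < B /\ forall z, L z -> `|a * z.1 + b * z.2 + c| <= B.
Proof.
move=> cL; have [z Lz|d [d0 Pd]] := cL (fun s q => s * `|a * q.1 + b * q.2 + c| < 1).
  set V := 1 + `|a| + `|b| + `|a * z.1 + b * z.2 + c|.
  have V0 : 0 < V.
    by rewrite /V; have := normr_ge0 a; have := normr_ge0 b;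
      have := normr_ge0 (a * z.1 + b * z.2 + c); lra.
  exists V^-1; split; first by rewrite invr_gt0.
  exists 1; split=> // q h1 h2 s s0 sV.
  have : s * V < 1 by rewrite -ltr_pdivlMr // div1r.
  apply: le_lt_trans; rewrite ler_pM2l // /V.
  have -> : a * q.1 + b * q.2 + c =
    a * (q.1 - z.1) + b * (q.2 - z.2) + (a * z.1 + b * z.2 + c) by ring.
  apply: le_trans (ler_normD _ _) _; rewrite lerD2r.
  apply: le_trans (ler_normD _ _) _; rewrite !normrM.
  have : `|a| * `|q.1 - z.1| <= `|a| * 1 by rewrite ler_wpM2l // ltW.
  have : `|b| * `|q.2 - z.2| <= `|b| * 1 by rewrite ler_wpM2l // ltW.
  by lra.
have d20 : 0 < d / 2 by lra.
exists (d / 2)^-1; split; first by rewrite invr_gt0.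
move=> z Lz; have := Pd (d / 2) z d20 _ Lz => /(_ _)/ltW.
by rewrite -(ler_pdivlMl _ _ d20) mulr1; apply; lra.
Qed.

Lemma near2_aff a b c d e f z (P : pt -> Prop) :
  near2 (aff a b c d e f z) P -> near2 z (fun q => P (aff a b c d e f q)).
Proof.
move=> [h [h0 Ph]].
set V := 1 + `|a| + `|b| + `|c| + `|d|.
have na := normr_ge0 a; have nb := normr_ge0 b; have nc := normr_ge0 c.
have nd := normr_ge0 d.
have V0 : 0 < V by rewrite /V; lra.
exists (h / V); split; first exact: divr_gt0.
move=> q h1 h2; set m := h / V in h1 h2.
have mV : m * V = h by rewrite /m divfK // gt_eqF.
have m0 : 0 < m by exact: divr_gt0.
have bnd (x y : R) : `|x| + `|y| + 1 <= V ->
    `|x * (q.1 - z.1) + y * (q.2 - z.2)| < h.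
  move=> xy; apply: le_lt_trans (ler_normD _ _) _; rewrite !normrM.
  have k1 : `|x| * `|q.1 - z.1| <= `|x| * m by rewrite ler_wpM2l // ltW.
  have k2 : `|y| * `|q.2 - z.2| <= `|y| * m by rewrite ler_wpM2l // ltW.
  have k3 : m * (`|x| + `|y| + 1) <= m * V by rewrite ler_pM2l.
  by lra.
apply: Ph => /=.
  have -> : a * q.1 + b * q.2 + e - (a * z.1 + b * z.2 + e) =
    a * (q.1 - z.1) + b * (q.2 - z.2) by ring.
  by apply: bnd; rewrite /V; lra.
have -> : c * q.1 + d * q.2 + f - (c * z.1 + d * z.2 + f) =
    c * (q.1 - z.1) + d * (q.2 - z.2) by ring.
by apply: bnd; rewrite /V; lra.
Qed.

Lemma near2_near p (P : pt -> Prop) : near2 p P -> near2 p (fun q => near2 q P).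
Proof.
move=> [d [d0 Pd]]; exists (d / 2); split; first lra.
move=> q h1 h2; exists (d / 2); split; first lra.
move=> w h3 h4; apply: Pd.
  rewrite (_ : _ - _ = (w.1 - q.1) + (q.1 - p.1)); last ring.
  by apply: le_lt_trans (ler_normD _ _) _; lra.
rewrite (_ : _ - _ = (w.2 - q.2) + (q.2 - p.2)); last ring.
by apply: le_lt_trans (ler_normD _ _) _; lra.
Qed.

Lemma choose_small (s0 eta T D : R) : 0 < s0 -> 0 < eta ->
  exists x : R, [/\ 0 < x, x <= 1, x * s0 * (1 + `|T|) <= 1 / 4,
    16 * x * s0 ^+ 2 * (1 + `|D|) <= 1 &
    16 * x * s0 ^+ 2 * (1 + `|D|) <= eta].
Proof.
move=> s00 e0.
have T0 := normr_ge0 T; have D0 := normr_ge0 D.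
set A := s0 * (1 + `|T|); set B := 16 * s0 ^+ 2 * (1 + `|D|).
have A0 : 0 < A by rewrite mulr_gt0 //; lra.
have B0 : 0 < B by rewrite !mulr_gt0 ?exprn_gt0 //; lra.
have e1 : 0 < eta^-1 by rewrite invr_gt0.
(* Every requirement is a summand of [N], so [x = N^-1] meets all of them together. *)
set N := 1 + 4 * A + B + B * eta^-1.
have Be : 0 < B * eta^-1 by rewrite mulr_gt0.
have N0 : 0 < N by rewrite /N; lra.
have x0 : 0 < N^-1 by rewrite invr_gt0.
have xN : N^-1 * N = 1 by rewrite mulVf // gt_eqF.
have xA : 0 < N^-1 * A by rewrite mulr_gt0.
have xB : 0 < N^-1 * B by rewrite mulr_gt0.
have xBe : 0 < N^-1 * (B * eta^-1) by rewrite mulr_gt0.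
have xN' : N^-1 + 4 * (N^-1 * A) + N^-1 * B + N^-1 * (B * eta^-1) = 1.
  have NE : N = 1 + 4 * A + B + B * eta^-1 by [].
  by move: xN; rewrite [X in _ * X = _]NE => xN; rewrite -[RHS]xN; ring.
exists N^-1; split=> //.
- by lra.
- by rewrite -mulrA -/A; lra.
- by rewrite (_ : _ * _ = N^-1 * B); [lra|rewrite /B; ring].
- rewrite (_ : _ * (1 + _) = N^-1 * B); last by rewrite /B; ring.
  have : N^-1 * (B * eta^-1) <= 1 by lra.
  by rewrite mulrA ler_pdivrMr // mul1r.
Qed.

(** Put [N = I - M]. Then [u = 1 + 2 h tr N] and [w = u + (2 h)^2 det N], and Cayley-Hamilton
    collapses [(I - (2 h / u) N) (I + 2 h N)] to [(w / u) I]. [F] is the first coordinate of the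
    perturbed map after the enlarged half point; the second coordinate follows by exchanging the
    indices. *)
Lemma pert_id (m11 m12 m21 m22 c1 c2 t1 t2 b h v z1 z2 u w : R) :
  u = 1 + 2 * h * (2 - m11 - m22) ->
  w = u + (2 * h) ^+ 2 * ((1 - m11) * (1 - m22) - m12 * m21) ->
  u != 0 -> w != 0 -> v != 0 ->
  let F x y := (1 - 2 * h / u * (1 - m11)) * (v * ((t1 - x) / 2 + h * (m11 * x + m12 * y - x + c1)))
   + 2 * h / u * m12 * (v * ((t2 - y) / 2 + h * (m21 * x + m22 * y - y + c2))) + b in
  z1 = - (2 * u / (w * v)) * F z1 z2 + - - (2 * u / (w * v)) * F 0 0.
Proof.
move=> uE wE un wn vn F; rewrite /F.
suff -> : forall A B C D,
   - (2 * u / (w * v)) * ((1 - 2 * h / u * (1 - m11)) * (v * A) + 2 * h / u * m12 * (v * B) + b)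
   + - - (2 * u / (w * v)) * ((1 - 2 * h / u * (1 - m11)) * (v * C) + 2 * h / u * m12 * (v * D) + b)
  = - 2 / w * ((u - 2 * h * (1 - m11)) * (A - C) + 2 * h * m12 * (B - D)).
  apply: (mulfI wn). rewrite mulrA.
  rewrite (_ : w * (-2 / w) = - 2); last by field.
  rewrite wE uE. by field.
by move=> A B C D; field; rewrite ?un ?wn ?vn.
Qed.

(** [w] differs from [u] by a term quadratic in [x], whereas the factor [1 + x * eta] gains
    linearly; for small [x] this makes [2 u / (w (1 + x eta))] less than 2. The bound [e <= u] makes
    the weight [e / u] of [T] at most 1. *)
Lemma choose_pert (T D s0 eta : R) : 0 < s0 -> 0 < eta ->
  exists x, 0 < x <= 1 /\
    let e := 2 * x * s0 in let u := 1 + e * T in let w := u + e ^+ 2 * D in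
    [/\ 0 < e, e <= u, 0 < w & u < w * (1 + x * eta)].
Proof.
move=> s00 eta0; have [x [x0 x1 xT xD xe]] := choose_small T D s00 eta0.
exists x; split; first by rewrite x0.
move=> ee u w.
have xs : 0 < x * s0 by rewrite mulr_gt0.
have ee0 : 0 < ee by rewrite /ee; lra.
have eT : `|ee * T| <= 1 / 2 - ee.
  by rewrite normrM (gtr0_norm ee0); move: xT; rewrite /ee; lra.
have eD : `|ee ^+ 2 * D| <= x / 4.
  have := normr_ge0 D => D0.
  rewrite normrM (@ger0_norm _ (ee ^+ 2)) ?sqr_ge0 //.
  have : x * (16 * x * s0 ^+ 2 * (1 + `|D|)) <= x * 1 by rewrite ler_pM2l.
  have : 0 < x ^+ 2 * s0 ^+ 2 by rewrite mulr_gt0 // exprn_gt0.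
  by rewrite /ee; lra.
have eD2 : `|ee ^+ 2 * D| < x * eta / 4.
  have := normr_ge0 D => D0.
  rewrite normrM (@ger0_norm _ (ee ^+ 2)) ?sqr_ge0 //.
  have : x * (16 * x * s0 ^+ 2 * (1 + `|D|)) <= x * eta by rewrite ler_pM2l.
  have : 0 < x ^+ 2 * s0 ^+ 2 by rewrite mulr_gt0 // exprn_gt0.
  by rewrite /ee; lra.
have [uu1 uu2] : ee + 1 / 2 <= u /\ u <= 2.
  by move: eT; rewrite ler_norml /u => /andP[h1 h2]; split; lra.
have [w1 w2] : 1 / 4 < w /\ u - x * eta / 4 < w.
  move: eD eD2; rewrite ltr_norml ler_norml /w => /andP[h1 h2] /andP[h3 h4].
  by split; lra.
have xeta : 0 < x * eta by rewrite mulr_gt0.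
split=> //; first by lra.
  by lra.
  have : 1 / 4 * (x * eta) < w * (x * eta) by rewrite ltr_pM2r.
  by lra.
Qed.

Lemma ratio_lt2_pert K L (m11 m12 m21 m22 b1 b2 c1 c2 t1 t2 : R) :
  conv2 K -> conv2 L -> cpt2 L ->
  (forall p, K p -> L p) ->
  (forall p, K p -> L (aff m11 m12 m21 m22 b1 b2 p)) ->
  (forall z, L z -> K ((t1 - z.1) / 2, (t2 - z.2) / 2)) ->
  (forall z, L z -> exists s : R, 0 < s /\
     int2 K ((t1 - z.1) / 2 + s * (m11 * z.1 + m12 * z.2 - z.1 + c1),
             (t2 - z.2) / 2 + s * (m21 * z.1 + m22 * z.2 - z.2 + c2))) ->
  ratio_lt2 K L.
Proof.
move=> cK cL pL KL TL zK zint.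
pose g s : pt -> pt := aff (s * (m11 - 1) - 1 / 2) (s * m12) (s * m21)
   (s * (m22 - 1) - 1 / 2) (t1 / 2 + s * c1) (t2 / 2 + s * c2).
have gE s q : g s q = ((t1 - q.1) / 2 + s * (m11 * q.1 + m12 * q.2 - q.1 + c1),
             (t2 - q.2) / 2 + s * (m21 * q.1 + m22 * q.2 - q.2 + c2)).
  by rewrite /g /aff; congr pair; field.
(* A good [s] at one point serves all smaller values nearby, because [g s' q] lies between [g 0 q],
   a point of [K], and the interior point [g s q]. Compactness then yields one [s0] for all of
   [L]. *)
have [s0 [s00 gint]] : exists s0 : R, 0 < s0 /\ forall q, L q -> int2 K (g s0 q).
  have [z Lz|d [d0 Pd]] := pL (fun s q => L q -> int2 K (g s q)); last first.
    by exists (d / 2); split=> [|q Lq]; [lra|apply: Pd => //; lra].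
  have [s [sp]] := zint z Lz; rewrite -gE => si.
  exists s; split=> //.
  apply: near2_sub (near2_aff (near2_near si)) => q gi s' s'0 s's Lq.
  have s'1 : 0 < s' / s by rewrite divr_gt0.
  have s'2 : s' / s <= 1 by rewrite ler_pdivrMr // mul1r ltW.
  have := conv_int cK (zK _ Lq) gi s'1 s'2.
  by congr (int2 K); rewrite gE /aff /=; congr pair; field; rewrite gt_eqF.
(* A second use of compactness: a single radius [d] around all the interior points [g s0 q]. *)
have [d [d0 gd]] : exists d : R, 0 < d /\ forall q, L q -> forall w,
    `|w.1 - (g s0 q).1| <= d -> `|w.2 - (g s0 q).2| <= d -> K w.
  have [z Lz|d [d0 Pd]] := pL (fun s q => forall w,
    `|w.1 - (g s0 q).1| <= s -> `|w.2 - (g s0 q).2| <= s -> K w); last first.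
    exists (d / 2); split=> [|q Lq]; first lra.
    by move=> w; apply: Pd => //; lra.
  have [h [h0 Kh]] := gint z Lz.
  exists (h / 2); split=> [|]; first lra.
  apply: (@near2_aff _ _ _ _ _ _ z (fun v : pt => forall s, 0 < s -> s < h / 2 ->
    forall w : pt, `|w.1 - v.1| <= s -> `|w.2 - v.2| <= s -> K w)).
  exists (h / 2); split=> [|v v1 v2 s s1 s2 w w1 w2]; first lra.
  apply: Kh.
    rewrite (_ : _ - _ = (w.1 - v.1) + (v.1 - (g s0 z).1)); last ring.
    by apply: le_lt_trans (ler_normD _ _) _; lra.
  rewrite (_ : _ - _ = (w.2 - v.2) + (v.2 - (g s0 z).2)); last ring.
  by apply: le_lt_trans (ler_normD _ _) _; lra.
have [B1 [B10 HB1]] := cpt2_bounded (- 1 / 2) 0 (t1 / 2) pL.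
have [B2 [B20 HB2]] := cpt2_bounded 0 (- 1 / 2) (t2 / 2) pL.
have [B3 [B30 HB3]] := cpt2_bounded (s0 * (m11 - 1)) (s0 * m12) (s0 * c1) pL.
have [B4 [B40 HB4]] := cpt2_bounded (s0 * m21) (s0 * (m22 - 1)) (s0 * c2) pL.
set B := B1 + B2 + B3 + B4.
have B0 : 0 < B by rewrite /B; lra.
(* [B] bounds both coordinates of [g (x * s0) z] for [x <= 1], so [eta] is the relative enlargement
   that the radius [d] pays for. *)
pose eta := d / B.
have eta0 : 0 < eta by exact: divr_gt0.
have etaB : eta * B = d by rewrite /eta divfK // gt_eqF.
pose T := 2 - m11 - m22; pose D := (1 - m11) * (1 - m22) - m12 * m21.
have [x [/andP[x0 x1]]] := choose_pert T D s00 eta0; cbv zeta.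
set ee := 2 * x * s0; set u := 1 + ee * T; set w := u + ee ^+ 2 * D.
move=> [ee0 eu w0 key].
have u0 : 0 < u by exact: lt_le_trans ee0 eu.
have v0 : 0 < 1 + x * eta by exact: (addr_gt0 ltr01 (mulr_gt0 x0 eta0)).
(* Both values are dictated by [pert_id]: this [ep] cancels the multiple of [I - M] in the product
   of the linear parts. *)
pose ep := ee / u; pose r := - (2 * u / (w * (1 + x * eta))).
have ep01 : 0 <= ep <= 1.
  apply/andP; split; first by rewrite divr_ge0 // ltW.
  by rewrite ler_pdivrMr // mul1r.
have r0 : r < 0 by rewrite oppr_lt0 divr_gt0 ?mulr_gt0.
have wv0 : 0 < w * (1 + x * eta) by rewrite mulr_gt0.
pose f := aff (1 - ep * (1 - m11)) (ep * m12) (ep * m21) (1 - ep * (1 - m22))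
  (ep * b1) (ep * b2).
pose k (z : pt) : pt := ((1 + x * eta) * (g (x * s0) z).1,
                         (1 + x * eta) * (g (x * s0) z).2).
exists f, r, (- r * (f (k (0, 0))).1, - r * (f (k (0, 0))).2).
have un : u != 0 by rewrite gt_eqF.
have wn : w != 0 by rewrite gt_eqF.
have vn : 1 + x * eta != 0 by rewrite gt_eqF.
split.
- exists (1 - ep * (1 - m11)), (ep * m12), (ep * m21), (1 - ep * (1 - m22)),
    (ep * b1), (ep * b2); split=> //.
  have -> : (1 - ep * (1 - m11)) * (1 - ep * (1 - m22)) - ep * m12 * (ep * m21)
     = w / u ^+ 2.
    by move: un; rewrite /ep /w /u /D /T => un; field.
  by rewrite mulf_neq0 // invr_eq0 expf_neq0.
- rewrite ltr0_norm // opprK ltr_pdivrMr //; lra.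
- by rewrite lt_eqF //; lra.
- move=> p Kp; have := cL _ _ ep (KL p Kp) (TL p Kp) ep01.
  by congr L; rewrite /f /aff /=; congr pair; ring.
move=> z Lz; exists (k z); split; last first.
  have uE : u = 1 + 2 * (x * s0) * (2 - m11 - m22) by rewrite /u /ee /T; ring.
  have wE : w = u + (2 * (x * s0)) ^+ 2 * ((1 - m11) * (1 - m22) - m12 * m21).
    by rewrite /w /ee /D; ring.
  have uE' : u = 1 + 2 * (x * s0) * (2 - m22 - m11) by rewrite uE; ring.
  have wE' : w = u + (2 * (x * s0)) ^+ 2 * ((1 - m22) * (1 - m11) - m21 * m12).
    by rewrite wE; ring.
  rewrite [LHS]surjective_pairing; congr pair.
    rewrite [LHS](pert_id c1 c2 t1 t2 (ep * b1) z.1 z.2 uE wE un wn vn).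
    by rewrite /r /f /k !gE /aff /ep /ee /=; congr (_ * _ + _ * _); ring.
  rewrite [LHS](pert_id c2 c1 t2 t1 (ep * b2) z.2 z.1 uE' wE' un wn vn).
  by rewrite /r /f /k !gE /aff /ep /ee /=; congr (_ * _ + _ * _); ring.
(* [k z] is the convex combination, with weight [x], of [g 0 z] and of [g s0 z] displaced by
   [(e1, e2)]; the displacement is at most [d]. *)
pose e1 := eta * (g (x * s0) z).1; pose e2 := eta * (g (x * s0) z).2.
have Kw : K ((g s0 z).1 + e1, (g s0 z).2 + e2).
  apply: (gd z Lz) => /=; rewrite addrAC subrr add0r normrM (gtr0_norm eta0) -etaB
    ler_pM2l // gE /=.
    rewrite (_ : _ + _ = (- 1 / 2 * z.1 + 0 * z.2 + t1 / 2) +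
      x * (s0 * (m11 - 1) * z.1 + s0 * m12 * z.2 + s0 * c1)); last by field.
    apply: le_trans (ler_normD _ _) _; rewrite normrM (gtr0_norm x0).
    have := HB1 z Lz; have h := HB3 z Lz.
    have : x * `|s0 * (m11 - 1) * z.1 + s0 * m12 * z.2 + s0 * c1| <= 1 * B3.
      by rewrite ler_pM // ltW.
    by rewrite /B; lra.
  rewrite (_ : _ + _ = (0 * z.1 - 1 / 2 * z.2 + t2 / 2) +
      x * (s0 * m21 * z.1 + s0 * (m22 - 1) * z.2 + s0 * c2)); last by field.
  apply: le_trans (ler_normD _ _) _; rewrite normrM (gtr0_norm x0).
  have := HB2 z Lz; have h := HB4 z Lz.
  have : x * `|s0 * m21 * z.1 + s0 * (m22 - 1) * z.2 + s0 * c2| <= 1 * B4.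
    by rewrite ler_pM // ltW.
  rewrite /B (_ : - 1 / 2 * z.2 = - (1 / 2 * z.2)); last by field.
  by lra.
have x01 : 0 <= x <= 1 by rewrite ltW.
have := cK _ _ x (zK z Lz) Kw x01.
by congr K; rewrite /k /e1 /e2 !gE /=; congr pair; field.
Qed.

End Perturbation2.

(** * Affine invariance *)

Section AffineInvariance.
Variable R : realFieldType.
Local Notation pt := (R * R)%type.
Implicit Types (K L : pt -> Prop) (p q z : pt) (f g h : pt -> pt).

Lemma isaff_id : isaff (fun p : pt => p).
Proof.
exists 1, 0, 0, 1, 0, 0; split; first by rewrite !mulr1 mul0r subr0 oner_neq0.
by move=> [x y]; rewrite /aff /=; congr pair; ring.
Qed.

Lemma isaff_comp f g : isaff f -> isaff g -> isaff (fun p => f (g p)).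
Proof.
move=> [a [b [c [d [e [h [D fE]]]]]]] [a' [b' [c' [d' [e' [h' [D' gE]]]]]]].
exists (a * a' + b * c'), (a * b' + b * d'), (c * a' + d * c'), (c * b' + d * d').
exists (a * e' + b * h' + e), (c * e' + d * h' + h); split; last first.
  by move=> p; rewrite fE gE /aff /=; congr pair; ring.
rewrite (_ : _ - _ = (a * d - b * c) * (a' * d' - b' * c')); last by ring.
exact: mulf_neq0.
Qed.

Lemma isaff_inv f : isaff f -> exists g, [/\ isaff g, cancel f g & cancel g f].
Proof.
move=> [a [b [c [d [e [h [D fE]]]]]]]; set D0 := _ - _ in D.
have DE : D0 = a * d - b * c by [].
exists (aff (d / D0) (- b / D0) (- c / D0) (a / D0)
  ((b * h - d * e) / D0) ((c * e - a * h) / D0)); split.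
- exists (d / D0), (- b / D0), (- c / D0), (a / D0),
    ((b * h - d * e) / D0), ((c * e - a * h) / D0); split=> //.
  rewrite (_ : _ - _ = D0^-1); first by rewrite invr_neq0.
  by rewrite DE; move: D; rewrite DE => D; field.
- move=> [x y]; rewrite fE /aff /=; congr pair.
    by rewrite DE; move: D; rewrite DE => D; field.
  by rewrite DE; move: D; rewrite DE => D; field.
- move=> [x y]; rewrite fE /aff /=; congr pair.
    by rewrite DE; move: D; rewrite DE => D; field.
  by rewrite DE; move: D; rewrite DE => D; field.
Qed.

Lemma isaff_scale f (r : R) (c : pt) : isaff f -> exists c' : pt, forall p,
  f (r * p.1 + c.1, r * p.2 + c.2) = (r * (f p).1 + c'.1, r * (f p).2 + c'.2).
Proof.
move=> [a [b [c0 [d [e [h [D fE]]]]]]].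
exists (a * c.1 + b * c.2 + (1 - r) * e, c0 * c.1 + d * c.2 + (1 - r) * h).
by move=> p; rewrite !fE /aff /=; congr pair; ring.
Qed.

Lemma ratio_lt2_pull K L g h : isaff g -> isaff h ->
  ratio_lt2 (fun p => K (g p)) (fun p => L (h p)) -> ratio_lt2 K L.
Proof.
move=> ag ah [f [r [c [af r2 r1 KL LK]]]].
have [g' [ag' gK g'K]] := isaff_inv ag; have [h' [ah' hK h'K]] := isaff_inv ah.
have [c' hc] := isaff_scale r c ah.
exists (fun p => h (f (g' p))), r, c'; split=> //.
- exact: (isaff_comp ah (isaff_comp af ag')).
- by move=> p Kp; apply: KL; rewrite g'K.
move=> z Lz; have [|p [Kp zE]] := LK (h' z); first by rewrite h'K.
by exists (g p); split=> //; rewrite gK -hc -zE h'K.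
Qed.

Lemma isaff_homothety (r : R) (c : pt) : r != 0 ->
  isaff (fun p : pt => (r * p.1 + c.1, r * p.2 + c.2)).
Proof.
move=> r0; exists r, 0, 0, r, c.1, c.2; split.
  by rewrite mul0r subr0 mulf_neq0.
by move=> p; rewrite /aff; congr pair; ring.
Qed.

(** The inverse of the outer homothety after [f] places [L] inside [K], and the same [r] covers [K].
    This lets two bodies exchange roles once a positive ratio is known. *)
Lemma ratio_lt2_sym_pos K L f (r : R) (c : pt) : isaff f -> 1 < r -> r < 2 ->
  (forall p, K p -> L (f p)) ->
  (forall z, L z -> exists p, K p /\ z = (r * (f p).1 + c.1, r * (f p).2 + c.2)) ->
  ratio_lt2 L K.
Proof.
move=> af r1 r2 KL LK.
have rn : r != 0 by rewrite gt_eqF //; lra.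
have [g [ag fK gK]] := isaff_inv (isaff_comp (isaff_homothety c rn) af).
have [g' [ag' fK' gK']] := isaff_inv af.
have [c' gc] := isaff_scale r c ag.
exists g, r, c'; split=> //.
- by rewrite gtr0_norm //; lra.
- by rewrite gt_eqF.
- by move=> z Lz; have [p [Kp ->]] := LK z Lz; rewrite (fK p).
by move=> p Kp; exists (f p); split; [exact: KL|rewrite -gc (fK p)].
Qed.

Lemma conv2_pull K h : isaff h -> conv2 K -> conv2 (fun p => K (h p)).
Proof.
move=> [a [b [c [d [e [k [D hE]]]]]]] cK p q t Kp Kq t01.
have := cK _ _ t Kp Kq t01; congr K; rewrite !hE /aff /=; congr pair; ring.
Qed.

Lemma int2_pull K h p : isaff h -> int2 K (h p) -> int2 (fun p => K (h p)) p.
Proof.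
move=> [a [b [c [d [e [k [D hE]]]]]]]; rewrite hE => /near2_aff.
by apply: near2_sub => q; rewrite hE.
Qed.

Lemma near2_pull h z (P : pt -> Prop) : isaff h -> near2 (h z) P ->
  near2 z (fun q => P (h q)).
Proof.
move=> [a [b [c [d [e [k [D hE]]]]]]]; rewrite hE => /near2_aff.
by apply: near2_sub => q; rewrite hE.
Qed.

Lemma cpt2_pull L h : isaff h -> cpt2 L -> cpt2 (fun p => L (h p)).
Proof.
move=> ah cL P Pn; have [g [ag hK gK]] := isaff_inv ah.
have [z Lz|d [d0 Pd]] := cL (fun s q => P s (g q)).
  have [|d [d0 Pd]] := Pn (g z); first by rewrite gK.
  by exists d; split=> //; exact: (near2_pull ag Pd).
exists d; split=> // s q s0 sd Lq.
by have := Pd s _ s0 sd Lq; rewrite hK.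
Qed.

(** The triangle in barycentric form, stating only that [K] is inside it; the other inclusion comes
    from convexity of [K]. *)
Definition tri2 K := exists A B C : pt, [/\ orient A B C != 0, K A, K B, K C &
  forall p, K p -> exists a b c : R, [/\ 0 <= a, 0 <= b, 0 <= c, a + b + c = 1 &
    p = (a * A.1 + b * B.1 + c * C.1, a * A.2 + b * B.2 + c * C.2)]].

Lemma tri2_pull K h : isaff h -> tri2 (fun p => K (h p)) -> tri2 K.
Proof.
move=> ah [A [B [C [oABC KA KB KC Kp]]]]; have [g [ag hK gK]] := isaff_inv ah.
move: ah => [a [b [c [d [e [k [D hE]]]]]]].
exists (h A), (h B), (h C); split=> //.
  rewrite (_ : orient _ _ _ = (a * d - b * c) * orient A B C).
    exact: mulf_neq0.
  by rewrite !hE /orient /aff /=; ring.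
move=> p; rewrite -(gK p) => /Kp[x [y [w [x0 y0 w0 s pE]]]].
exists x, y, w; split=> //.
rewrite {1}pE !hE /aff /=; have -> : x = 1 - y - w by lra.
by congr pair; ring.
Qed.

Lemma tri2_orient K A B C : 0 < orient A B C -> K A -> K B -> K C ->
  (forall p, K p -> [/\ 0 <= orient A B p, 0 <= orient B C p & 0 <= orient C A p]) ->
  tri2 K.
Proof.
move=> o KA KB KC Kp; have on : orient A B C != 0 by rewrite gt_eqF.
exists A, B, C; split=> // p /Kp[or1 or2 or3].
exists (orient B C p / orient A B C), (orient C A p / orient A B C),
  (orient A B p / orient A B C).
split; try by rewrite divr_ge0 // ltW.
  by move: on; rewrite /orient => on; field.
by rewrite [LHS]surjective_pairing; congr pair;
  move: on; rewrite /orient => on; field.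
Qed.

End AffineInvariance.

(** * Three contact pairs *)

Section ThreeContacts.
Variable R : realType.
Local Notation pt := (R * R)%type.
Implicit Types (K L : pt -> Prop) (p q z k : pt).

(* With three contact pairs, [-2 u_1], [-2 u_2], [-2 u_3] are the points
   [(2, 0)], [(0, 2)], [(0, 0)] in suitable affine coordinates. *)
Definition conf3 K L := [/\ conv2 K, conv2 L, cpt2 L, forall p, K p -> L p &
  [/\ K (1, 1), K (0, 1), K (1, 0) &
      forall z, L z -> [/\ 0 <= z.1, 0 <= z.2 & z.1 + z.2 <= 2]]].

Lemma conf3_half K L z : conf3 K L -> L z -> K ((2 - z.1) / 2, (2 - z.2) / 2).
Proof.
move=> [cK _ _ _ [K3 K1 K2 Lb]] /Lb[z1 z2 z3].
by apply: (@tri_in _ K (1, 1) (0, 1) (1, 0)) => //; rewrite /orient /=; lra.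
Qed.

Lemma conf3_ray K L z (e : pt) : conf3 K L -> L z ->
  0 < z.2 \/ e.2 < 0 -> z.1 + z.2 < 2 \/ 0 < e.1 + e.2 -> 0 < z.1 \/ e.1 < 0 ->
  exists s : R, 0 < s /\
    int2 K ((2 - z.1) / 2 + s * e.1, (2 - z.2) / 2 + s * e.2).
Proof.
move=> [cK _ _ _ [K3 K1 K2 Lb]] /Lb[z1 z2 z3] h1 h2 h3.
apply: (@ray_int _ K (1, 1) (0, 1) (1, 0) ((2 - z.1) / 2, (2 - z.2) / 2) e) => //;
  rewrite /orient /=.
1-3: lra.
- by case: h1 => h; [left|right]; lra.
- by case: h2 => h; [left|right]; lra.
- by case: h3 => h; [left|right]; lra.
Qed.

(** A point of [K] beyond the side from [(1, 0)] to [(1, 1)] makes the open side interior to [K].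
    The points of [L] inside the corresponding side of [-2U] then impose no condition on [e]. The
    next two lemmas treat the other sides. *)
Lemma conf3_side1 K L k z (e : pt) : conf3 K L -> K k -> 1 < k.1 ->
  z.1 = 0 -> 0 < z.2 -> z.2 < 2 -> exists s : R, 0 < s /\
    int2 K ((2 - z.1) / 2 + s * e.1, (2 - z.2) / 2 + s * e.2).
Proof.
move=> [cK _ _ _ [K3 K1 K2 Lb]] Kk k1 z1 z2 z3.
apply: (@int2_ray _ K ((2 - z.1) / 2, (2 - z.2) / 2)).
have pE : ((2 - z.1) / 2, (2 - z.2) / 2) = ((1 - (1 - z.2 / 2)) * ((1, 0) : pt).1 + (1 - z.2 / 2) * ((1, 1) : pt).1,
    (1 - (1 - z.2 / 2)) * ((1, 0) : pt).2 + (1 - z.2 / 2) * ((1, 1) : pt).2) :> pt.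
  by congr (_, _) => /=; lra.
by apply: (edge_int (C := (0, 1)) (D := k) cK _ _ _ _ _ _ _ pE) => //;
  rewrite /orient /=; lra.
Qed.

Lemma conf3_side2 K L k z (e : pt) : conf3 K L -> K k -> 1 < k.2 ->
  z.2 = 0 -> 0 < z.1 -> z.1 < 2 -> exists s : R, 0 < s /\
    int2 K ((2 - z.1) / 2 + s * e.1, (2 - z.2) / 2 + s * e.2).
Proof.
move=> [cK _ _ _ [K3 K1 K2 Lb]] Kk k1 z1 z2 z3.
apply: (@int2_ray _ K ((2 - z.1) / 2, (2 - z.2) / 2)).
have pE : ((2 - z.1) / 2, (2 - z.2) / 2) = ((1 - (z.1 / 2)) * ((1, 1) : pt).1 + (z.1 / 2) * ((0, 1) : pt).1,
    (1 - (z.1 / 2)) * ((1, 1) : pt).2 + (z.1 / 2) * ((0, 1) : pt).2) :> pt.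
  by congr (_, _) => /=; lra.
by apply: (edge_int (C := (1, 0)) (D := k) cK _ _ _ _ _ _ _ pE) => //;
  rewrite /orient /=; lra.
Qed.

Lemma conf3_side3 K L k z (e : pt) : conf3 K L -> K k -> k.1 + k.2 < 1 ->
  z.1 + z.2 = 2 -> 0 < z.1 -> z.1 < 2 -> exists s : R, 0 < s /\
    int2 K ((2 - z.1) / 2 + s * e.1, (2 - z.2) / 2 + s * e.2).
Proof.
move=> [cK _ _ _ [K3 K1 K2 Lb]] Kk k1 z1 z2 z3.
apply: (@int2_ray _ K ((2 - z.1) / 2, (2 - z.2) / 2)).
have pE : ((2 - z.1) / 2, (2 - z.2) / 2) = ((1 - (1 - z.1 / 2)) * ((0, 1) : pt).1 + (1 - z.1 / 2) * ((1, 0) : pt).1,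
    (1 - (1 - z.1 / 2)) * ((0, 1) : pt).2 + (1 - z.1 / 2) * ((1, 0) : pt).2) :> pt.
  by congr (_, _) => /=; lra.
by apply: (edge_int (C := (1, 1)) (D := k) cK _ _ _ _ _ _ _ pE) => //;
  rewrite /orient /=; lra.
Qed.

Lemma conf3_pert K L (m11 m12 m21 m22 b1 b2 c1 c2 : R) : conf3 K L ->
  (forall p, K p -> L (aff m11 m12 m21 m22 b1 b2 p)) ->
  (forall z (e : pt), L z -> e.1 = m11 * z.1 + m12 * z.2 - z.1 + c1 ->
     e.2 = m21 * z.1 + m22 * z.2 - z.2 + c2 -> exists s : R, 0 < s /\
     int2 K ((2 - z.1) / 2 + s * e.1, (2 - z.2) / 2 + s * e.2)) ->
  ratio_lt2 K L.
Proof.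
move=> cf TL zi; have [cK cL pL KL _] := cf.
apply: (ratio_lt2_pert (t1 := 2) (t2 := 2) cK cL pL KL TL) => z Lz.
  exact: conf3_half cf Lz.
exact: (zi z (_, _) Lz erefl erefl).
Qed.

Lemma pt_eq z (x y : R) : z.1 = x -> z.2 = y -> z = (x, y).
Proof. by case: z => a b /= -> ->. Qed.

(** The direction [(-1, -1)] enters [K] through the sides [x = 1] and [y = 1]. The third side is
    interior because of [k], except for its ends, whose contact points [(2, 0)] and [(0, 2)] are not
    in [L]. *)
Lemma ratio3_lt2_opposite K L k : conf3 K L -> K k -> k.1 + k.2 < 1 ->
  ~ L (2, 0) -> ~ L (0, 2) -> ratio_lt2 K L.
Proof.
move=> cf Kk hk n1 n2; have [cK cL pL KL [K3 K1 K2 Lb]] := cf.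
apply: (@conf3_pert K L 1 0 0 1 0 0 (-1) (-1)) => // [p Kp|z e Lz e1 e2].
  rewrite (_ : aff _ _ _ _ _ _ p = p); first exact: KL.
  by rewrite [RHS]surjective_pairing /aff; congr pair; ring.
have [z1 z2 z3] := Lb z Lz.
have [h|h] := ltP (z.1 + z.2) 2.
  by apply: (conf3_ray cf Lz); [right; lra|left|right; lra].
have zs : z.1 + z.2 = 2 by lra.
apply: (conf3_side3 _ cf Kk hk zs).
  rewrite lt_def z1 andbT; apply/eqP => z0; apply: n2.
  by rewrite -(@pt_eq z 0 2) //; lra.
rewrite lt_def (_ : z.1 <= 2) ?andbT; last lra.
apply/eqP => z0; apply: n1.
by rewrite -(@pt_eq z 2 0) //; lra.
Qed.

Lemma ratio3_lt2_two_bulges K L k k' : conf3 K L -> L (0, 0) ->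
  ~ L (2, 0) -> ~ L (0, 2) ->
  K k -> 1 < k.1 -> K k' -> 1 < k'.2 -> (forall p, K p -> 1 <= p.1 + p.2) ->
  ratio_lt2 K L.
Proof.
move=> cf L0 n1 n2 Kk hk Kk' hk' nb; have [cK cL pL KL [K3 K1 K2 Lb]] := cf.
(* [T p = (p.1 + p.2 - 1) (1, 1)] maps [K] to the segment from [(0, 0)] to [(1, 1)]. The shift gives
   [e = (z.2 - 1/2, z.1 - 1/2)], which points inward at [(0, 0)] and has coordinate sum 1 on
   [x + y = 2]. *)
apply: (@conf3_pert K L 1 1 1 1 (-1) (-1) (-1/2) (-1/2)) => // [p Kp|z e Lz e1 e2].
  have t01 : 0 <= p.1 + p.2 - 1 <= 1 by have := nb _ Kp; have [] := Lb _ (KL _ Kp); lra.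
  have := cL _ _ _ L0 (KL _ K3) t01; congr L; rewrite /aff /=; congr pair; ring.
have [z1 z2 z3] := Lb z Lz.
have [z1p|z10] := ltP 0 z.1; have [z2p|z20] := ltP 0 z.2.
- apply: (conf3_ray cf Lz); [by left| |by left].
  by have [h|h] := ltP (z.1 + z.2) 2; [left|right; lra].
- apply: (conf3_side2 _ cf Kk' hk') => //; first lra.
  rewrite lt_def (_ : z.1 <= 2) ?andbT; last lra.
  by apply/eqP => z0; apply: n1; rewrite -(@pt_eq z 2 0) //; lra.
- apply: (conf3_side1 _ cf Kk hk) => //; first lra.
  rewrite lt_def (_ : z.2 <= 2) ?andbT; last lra.
  by apply/eqP => z0; apply: n2; rewrite -(@pt_eq z 0 2) //; lra.
- by apply: (conf3_ray cf Lz); [right|left|right]; lra.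
Qed.

Lemma ratio3_lt2_one_bulge K L k : conf3 K L -> ~ L (0, 0) ->
  L (2, 0) -> L (0, 2) -> K k -> 1 < k.1 -> (forall p, K p -> p.2 <= 1) ->
  ratio_lt2 K L.
Proof.
move=> cf n0 L1 L2 Kk hk nb; have [cK cL pL KL [K3 K1 K2 Lb]] := cf.
(* [T p = (2 - 2 p.2, 2 p.2)] maps [K] to the segment from [(2, 0)] to [(0, 2)]. With this shift [e]
   is [(1/2, -1/4)] at [(2, 0)] and [(-3/2, 7/4)] at [(0, 2)]; both enter [K]. *)
apply: (@conf3_pert K L 0 (-2) 0 2 2 0 (5/2) (-1/4)) => // [p Kp|z e Lz e1 e2].
  have t01 : 0 <= p.2 <= 1 by have := nb _ Kp; have [] := Lb _ (KL _ Kp); lra.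
  have := cL _ _ _ L1 L2 t01; congr L; rewrite /aff /=; congr pair; ring.
have [z1 z2 z3] := Lb z Lz.
have [z1p|z10] := ltP 0 z.1.
  apply: (conf3_ray cf Lz); last by left.
    by have [h|h] := ltP 0 z.2; [left|right; lra].
  by right; lra.
have z1e : z.1 = 0 by lra.
have [h|h] := ltP z.2 2; last first.
  by apply: (conf3_ray cf Lz); [left|right|right]; lra.
apply: (conf3_side1 _ cf Kk hk) => //.
by rewrite lt_def z2 andbT; apply/eqP => z0; apply: n0; rewrite -(@pt_eq z 0 0).
Qed.

(** For a slope [m], take the parallel lines through the corners [(1, 0)] and [(0, 1)]. If no slope
    has points of [K] beyond both lines, consider the largest slope for which nothing lies beyond
    the first. Larger slopes violate the first line, hence respect the second, and in the limit the
    extremal slope respects both. *)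
Lemma slope_dichotomy K L k k' : conf3 K L -> K k -> 1 < k.1 -> K k' -> 1 < k'.2 ->
  exists m : R, 0 < m /\
  ((forall p, K p -> - m <= p.2 - m * p.1 <= 1) \/
   (exists q q', [/\ K q, K q', q.2 < m * (q.1 - 1) & 1 + m * q'.1 < q'.2])).
Proof.
move=> cf Kk hk Kk' hk'; have [cK cL pL KL [K3 K1 K2 Lb]] := cf.
apply: contrapT => no.
pose S1 (m : R) := forall p, K p -> m * (p.1 - 1) <= p.2.
pose S2 (m : R) := forall p, K p -> p.2 <= 1 + m * p.1.
have S12 m : 0 < m -> ~ S1 m -> S2 m.
  move=> m0 nS1 p Kp; rewrite leNgt; apply/negP => h; apply: nS1 => q Kq.
  rewrite leNgt; apply/negP => h'; apply: no; exists m; split=> //; right.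
  by exists q, p.
pose S : set R := [set m | 0 <= m /\ S1 m]%classic.
have S0 : S 0.
  by split=> // p Kp; rewrite mul0r; have [] := Lb _ (KL _ Kp).
have Sub p : K p -> 1 < p.1 -> ubound S (p.2 / (p.1 - 1)).
  by move=> Kp hp m [m0 Sm]; rewrite ler_pdivlMr ?Sm //; lra.
have hS : has_sup S by split; [exists 0|exists (k.2 / (k.1 - 1)); exact: Sub].
set kap := sup S.
have kap0 : 0 <= kap by apply: sup_upper_bound.
have S1k : S1 kap.
  move=> p Kp; have [hp|hp] := ltP 1 p.1.
    by rewrite -ler_pdivlMr ?subr_gt0 //; apply: ge_sup; [exists 0|exact: Sub].
  have [_ p2 _] := Lb _ (KL _ Kp); have : 0 <= kap * (1 - p.1) by rewrite mulr_ge0 //; lra.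
  by lra.
have S2k : S2 kap.
  move=> p Kp; have [p1 p2 p3] := Lb _ (KL _ Kp).
  rewrite leNgt; apply/negP => h.
  (* As [p.1 <= 2], raising the slope by a quarter of the excess of [p] consumes at most half of
     that excess, so [p] still violates the second line. *)
  pose m := kap + (p.2 - 1 - kap * p.1) / 4.
  have km : kap < m by rewrite /m; lra.
  have nS : ~ S1 m.
    move=> S1m; have : m <= kap by apply: sup_upper_bound => //; split=> //; lra.
    by lra.
  have := S12 m (le_lt_trans kap0 km) nS p Kp; rewrite /m => h2.
  have : (p.2 - 1 - kap * p.1) / 4 * p.1 <= (p.2 - 1 - kap * p.1) / 4 * 2.
    by rewrite ler_pM2l; lra.
  by lra.
have kp : 0 < kap.
  rewrite lt_def kap0 andbT; apply/eqP => k0.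
  by have := S2k _ Kk'; rewrite k0 mul0r; lra.
apply: no; exists kap; split=> //; left=> p Kp.
by have := S1k p Kp; have := S2k p Kp; lra.
Qed.

Lemma ratio3_lt2_adjacent_bulges K L k k' : conf3 K L -> ~ L (0, 0) ->
  L (2, 0) -> L (0, 2) -> K k -> 1 < k.1 -> K k' -> 1 < k'.2 -> ratio_lt2 K L.
Proof.
move=> cf n0 L1 L2 Kk hk Kk' hk'; have [cK cL pL KL [K3 K1 K2 Lb]] := cf.
have bd p : K p -> [/\ 0 <= p.1, 0 <= p.2 & p.1 + p.2 <= 2] by move/KL/Lb.
(* The half points of [(2, 0)] and [(0, 2)] are the corners [(0, 1)] and [(1, 0)] of [U]. A point of
   [K] beyond an adjacent side widens the cone of directions that enter [K] there. *)
have corner1 q (e : pt) : K q -> 1 < q.2 -> 0 < e.1 + e.2 ->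
    0 < (q.2 - 1) * e.1 - q.1 * e.2 ->
    exists s : R, 0 < s /\ int2 K (0 + s * e.1, 1 + s * e.2).
  move=> Kq hq h1 h2; have [q1 q2 q3] := bd q Kq.
  apply: (@ray_int _ K (0, 1) (1, 0) q (0, 1) e cK K1 K2 Kq); rewrite /orient /=;
    [lra|lra|lra|right; lra|left; lra|right; lra].
have corner2 q (e : pt) : K q -> 1 < q.1 -> 0 < e.1 + e.2 ->
    0 < (q.1 - 1) * e.2 - q.2 * e.1 ->
    exists s : R, 0 < s /\ int2 K (1 + s * e.1, 0 + s * e.2).
  move=> Kq hq h1 h2; have [q1 q2 q3] := bd q Kq.
  apply: (@ray_int _ K (0, 1) (1, 0) q (1, 0) e cK K1 K2 Kq); rewrite /orient /=;
    [lra|lra|lra|right; lra|right; lra|left; lra].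
have rest z (e : pt) : L z -> 0 < e.1 + e.2 ->
   (z = (2, 0) -> exists s : R, 0 < s /\ int2 K (0 + s * e.1, 1 + s * e.2)) ->
   (z = (0, 2) -> exists s : R, 0 < s /\ int2 K (1 + s * e.1, 0 + s * e.2)) ->
   exists s : R, 0 < s /\
    int2 K ((2 - z.1) / 2 + s * e.1, (2 - z.2) / 2 + s * e.2).
  move=> Lz he e1 e2; have [z1 z2 z3] := Lb z Lz.
  have [z1p|z10] := ltP 0 z.1; have [z2p|z20] := ltP 0 z.2.
  - by apply: (conf3_ray cf Lz); cbn [fst snd]; [left|right|left].
  - have [h|h] := ltP z.1 2; first by apply: (conf3_side2 _ cf Kk' hk') => //; lra.
    have ze : z = (2, 0) by apply: pt_eq; lra.
    have [s [s0 hs]] := e1 ze; exists s; split=> //; move: hs; rewrite ze /=.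
    by congr (int2 K (_, _)); lra.
  - have [h|h] := ltP z.2 2; first by apply: (conf3_side1 _ cf Kk hk) => //; lra.
    have ze : z = (0, 2) by apply: pt_eq; lra.
    have [s [s0 hs]] := e2 ze; exists s; split=> //; move: hs; rewrite ze /=.
    by congr (int2 K (_, _)); lra.
  - by case: n0; rewrite -(@pt_eq z 0 0) //; lra.
have [m [m0 [strip|[q [q' [Kq Kq' hq hq']]]]]] := slope_dichotomy cf Kk hk Kk' hk'.
  have m1 : 0 < 1 + m by lra.
  have mn : 1 + m != 0 by rewrite gt_eqF.
  pose c := 2 / (1 + m).
  have cE : c * (1 + m) = 2 by rewrite /c divfK.
  (* Projection along the strip to the segment from [(2, 0)] to [(0, 2)]. The shift makes [e] equal
     to [(2, 0)] at the first end and to [(0, 2)] at the second, with [e.1 + e.2 = 4 - z.1 - z.2]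
     everywhere. *)
  apply: (@conf3_pert K L (c * m) (- c) (- c * m) c (2 - c * m) (c * m)
    (2 * c) (2 * (c * m))) => // [p Kp|z e Lz e1 e2].
    pose t := (p.2 - m * p.1 + m) / (1 + m).
    have t01 : 0 <= t <= 1.
      have := strip p Kp => h; apply/andP; split; first by rewrite divr_ge0; lra.
      by rewrite ler_pdivrMr //; lra.
    have := cL _ _ _ L1 L2 t01; congr L; rewrite /aff /t /c /=; congr pair; field=> //.
  have [z1 z2 z3] := Lb z Lz.
  apply: rest => //.
  - by rewrite e1 e2; lra.
  - move=> ze; have [f1 f2] : e.1 = 2 /\ e.2 = 0 by rewrite e1 e2 ze /=; split; lra.
    by apply: (@corner1 k' e) => //; rewrite f1 f2; lra.
  - move=> ze; have [f1 f2] : e.1 = 0 /\ e.2 = 2 by rewrite e1 e2 ze /=; split; lra.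
    by apply: (@corner2 k e) => //; rewrite f1 f2; lra.
(* Here [q] and [q'] lie strictly beyond the two lines of slope [m], so the translation along
   [(1, m)] enters [K] at both corners. *)
apply: (@conf3_pert K L 1 0 0 1 0 0 1 m) => // [p Kp|z e Lz e1 e2].
  rewrite (_ : aff _ _ _ _ _ _ p = p); first exact: KL.
  by rewrite [RHS]surjective_pairing /aff; congr pair; ring.
apply: rest => //.
- lra.
- move=> ze; have [q1 _ _] := bd _ Kq'; have mq : 0 <= m * q'.1 by rewrite mulr_ge0 // ltW.
  by apply: (@corner1 q' e) => //; rewrite ?e1 ?e2 ?ze /=; lra.
- move=> ze; have [_ q2 _] := bd _ Kq.
  have : 0 < m * (q.1 - 1) by lra.
  rewrite pmulr_rgt0 // => q1.
  by apply: (@corner2 q e) => //; rewrite ?e1 ?e2 ?ze /=; lra.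
Qed.

End ThreeContacts.

(** * Reductions by the affine symmetries of the triangle *)

Section ThreeContactsCases.
Variable R : realType.
Local Notation pt := (R * R)%type.
Implicit Types (K L : pt -> Prop) (p q z k : pt).

(** Two affine reflections generating the symmetries of the triangle [(0, 0), (2, 0), (0, 2)]: this
    one exchanges [(0, 0)] and [(2, 0)], the next exchanges [(2, 0)] and [(0, 2)]. *)
Definition swap13 p : pt := (2 - p.1 - p.2, p.2).
Definition swapxy p : pt := (p.2, p.1).

Lemma isaff_swap13 : isaff swap13.
Proof.
exists (-1), (-1), 0, 1, 2, 0; split; first by rewrite mulr1 mulr0 subr0 oppr_eq0 oner_neq0.
by move=> p; rewrite /swap13 /aff; congr pair; ring.
Qed.

Lemma isaff_swapxy : isaff swapxy.
Proof.
exists 0, 1, 1, 0, 0, 0; split; first by rewrite mulr1 mulr0 sub0r oppr_eq0 oner_neq0.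
by move=> p; rewrite /swapxy /aff; congr pair; ring.
Qed.

Lemma conf3_swap13 K L : conf3 K L ->
  conf3 (fun p => K (swap13 p)) (fun p => L (swap13 p)).
Proof.
move=> [cK cL pL KL [K3 K1 K2 Lb]]; split.
- exact: conv2_pull isaff_swap13 cK.
- exact: conv2_pull isaff_swap13 cL.
- exact: cpt2_pull isaff_swap13 pL.
- by move=> p; apply: KL.
split.
- by move: K1; congr K; rewrite /swap13 /=; congr pair; ring.
- by move: K3; congr K; rewrite /swap13 /=; congr pair; ring.
- by move: K2; congr K; rewrite /swap13 /=; congr pair; ring.
by move=> z /Lb; rewrite /swap13 /= => -[h1 h2 h3]; split; lra.
Qed.

Lemma conf3_swapxy K L : conf3 K L ->
  conf3 (fun p => K (swapxy p)) (fun p => L (swapxy p)).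
Proof.
move=> [cK cL pL KL [K3 K1 K2 Lb]]; split => //.
- exact: conv2_pull isaff_swapxy cK.
- exact: conv2_pull isaff_swapxy cL.
- exact: cpt2_pull isaff_swapxy pL.
- by move=> p; apply: KL.
by split=> // z /Lb; rewrite /swapxy /= => -[h1 h2 h3]; split; lra.
Qed.

(** Only [K] is reflected, [L] stays. The distance does not notice, but the bulges of [K] move
    relative to the vertices of [-2U] that belong to [L]. *)
Lemma conf3_reflect K L : conf3 K L -> (forall p, K p -> L (swap13 p)) ->
  conf3 (fun p => K (swap13 p)) L.
Proof.
move=> cf h; have [cK' _ _ _ [K3 K1 K2 _]] := conf3_swap13 cf.
have [_ cL pL _ [_ _ _ Lb]] := cf; split=> // p /h.
by congr L; rewrite /swap13 [RHS]surjective_pairing /=; congr pair; ring.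
Qed.

Lemma ratio_lt2_reflect K L : ratio_lt2 (fun p => K (swap13 p)) L -> ratio_lt2 K L.
Proof. exact: (ratio_lt2_pull isaff_swap13 (isaff_id R)). Qed.

Definition bulge K := exists k, K k /\ [\/ 1 < k.1, 1 < k.2 | k.1 + k.2 < 1].

Lemma bulge_swapxy K : bulge K -> bulge (fun p => K (swapxy p)).
Proof.
move=> [k [Kk h]]; exists (k.2, k.1); rewrite /swapxy /= -surjective_pairing.
by split=> //; case: h => h; [constructor 2|constructor 1|constructor 3]; lra.
Qed.

Lemma bulge_swap13 K : bulge K -> bulge (fun p => K (swap13 p)).
Proof.
move=> [k [Kk h]]; exists (swap13 k); split.
  by move: Kk; congr K; rewrite /swap13 [LHS]surjective_pairing /=; congr pair; ring.
by rewrite /swap13 /=; case: h => h; [constructor 3|constructor 2|constructor 1]; lra.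
Qed.

Lemma no_bulge K (P : pt -> bool) : ~ (exists k, K k /\ P k) ->
  forall p, K p -> ~~ P p.
Proof. by move=> h p Kp; apply/negP => Pp; apply: h; exists p. Qed.

Lemma ratio3_lt2_one_side K L k : conf3 K L -> L (0, 0) -> ~ L (2, 0) -> ~ L (0, 2) ->
  K k -> 1 < k.1 -> (forall p, K p -> p.2 <= 1) ->
  (forall p, K p -> 1 <= p.1 + p.2) -> ratio_lt2 K L.
Proof.
move=> cf L0 n1 n2 Kk hk nb2 nb3; have [cK cL pL KL [K3 K1 K2 Lb]] := cf.
(* The reflection carries the bulge beyond [x = 1] to one beyond [x + y = 1]. The reflected [K]
   stays in the square [(0, 0), (1, 0), (1, 1), (0, 1)], whose corners are in [L]. *)
apply: ratio_lt2_reflect; apply: (@ratio3_lt2_opposite _ _ _ (swap13 k)) => //.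
- apply: conf3_reflect => // p Kp; have [p1 p2 p3] := Lb _ (KL _ Kp).
  have := nb2 p Kp; have := nb3 p Kp => h3 h2.
  by apply: (@quad_in _ L (0, 0) (1, 0) (1, 1) (0, 1)) => //;
    (try exact: KL); rewrite /orient /swap13 /=; lra.
- by move: Kk; congr K; rewrite /swap13 [LHS]surjective_pairing /=; congr pair; ring.
- by rewrite /swap13 /=; lra.
Qed.

Lemma ratio3_lt2_one_vertex K L : conf3 K L -> L (0, 0) -> ~ L (2, 0) -> ~ L (0, 2) ->
  bulge K -> ratio_lt2 K L.
Proof.
move=> cf L0 n1 n2 [k [Kk hk]].
have [[k3 [Kk3 hk3]]|nb3] := pselect (exists k, K k /\ k.1 + k.2 < 1).
  exact: ratio3_lt2_opposite cf Kk3 hk3 n1 n2.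
have {}nb3 p : K p -> 1 <= p.1 + p.2 by move/(no_bulge nb3); rewrite -leNgt.
have [[k1 [Kk1 hk1]]|nb1] := pselect (exists k, K k /\ 1 < k.1);
have [[k2 [Kk2 hk2]]|nb2] := pselect (exists k, K k /\ 1 < k.2).
- exact: (@ratio3_lt2_two_bulges _ _ _ k1 k2).
- have {}nb2 p : K p -> p.2 <= 1 by move/(no_bulge nb2); rewrite -leNgt.
  exact: (@ratio3_lt2_one_side _ _ k1).
- have {}nb1 p : K p -> p.1 <= 1 by move/(no_bulge nb1); rewrite -leNgt.
  apply: (ratio_lt2_pull isaff_swapxy isaff_swapxy).
  apply: (@ratio3_lt2_one_side _ _ (swapxy k2)) => //.
  + exact: conf3_swapxy.
  + by rewrite /swapxy /= -surjective_pairing.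
  + by move=> p /nb1.
  + by move=> p /nb3; rewrite /swapxy /=; lra.
- have := no_bulge nb1 Kk; have := no_bulge nb2 Kk; have := nb3 _ Kk.
  by case: hk; lra.
Qed.

Lemma ratio3_lt2_two_vertices K L : conf3 K L -> ~ L (0, 0) -> L (2, 0) -> L (0, 2) ->
  bulge K -> ratio_lt2 K L.
Proof.
move=> cf n0 L1 L2 [k [Kk hk]]; have [cK cL pL KL [K3 K1 K2 Lb]] := cf.
have [[k1 [Kk1 hk1]]|nb1] := pselect (exists k, K k /\ 1 < k.1);
have [[k2 [Kk2 hk2]]|nb2] := pselect (exists k, K k /\ 1 < k.2).
- exact: (@ratio3_lt2_adjacent_bulges _ _ _ k1 k2).
- have {}nb2 p : K p -> p.2 <= 1 by move/(no_bulge nb2); rewrite -leNgt.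
  exact: (@ratio3_lt2_one_bulge _ _ _ k1).
- have {}nb1 p : K p -> p.1 <= 1 by move/(no_bulge nb1); rewrite -leNgt.
  apply: (ratio_lt2_pull isaff_swapxy isaff_swapxy).
  apply: (@ratio3_lt2_one_bulge _ _ _ (swapxy k2)) => //.
  + exact: conf3_swapxy.
  + by rewrite /swapxy /= -surjective_pairing.
  + by move=> p /nb1.
have {}nb1 p : K p -> p.1 <= 1 by move/(no_bulge nb1); rewrite -leNgt.
have {}nb2 p : K p -> p.2 <= 1 by move/(no_bulge nb2); rewrite -leNgt.
have hk3 : k.1 + k.2 < 1.
  by have := nb1 _ Kk; have := nb2 _ Kk; case: hk; lra.
(* The only bulge is beyond [x + y = 1]; reflected, it is beyond [x = 1], and the reflected [K]
   stays in the quadrilateral [(1, 0), (2, 0), (1, 1), (0, 1)] contained in [L]. *)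
apply: ratio_lt2_reflect; apply: (@ratio3_lt2_one_bulge _ _ _ (swap13 k)) => //.
- apply: conf3_reflect => // p Kp; have [p1 p2 p3] := Lb _ (KL _ Kp).
  have := nb1 p Kp; have := nb2 p Kp => h2 h1.
  by apply: (@quad_in _ L (1, 0) (2, 0) (1, 1) (0, 1)) => //;
    (try exact: KL); rewrite /orient /swap13 /=; lra.
- by move: Kk; congr K; rewrite /swap13 [LHS]surjective_pairing /=; congr pair; ring.
- by rewrite /swap13 /=; lra.
- by move=> p /nb2.
Qed.

Lemma conf3_ratio_lt2 K L : conf3 K L -> tri2 K \/ tri2 L \/ ratio_lt2 K L.
Proof.
move=> cf; have [cK cL pL KL [K3 K1 K2 Lb]] := cf.
have s13 (x y : R) : swap13 (x, y) = (2 - x - y, y) by [].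
have [bK|nb] := pselect (bulge K); last first.
  left; apply: (@tri2_orient _ _ (1, 1) (0, 1) (1, 0)) => //.
    by rewrite /orient /=; lra.
  move=> p Kp; rewrite /orient /=.
  have h1 : p.1 <= 1 by rewrite leNgt; apply/negP => h; apply: nb; exists p; split=> //; constructor 1.
  have h2 : p.2 <= 1 by rewrite leNgt; apply/negP => h; apply: nb; exists p; split=> //; constructor 2.
  have h3 : 1 <= p.1 + p.2 by rewrite leNgt; apply/negP => h; apply: nb; exists p; split=> //; constructor 3.
  by split; lra.
right.
have e1 : swap13 (0, 0) = (2, 0) by rewrite s13; congr pair; ring.
have e2 : swap13 (2, 0) = (0, 0) by rewrite s13; congr pair; ring.
have e3 : swap13 (0, 2) = (0, 2) by rewrite s13; congr pair; ring.
have f1 : swapxy (0, 0) = (0, 0) :> pt by [].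
have f2 : swapxy (2, 0) = (0, 2) :> pt by [].
have f3 : swapxy (0, 2) = (2, 0) :> pt by [].
have [L0|n0] := pselect (L (0, 0)); have [L1|n1] := pselect (L (2, 0));
  have [L2|n2] := pselect (L (0, 2)).
- left; apply: (@tri2_orient _ _ (0, 0) (2, 0) (0, 2)) => //.
    by rewrite /orient /=; lra.
  by move=> p /Lb[h1 h2 h3]; rewrite /orient /=; split; lra.
- right; apply: (ratio_lt2_pull isaff_swapxy isaff_swapxy).
  apply: (ratio_lt2_pull isaff_swap13 isaff_swap13).
  apply: ratio3_lt2_two_vertices; rewrite ?e1 ?e2 ?e3 ?f1 ?f2 ?f3 //.
    exact: (conf3_swap13 (conf3_swapxy cf)).
  exact: (bulge_swap13 (bulge_swapxy bK)).
- right; apply: (ratio_lt2_pull isaff_swap13 isaff_swap13).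
  apply: ratio3_lt2_two_vertices; rewrite ?e1 ?e2 ?e3 //.
    exact: (conf3_swap13 cf).
  exact: (bulge_swap13 bK).
- by right; exact: ratio3_lt2_one_vertex.
- by right; exact: ratio3_lt2_two_vertices.
- right; apply: (ratio_lt2_pull isaff_swap13 isaff_swap13).
  apply: ratio3_lt2_one_vertex; rewrite ?e1 ?e2 ?e3 //.
    exact: (conf3_swap13 cf).
  exact: (bulge_swap13 bK).
- right; apply: (ratio_lt2_pull isaff_swapxy isaff_swapxy).
  apply: (ratio_lt2_pull isaff_swap13 isaff_swap13).
  apply: ratio3_lt2_one_vertex; rewrite ?e1 ?e2 ?e3 ?f1 ?f2 ?f3 //.
    exact: (conf3_swap13 (conf3_swapxy cf)).
  exact: (bulge_swap13 (bulge_swapxy bK)).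
right; have [k [Kk hk]] := bK; case: hk => hk.
- apply: (ratio_lt2_pull isaff_swap13 isaff_swap13).
  apply: (@ratio3_lt2_opposite _ _ _ (swap13 k)); rewrite ?e1 ?e2 ?e3 //.
  + exact: (conf3_swap13 cf).
  + by move: Kk; congr K; rewrite /swap13 [LHS]surjective_pairing /=; congr pair; ring.
  + by rewrite /swap13 /=; lra.
- apply: (ratio_lt2_pull isaff_swapxy isaff_swapxy).
  apply: (ratio_lt2_pull isaff_swap13 isaff_swap13).
  apply: (@ratio3_lt2_opposite _ _ _ (swap13 (swapxy k))); rewrite ?e1 ?e2 ?e3 ?f1 ?f2 ?f3 //.
  + exact: (conf3_swap13 (conf3_swapxy cf)).
  + by move: Kk; congr K; rewrite /swapxy /swap13 [LHS]surjective_pairing /=; congr pair; ring.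
  + by rewrite /swap13 /=; lra.
- exact: ratio3_lt2_opposite cf Kk hk n1 n2.
Qed.

End ThreeContactsCases.

(** * Two quadrilaterals *)

Section Quadrilaterals.
Variable R : realFieldType.
Local Notation pt := (R * R)%type.
Implicit Types (K L : pt -> Prop) (p q z A B C D : pt).

Record quad K A B C D : Prop := Quad {
  quadA : K A; quadB : K B; quadC : K C; quadD : K D;
  quad_oA : 0 < orient D A B; quad_oB : 0 < orient A B C;
  quad_oC : 0 < orient B C D; quad_oD : 0 < orient C D A;
  quad_eAB : forall p, K p -> 0 <= orient A B p;
  quad_eBC : forall p, K p -> 0 <= orient B C p;
  quad_eCD : forall p, K p -> 0 <= orient C D p;
  quad_eDA : forall p, K p -> 0 <= orient D A p }.

Lemma quad_rot K A B C D : quad K A B C D -> quad K B C D A.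
Proof. by case=> *; split. Qed.

(** With the origin at a corner whose triangle is no smaller than those of its two neighbours, the
    fourth vertex [(a, b)] of the normal form has [a <= 1] and [b <= 1]. *)
Lemma quad_max_corner K A B C D : quad K A B C D -> exists A' B' C' D',
  [/\ quad K A' B' C' D', orient A' B' C' <= orient D' A' B' &
      orient C' D' A' <= orient D' A' B'].
Proof.
move=> qK; have q1 := quad_rot qK; have q2 := quad_rot q1; have q3 := quad_rot q2.
have [h1|h1] := leP (orient A B C) (orient D A B);
have [h2|h2] := leP (orient C D A) (orient B C D).
- have [h3|h3] := leP (orient B C D) (orient D A B).
    by exists A, B, C, D; split=> //; lra.
  by exists C, D, A, B; split=> //; lra.
- have [h3|h3] := leP (orient C D A) (orient D A B).
    by exists A, B, C, D; split=> //; lra.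
  by exists D, A, B, C; split=> //; lra.
- have [h3|h3] := leP (orient A B C) (orient B C D).
    by exists C, D, A, B; split=> //; lra.
  by exists B, C, D, A; split=> //; lra.
- have [h3|h3] := leP (orient A B C) (orient C D A).
    by exists D, A, B, C; split=> //; lra.
  by exists B, C, D, A; split=> //; lra.
Qed.

Record unit_quad K (a b : R) : Prop := UnitQuad {
  uqK : conv2 K; uq0 : K (0, 0); uq1 : K (1, 0); uq2 : K (0, 1); uqC : K (a, b);
  uqa0 : 0 < a; uqab : a <= b; uqb1 : b <= 1; uqab1 : 1 < a + b;
  uqx : forall p, K p -> 0 <= p.1; uqy : forall p, K p -> 0 <= p.2;
  uq_e1 : forall p, K p -> b * p.1 + (1 - a) * p.2 <= b;
  uq_e2 : forall p, K p -> (1 - b) * p.1 + a * p.2 <= a }.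

Lemma quad_unit K A B C D : conv2 K -> quad K A B C D ->
  exists (g : pt -> pt) (a b : R), isaff g /\ unit_quad (fun p => K (g p)) a b.
Proof.
move=> cK /quad_max_corner[{}A [{}B [{}C [{}D [qK hB hD]]]]].
have D0 := quad_oA qK; set De := orient D A B in D0 hB hD.
have DeE : De = (B.1 - A.1) * (D.2 - A.2) - (D.1 - A.1) * (B.2 - A.2).
  by rewrite /De /orient; ring.
have Dn : De != 0 by rewrite gt_eqF.
pose g := aff (B.1 - A.1) (D.1 - A.1) (B.2 - A.2) (D.2 - A.2) A.1 A.2.
have ag : isaff g.
  exists (B.1 - A.1), (D.1 - A.1), (B.2 - A.2), (D.2 - A.2), A.1, A.2.
  by rewrite -DeE.
pose a := orient C D A / De; pose b := orient A B C / De.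
have a0 : 0 < a by rewrite divr_gt0 ?(quad_oD qK).
have b0 : 0 < b by rewrite divr_gt0 ?(quad_oB qK).
have a1 : a <= 1 by rewrite ler_pdivrMr // mul1r.
have b1 : b <= 1 by rewrite ler_pdivrMr // mul1r.
have ab1 : 1 < a + b.
  rewrite -mulrDl ltr_pdivlMr // mul1r; have := quad_oC qK.
  by rewrite /De /orient; lra.
have gA : g (0, 0) = A.
  by rewrite [RHS]surjective_pairing /g /aff /=; congr pair; ring.
have gB : g (1, 0) = B.
  by rewrite [RHS]surjective_pairing /g /aff /=; congr pair; ring.
have gD : g (0, 1) = D.
  by rewrite [RHS]surjective_pairing /g /aff /=; congr pair; ring.
have gC : g (a, b) = C.
  rewrite [RHS]surjective_pairing /g /aff /a /b /=; congr pair.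
    by rewrite DeE; move: Dn; rewrite DeE /orient => Dn; field.
  by rewrite DeE; move: Dn; rewrite DeE /orient => Dn; field.
have e1 p : orient A B (g p) = De * p.2.
  by rewrite DeE /orient /g /aff /=; ring.
have e2 p : orient D A (g p) = De * p.1.
  by rewrite DeE /orient /g /aff /=; ring.
have e3 p : orient B C (g p) = De * (b - b * p.1 - (1 - a) * p.2).
  by rewrite -gB -gC DeE /orient /g /aff /=; ring.
have e4 p : orient C D (g p) = De * (a - a * p.2 - (1 - b) * p.1).
  by rewrite -gD -gC DeE /orient /g /aff /=; ring.
have h1 p : K (g p) -> 0 <= p.2.
  by move/(quad_eAB qK); rewrite e1 pmulr_rge0.
have h2 p : K (g p) -> 0 <= p.1.
  by move/(quad_eDA qK); rewrite e2 pmulr_rge0.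
have h3 p : K (g p) -> b * p.1 + (1 - a) * p.2 <= b.
  by move/(quad_eBC qK); rewrite e3 pmulr_rge0 //; lra.
have h4 p : K (g p) -> (1 - b) * p.1 + a * p.2 <= a.
  by move/(quad_eCD qK); rewrite e4 pmulr_rge0 //; lra.
have cg := conv2_pull ag cK.
have [ab|ab] := leP a b.
  exists g, a, b; split=> //; split=> //; rewrite ?gA ?gB ?gC ?gD //.
  - exact: quadA qK. - exact: quadB qK. - exact: quadD qK. - exact: quadC qK.
pose g' (p : pt) := g (p.2, p.1).
exists g', b, a; split.
  exists (D.1 - A.1), (B.1 - A.1), (D.2 - A.2), (B.2 - A.2), A.1, A.2.
  split; last by move=> p; rewrite /g' /g /aff /=; congr pair; ring.
  rewrite (_ : _ - _ = - De) ?oppr_eq0 //.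
  by rewrite DeE; ring.
split=> //; rewrite /g' /= ?gA ?gB ?gC ?gD //.
- move=> p q t Kp Kq t01.
  by have := cg (p.2, p.1) (q.2, q.1) t Kp Kq t01.
- exact: quadA qK.
- exact: quadD qK.
- exact: quadB qK.
- exact: quadC qK.
- exact: ltW.
- by lra.
- by move=> p /h1.
- by move=> p /h2.
- by move=> p /h4 /=; lra.
- by move=> p /h3 /=; lra.
Qed.

Lemma unit_quad_in K a b p : unit_quad K a b -> 0 <= p.1 -> 0 <= p.2 ->
  b * p.1 + (1 - a) * p.2 <= b -> (1 - b) * p.1 + a * p.2 <= a -> K p.
Proof.
move=> uK h1 h2 h3 h4; have b1 := uqb1 uK; have ab := uqab uK; have a0 := uqa0 uK.
by apply: (quad_in (uqK uK) (uq0 uK) (uq1 uK) (uqC uK) (uq2 uK)); rewrite /orient /=; lra.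
Qed.

Lemma unit_quad_sub K a b (P : pt -> Prop) : unit_quad K a b -> conv2 P ->
  P (0, 0) -> P (1, 0) -> P (0, 1) -> P (a, b) -> forall p, K p -> P p.
Proof.
move=> uK cP P0 P1 P2 PC p Kp.
have := uqx uK Kp; have := uqy uK Kp; have := uq_e1 uK Kp; have := uq_e2 uK Kp.
have := uqb1 uK; have := uqab uK; have := uqa0 uK => a0 ab b1 h1 h2 h3 h4.
by apply: (quad_in cP P0 P1 PC P2); rewrite /orient /=; lra.
Qed.

(** The ratio is kept positive so that the relation also gives the result with the two bodies
    exchanged. *)
Definition nested K L := exists (f : pt -> pt) (r : R) (c : pt),
  [/\ isaff f, 1 < r, r < 2, forall p, K p -> L (f p) &
      forall z, L z -> exists p, K p /\ z = (r * (f p).1 + c.1, r * (f p).2 + c.2)].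

Lemma nested_ratio_lt2 K L : nested K L -> ratio_lt2 K L.
Proof.
move=> [f [r [c [af r1 r2 KL LK]]]]; exists f, r, c; split=> //.
- by rewrite gtr0_norm //; lra.
- by rewrite gt_eqF.
Qed.

Lemma nested_ratio_lt2_sym K L : nested L K -> ratio_lt2 K L.
Proof. by move=> [f [r [c [af r1 r2 KL LK]]]]; exact: ratio_lt2_sym_pos KL LK. Qed.

Lemma exists_ratio (x y w : R) : x < 2 -> y < 2 -> w < 2 ->
  exists r, [/\ 1 < r, r < 2, x <= r, y <= r & w <= r].
Proof.
move=> x2 y2 w2; pose m := Num.max 1 (Num.max x (Num.max y w)).
have m2 : m < 2 by rewrite /m !gt_max x2 y2 w2 !andbT; lra.
have [m1 mx my mw] : [/\ 1 <= m, x <= m, y <= m & w <= m].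
  by rewrite /m !le_max !lexx !orbT.
by exists ((m + 2) / 2); split; lra.
Qed.

Lemma unit_quad_axes K a b (x : R) : unit_quad K a b -> 0 <= x -> x <= 1 ->
  K (x, 0) /\ K (0, x).
Proof.
move=> uK x0 x1; have x01 : 0 <= x <= 1 by rewrite x0.
have := uqK uK (uq0 uK) (uq1 uK) x01; have := uqK uK (uq0 uK) (uq2 uK) x01.
by rewrite /= !mulr0 !mulr1 !add0r; split.
Qed.

Lemma unit_quad_bounds K a b : unit_quad K a b ->
  [/\ 0 < b, 0 <= 1 - a, 0 <= 1 - b & 1 < 2 * b].
Proof.
move=> uK; have := uqa0 uK; have := uqab uK; have := uqb1 uK; have := uqab1 uK.
by clear; split; lra.
Qed.

Lemma nested_le K L a b c d : unit_quad K a b -> unit_quad L c d ->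
  a <= c -> b <= d -> nested K L.
Proof.
move=> uK uL ac bd.
have a0 := uqa0 uK; have ab1 := uqab1 uK; have [b0 a1 b1 _] := unit_quad_bounds uK.
have c0 := uqa0 uL; have [d0 c1 d1 _] := unit_quad_bounds uL.
have ca : 0 <= c - a by rewrite subr_ge0.
have db : 0 <= d - b by rewrite subr_ge0.
(* These are the smallest ratios for which [r K] contains [(1, 1)], hence [(c, d)]; they are below 2
   because [a + b > 1]. *)
have [|||r [r1 r2 hx hy _]] := @exists_ratio (1 + (1 - a) / b) (1 + (1 - b) / a) 0.
- by rewrite -ltrBrDl ltr_pdivrMr //; clear - ab1; lra.
- by rewrite -ltrBrDl ltr_pdivrMr //; clear - ab1; lra.
- by clear; lra.
have r0 : 0 < r by clear - r1; lra.
have rn : r != 0 by rewrite gt_eqF.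
have hx' : b + (1 - a) <= r * b.
  by move: hx; rewrite -(ler_pM2r b0) mulrDl mul1r divfK // gt_eqF.
have hy' : a + (1 - b) <= r * a.
  by move: hy; rewrite -(ler_pM2r a0) mulrDl mul1r divfK // gt_eqF.
exists (fun p => p), r, (0, 0); split=> //.
- exact: isaff_id.
- apply: (unit_quad_sub uK (uqK uL) (uq0 uL) (uq1 uL) (uq2 uL)).
  apply: (unit_quad_in uL); rewrite ?(ltW a0) ?(ltW b0) //=.
    have h1 := mulr_ge0 db c1; have h2 := mulr_ge0 ca (ltW d0).
    by clear - h1 h2; lra.
  have h1 := mulr_ge0 ca d1; have h2 := mulr_ge0 db (ltW c0).
  by clear - h1 h2; lra.
have ri : 0 < r^-1 by rewrite invr_gt0.
have ri1 : r^-1 <= 1 by rewrite invf_le1 // ltW.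
have ah : isaff (fun p : pt => (r^-1 * p.1 + 0, r^-1 * p.2 + 0)).
  by apply: (isaff_homothety (0, 0)); rewrite gt_eqF.
have sub := unit_quad_sub uL (conv2_pull ah (uqK uK)).
have [Kx Ky] := unit_quad_axes uK (ltW ri) ri1.
move=> z Lz; exists (r^-1 * z.1 + 0, r^-1 * z.2 + 0); split; last first.
  by rewrite [LHS]surjective_pairing /=; congr pair; field.
apply: sub => //=; rewrite ?mulr0 ?mulr1 ?addr0 //; first exact: uq0 uK.
apply: (unit_quad_in uK); rewrite /= ?mulr_ge0 ?(ltW ri) ?(ltW c0) ?(ltW d0) //.
  rewrite (_ : _ + _ = r^-1 * (b * c + (1 - a) * d)); last ring.
  rewrite ler_pdivrMl //.
  have h1 := mulr_ge0 (ltW b0) c1; have h2 := mulr_ge0 a1 d1.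
  by clear - h1 h2 hx'; lra.
rewrite (_ : _ + _ = r^-1 * ((1 - b) * c + a * d)); last ring.
rewrite ler_pdivrMl //.
have h1 := mulr_ge0 b1 c1; have h2 := mulr_ge0 (ltW a0) d1.
by clear - h1 h2 hy'; lra.
Qed.

(* Squeezing [K] vertically by [d / b] makes the topmost corners level. *)
Lemma nested_cross K L a b c d : unit_quad K a b -> unit_quad L c d ->
  a <= c -> d <= b -> nested K L.
Proof.
move=> uK uL ac db.
have a0 := uqa0 uK; have ab1 := uqab1 uK; have [b0 a1 b1 _] := unit_quad_bounds uK.
have c0 := uqa0 uL; have [d0 c1 d1 d2] := unit_quad_bounds uL.
have ca : 0 <= c - a by rewrite subr_ge0.
have bn : b != 0 by rewrite gt_eqF.
(* The first two bounds put [(c, d)] into [r] times the squeezed [K], the third puts [(0, 1)] there;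
   the third is below 2 since [d > 1/2]. *)
have [|||r [r1 r2 hx hy hw]] := @exists_ratio (2 - a) ((1 - b) / a + b) (b / d).
- by clear - a0; lra.
- rewrite -ltrBrDr ltr_pdivrMr //; have h1 := mulr_ge0 b1 (ltW a0).
  by clear - h1 ab1; lra.
- by rewrite ltr_pdivrMr //; clear - d2 b1; lra.
have r0 : 0 < r by clear - r1; lra.
have rn : r != 0 by rewrite gt_eqF.
have hy' : (1 - b) + a * b <= r * a.
  by move: hy; rewrite -(ler_pM2r a0) mulrDl divfK ?gt_eqF // [b * a]mulrC.
have hw' : b <= r * d by move: hw; rewrite ler_pdivrMr.
pose y := d / b.
have yb : y * b = d by rewrite /y divfK.
have y0 : 0 < y by rewrite divr_gt0.
have y1 : y <= 1 by rewrite ler_pdivrMr // mul1r.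
have yn : y != 0 by rewrite gt_eqF.
have af : isaff (fun p : pt => (p.1, y * p.2)).
  exists 1, 0, 0, y, 0, 0; split; first by rewrite mul1r mulr0 subr0.
  by move=> p; rewrite /aff; congr pair; ring.
exists (fun p => (p.1, y * p.2)), r, (0, 0); split=> //.
- have [_ Ly] := unit_quad_axes uL (ltW y0) y1.
  apply: (unit_quad_sub uK (conv2_pull af (uqK uL))); rewrite /= ?mulr0 ?mulr1 ?yb //.
  + exact: uq0 uL.
  + exact: uq1 uL.
  apply: (unit_quad_in uL); rewrite /= ?(ltW a0) ?(ltW d0) //.
    have h1 := mulr_ge0 ca (ltW d0).
    by clear - h1; lra.
  have h1 := mulr_ge0 ca d1.
  by clear - h1; lra.
have ry : 0 < r * y by rewrite mulr_gt0.
have ah : isaff (fun p : pt => (r^-1 * p.1, (r * y)^-1 * p.2)).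
  exists r^-1, 0, 0, (r * y)^-1, 0, 0; split.
    by rewrite mulr0 subr0 mulf_neq0 // invr_neq0 // mulf_neq0.
  by move=> p; rewrite /aff; congr pair; ring.
have sub := unit_quad_sub uL (conv2_pull ah (uqK uK)).
move=> z Lz; exists (r^-1 * z.1, (r * y)^-1 * z.2); split; last first.
  by rewrite [LHS]surjective_pairing /=; congr pair; field; rewrite ?rn ?yn.
have ri : 0 < r^-1 by rewrite invr_gt0.
have ri1 : r^-1 <= 1 by rewrite invf_le1 // ltW.
have ryd : (r * y)^-1 * d = r^-1 * b.
  by rewrite -yb; field; rewrite ?rn ?yn.
have ry0 : 0 < (r * y)^-1 by rewrite invr_gt0.
have ry1 : (r * y)^-1 <= 1.
  by rewrite invf_le1 // -(ler_pM2r b0) mul1r -mulrA yb.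
have [Kx _] := unit_quad_axes uK (ltW ri) ri1.
have [_ Ky] := unit_quad_axes uK (ltW ry0) ry1.
apply: sub => //=; rewrite ?mulr0 ?mulr1 ?ryd //; first exact: uq0 uK.
apply: (unit_quad_in uK); rewrite /= ?mulr_ge0 ?(ltW ri) ?(ltW c0) ?(ltW b0) //.
  rewrite (_ : _ + _ = r^-1 * (b * (c + 1 - a))); last ring.
  rewrite ler_pdivrMl // mulrC ler_pM2r //.
  by clear - hx c1; lra.
rewrite (_ : _ + _ = r^-1 * ((1 - b) * c + a * b)); last ring.
rewrite ler_pdivrMl //; have h1 := mulr_ge0 b1 c1.
by clear - h1 hy'; lra.
Qed.

Lemma ratio_lt2_quads K L A B C D A' B' C' D' : conv2 K -> conv2 L ->
  quad K A B C D -> quad L A' B' C' D' -> ratio_lt2 K L.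
Proof.
move=> cK cL /(quad_unit cK)[g [a [b [ag uK]]]] /(quad_unit cL)[h [c [d [ah uL]]]].
apply: (ratio_lt2_pull ag ah).
have [ac|ca] := leP a c; have [bd|db] := leP b d.
- exact/nested_ratio_lt2/(nested_le uK uL).
- by apply/nested_ratio_lt2/(nested_cross uK uL) => //; exact: ltW.
- by apply/nested_ratio_lt2_sym/(nested_cross uL uK) => //; exact: ltW.
- by apply/nested_ratio_lt2_sym/(nested_le uL uK) => //; exact: ltW.
Qed.

End Quadrilaterals.

(** * Outer contacts *)

Section OuterContacts.
Variable R : realFieldType.
Local Notation pt := (R * R)%type.
Implicit Types (K L : pt -> Prop) (p q z k n e t : pt).

Definition dot2 p q : R := p.1 * q.1 + p.2 * q.2.

Definition opp_half t z : pt := ((t.1 - z.1) / 2, (t.2 - z.2) / 2).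

(* [z] lies on the boundary of [t - 2 K], where [n] is an inner normal of [K] at
   the smooth boundary point [opp_half t z]. *)
Definition contact K t z n := forall e, 0 < dot2 n e -> exists s : R, 0 < s /\
  int2 K ((opp_half t z).1 + s * e.1, (opp_half t z).2 + s * e.2).

Definition seg (k : R) A B : pt :=
  ((1 - k) * A.1 + k * B.1, (1 - k) * A.2 + k * B.2).

Lemma contact_edge K t z A B C (k : R) : conv2 K -> K A -> K B -> K C ->
  0 < orient A B C -> 0 < k < 1 -> opp_half t z = seg k A B ->
  contact K t z (A.2 - B.2, B.1 - A.1).
Proof.
move=> cK KA KB KC o k01 zE e he.
by apply: (edge_ray cK KA KB KC o k01 zE); move: he; rewrite /dot2 /=; lra.
Qed.

Lemma ratio_lt2_contacts K L t (m11 m12 m21 m22 b1 b2 c1 c2 : R) :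
  conv2 K -> conv2 L -> cpt2 L -> (forall p, K p -> L p) ->
  (forall z, L z -> K (opp_half t z)) ->
  (forall p, K p -> L (aff m11 m12 m21 m22 b1 b2 p)) ->
  (forall z e, L z -> e.1 = m11 * z.1 + m12 * z.2 - z.1 + c1 ->
     e.2 = m21 * z.1 + m22 * z.2 - z.2 + c2 ->
     int2 K (opp_half t z) \/ exists n, contact K t z n /\ 0 < dot2 n e) ->
  ratio_lt2 K L.
Proof.
move=> cK cL pL KL zK TL zi.
apply: (ratio_lt2_pert cK cL pL KL TL zK) => z Lz.
have [h|[n [cn hn]]] := zi z (_, _) Lz erefl erefl.
  exact: (int2_ray (_, _) h).
exact: (cn (_, _) hn).
Qed.

Lemma ratio_lt2_translate K L t e : conv2 K -> conv2 L -> cpt2 L ->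
  (forall p, K p -> L p) -> (forall z, L z -> K (opp_half t z)) ->
  (forall z, L z ->
     int2 K (opp_half t z) \/ exists n, contact K t z n /\ 0 < dot2 n e) ->
  ratio_lt2 K L.
Proof.
move=> cK cL pL KL zK zi.
apply: (@ratio_lt2_contacts K L t 1 0 0 1 0 0 e.1 e.2) => // [p Kp|z e' Lz e1 e2].
  rewrite (_ : aff _ _ _ _ _ _ p = p); first exact: KL.
  by rewrite [RHS]surjective_pairing /aff; congr pair; ring.
have -> : e' = e by case: e' e1 e2 {zi} => /= x y -> ->; case: e => /= a b; congr pair; ring.
exact: zi.
Qed.

(* Antiparallel contacts: [K] lies in a strip and is projected along it onto the
   segment [zA, zB]. *)
Lemma ratio_lt2_strip K L t zA zB zC nA nC (al h ka : R) :
  conv2 K -> conv2 L -> cpt2 L -> (forall p, K p -> L p) ->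
  (forall z, L z -> K (opp_half t z)) ->
  L zA -> L zB -> 0 < h -> 0 < ka ->
  (forall p, K p -> al <= dot2 nA p <= al + h) ->
  dot2 nA (opp_half t zA) = al -> dot2 nA (opp_half t zB) = al + h ->
  contact K t zA nA -> contact K t zB (- ka * nA.1, - ka * nA.2) ->
  nA.1 * nC.2 - nA.2 * nC.1 != 0 ->
  (forall z, L z -> [\/ int2 K (opp_half t z), z = zA, z = zB |
     z = zC /\ contact K t z nC]) ->
  ratio_lt2 K L.
Proof.
move=> cK cL pL KL zK LA LB h0 ka0 Kst tA tB cA cB ncr zi.
have hn : h != 0 by rewrite gt_eqF.
pose dx := zA.1 - zB.1; pose dy := zA.2 - zB.2.
have dE : nA.1 * dx + nA.2 * dy = 2 * h.
  by move: tA tB; rewrite /dot2 /opp_half /dx /dy /=; lra.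
pose cr := nA.1 * nC.2 - nA.2 * nC.1.
(* The midpoint part of the shift balances [zA] against [zB]. The multiple [la] of the direction
   orthogonal to [nA] does not affect these two, and is chosen to make the product of [nC] with [e]
   at [zC] equal to 1. *)
pose w := dot2 nA zC / h * dot2 nC (dx, dy) - dot2 nC zC -
  dot2 nC ((zA.1 + zB.1) / 2, (zA.2 + zB.2) / 2).
pose la := (1 - w) / cr.
apply: (@ratio_lt2_contacts K L t (nA.1 * dx / h) (nA.2 * dx / h) (nA.1 * dy / h)
  (nA.2 * dy / h) (zB.1 - al / h * dx) (zB.2 - al / h * dy)
  (- (zA.1 + zB.1) / 2 - la * nA.2) (- (zA.2 + zB.2) / 2 + la * nA.1))
  => // [p Kp|z e Lz e1 e2].
  have t01 : 0 <= (dot2 nA p - al) / h <= 1.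
    have := Kst p Kp => hp; apply/andP; split; first by rewrite divr_ge0; lra.
    by rewrite ler_pdivrMr //; lra.
  have := cL _ _ _ LB LA t01; congr L; rewrite /aff /dot2 /dx /dy /=.
  by congr pair; field.
have nE : dot2 nA e = dot2 nA z - dot2 nA ((zA.1 + zB.1) / 2, (zA.2 + zB.2) / 2).
  have -> : dot2 nA e = dot2 nA z * (nA.1 * dx + nA.2 * dy) / h - dot2 nA z -
       dot2 nA ((zA.1 + zB.1) / 2, (zA.2 + zB.2) / 2).
    by rewrite {1}/dot2 e1 e2 /dot2 /=; field.
  by rewrite dE; field.
have [|zE|zE|[zE cC]] := zi z Lz; first by left.
- right; exists nA; split; first by rewrite zE.
  by rewrite nE zE /dot2 /=; move: dE; rewrite /dx /dy; lra.
- right; exists (- ka * nA.1, - ka * nA.2); split; first by rewrite zE.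
  rewrite (_ : dot2 _ _ = ka * - dot2 nA e); last by rewrite /dot2 /=; ring.
  rewrite mulr_gt0 // nE zE /dot2 /=; move: dE; rewrite /dx /dy; lra.
right; exists nC; split=> //.
rewrite (_ : dot2 nC e = 1) //.
have -> : dot2 nC e = w + la * cr.
  by rewrite /dot2 e1 e2 zE /w /dot2 /cr /=; field.
by rewrite /la divfK // addrC subrK.
Qed.

Definition cross n n' : R := n.1 * n'.2 - n.2 * n'.1.

(** Two inner normals have a common entering direction unless they are antiparallel; in that case
    the two supporting lines bound a strip containing [K]. *)
Lemma ratio_lt2_two K L t zA zB nA nB (al be : R) :
  conv2 K -> conv2 L -> cpt2 L -> (forall p, K p -> L p) ->
  (forall z, L z -> K (opp_half t z)) -> L zA -> L zB ->
  (forall p, K p -> al <= dot2 nA p) -> (forall p, K p -> be <= dot2 nB p) ->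
  dot2 nA (opp_half t zA) = al -> dot2 nB (opp_half t zB) = be ->
  contact K t zA nA -> contact K t zB nB -> nA <> (0, 0) -> nB <> (0, 0) ->
  (exists2 p, K p & al < dot2 nA p) ->
  (forall z, L z -> [\/ int2 K (opp_half t z), z = zA | z = zB]) ->
  ratio_lt2 K L.
Proof.
move=> cK cL pL KL zK LA LB Ka Kb tA tB cA cB nA0 nB0 [p0 Kp0 hp0] zi.
have sq n : n <> (0, 0) -> 0 < n.1 * n.1 + n.2 * n.2.
  move=> n0; rewrite -!expr2 lt_def addr_ge0 ?sqr_ge0 // andbT.
  rewrite paddr_eq0 ?sqr_ge0 // !sqrf_eq0; apply/negP => /andP[/eqP h1 /eqP h2].
  by apply: n0; rewrite [LHS]surjective_pairing h1 h2.
have qA := sq _ nA0; have qB := sq _ nB0.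
have trans e : 0 < dot2 nA e -> 0 < dot2 nB e -> ratio_lt2 K L.
  move=> h1 h2; apply: (@ratio_lt2_translate K L t e) => // z Lz.
  have [|zE|zE] := zi z Lz; first by left.
    by right; exists nA; rewrite zE.
  by right; exists nB; rewrite zE.
have [cr0|crn] := eqVneq (cross nA nB) 0; last first.
  (* solve n_A . e = n_B . e = 1 *)
  apply: (trans ((nB.2 - nA.2) / cross nA nB, (nA.1 - nB.1) / cross nA nB)).
    rewrite (_ : dot2 _ _ = 1) //.
    by rewrite /dot2 /=; move: crn; rewrite /cross => crn; field.
  rewrite (_ : dot2 _ _ = 1) //.
  by rewrite /dot2 /=; move: crn; rewrite /cross => crn; field.
have [dp|dn] := ltP 0 (dot2 nA nB).
  by apply: (trans nA) => //; rewrite /dot2 mulrC [nB.2 * _]mulrC.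
pose ka := - dot2 nA nB / (nA.1 * nA.1 + nA.2 * nA.2).
have qn : nA.1 * nA.1 + nA.2 * nA.2 != 0 by rewrite gt_eqF.
have nBE1 : nB.1 = - ka * nA.1.
  apply: (mulIf qn); rewrite (_ : - ka * nA.1 * _ =
    - (ka * (nA.1 * nA.1 + nA.2 * nA.2)) * nA.1); last by ring.
  rewrite /ka divfK // opprK.
  have -> : dot2 nA nB * nA.1 = nB.1 * (nA.1 * nA.1 + nA.2 * nA.2) + nA.2 * cross nA nB.
    by rewrite /dot2 /cross; ring.
  by rewrite cr0 mulr0 addr0.
have nBE2 : nB.2 = - ka * nA.2.
  apply: (mulIf qn); rewrite (_ : - ka * nA.2 * _ =
    - (ka * (nA.1 * nA.1 + nA.2 * nA.2)) * nA.2); last by ring.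
  rewrite /ka divfK // opprK.
  have -> : dot2 nA nB * nA.2 = nB.2 * (nA.1 * nA.1 + nA.2 * nA.2) - nA.1 * cross nA nB.
    by rewrite /dot2 /cross; ring.
  by rewrite cr0 mulr0 subr0.
have ka0 : 0 < ka.
  have : 0 <= ka by rewrite /ka divr_ge0 ?oppr_ge0 // ltW.
  rewrite le_eqVlt => /orP[/eqP ka0|//]; case: nB0.
  by rewrite [LHS]surjective_pairing nBE1 nBE2 -ka0 oppr0 !mul0r.
have nBd q : dot2 nB q = - ka * dot2 nA q by rewrite /dot2 nBE1 nBE2; ring.
have Kst p : K p -> al <= dot2 nA p <= dot2 nA (opp_half t zB).
  move=> Kp; rewrite Ka //=; have := Kb p Kp; rewrite -tB !nBd !mulNr lerN2.
  by rewrite ler_pM2l.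
(* There is no third contact: [zA] and the normal orthogonal to [nA] only fill the places of [zC]
   and [nC]. *)
apply: (@ratio_lt2_strip K L t zA zB zA nA (- nA.2, nA.1) al (dot2 nA (opp_half t zB) - al) ka)
  => //.
- by rewrite subr_gt0; have /andP[_] := Kst _ Kp0; apply: lt_le_trans.
- by move=> p /Kst; rewrite addrC subrK.
- by rewrite addrC subrK.
- by move: cB; rewrite [nB]surjective_pairing nBE1 nBE2.
- by rewrite /= mulrN opprK.
- by move=> z /zi[h|h|h]; [constructor 1|constructor 2|constructor 3].
Qed.

End OuterContacts.

(** * Exactly three outer contacts, in normal form *)

Section ThreeOuterContacts.
Variable R : realFieldType.
Local Notation pt := (R * R)%type.
Implicit Types (K L : pt -> Prop) (z n e t : pt).

(** The contact points are [(0, 0)], [(1, 0)], [(0, 1)], and the axes [y = 0] and [x = 0] are the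
    lines [v_1 = 1] and [v_4 = 1], carrying [u1] and [u4]. The last two fields keep what is needed
    of [v_2] and [v_3]: the line [v_2 = 1] meets [y = 0] only at [(1, 0)], and [v_3 = 1] meets
    [x = 0] only at [(0, 1)]. *)
Record conf4 K L t (u1 u2 u3 u4 : pt) : Prop := Conf4 {
  c4K : conv2 K; c4L : conv2 L; c4p : cpt2 L;
  c4KL : forall p, K p -> L p;
  c4half : forall z, L z -> K (opp_half t z);
  c4u1 : K u1; c4u2 : K u2; c4u3 : K u3; c4u4 : K u4;
  c4o1 : 0 < orient u1 u2 u3; c4o2 : 0 < orient u2 u3 u4;
  c4o3 : 0 < orient u3 u4 u1; c4o4 : 0 < orient u4 u1 u2;
  c4z0 : L (0, 0); c4z1 : L (1, 0); c4z2 : L (0, 1);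
  c4pos : forall z, L z -> 0 <= z.1 /\ 0 <= z.2;
  c4x1 : u1.2 = 0; c4x4 : u4.1 = 0; c4x12 : u1.1 < u2.1; c4x43 : u4.2 < u3.2;
  c4e12 : forall p, K p -> 0 <= orient u1 u2 p;
  c4e23 : forall p, K p -> 0 <= orient u2 u3 p;
  c4e34 : forall p, K p -> 0 <= orient u3 u4 p;
  c4h0 : exists2 k, 0 < k < 1 & opp_half t (0, 0) = seg k u2 u3;
  c4h1 : exists2 k, 0 < k < 1 & opp_half t (1, 0) = seg k u3 u4;
  c4h2 : exists2 k, 0 < k < 1 & opp_half t (0, 1) = seg k u1 u2;
  c4int : forall z, L z ->
    [\/ int2 K (opp_half t z), z = (0, 0), z = (1, 0) | z = (0, 1)];
  c4v2 : u2.2 = 0 -> u2.1 = 1;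
  c4v3 : u3.1 = 0 -> u3.2 = 1 }.

Section Conf4.
Variables (K L : pt -> Prop) (t u1 u2 u3 u4 : pt).
Hypothesis cf : conf4 K L t u1 u2 u3 u4.

Let A := u3.2 - u4.2.
Let B := u3.1.
Let G := u2.2.
Let D := u2.1 - u1.1.
Let n34 : pt := (A, - B).
Let n12 : pt := (- G, D).
Let n23 : pt := (u2.2 - u3.2, u3.1 - u2.1).

Let A0 : 0 < A. Proof. by rewrite subr_gt0 (c4x43 cf). Qed.
Let D0 : 0 < D. Proof. by rewrite subr_gt0 (c4x12 cf). Qed.
Let B0 : 0 <= B. Proof. by case: (c4pos cf (c4KL cf (c4u3 cf))). Qed.
Let G0 : 0 <= G. Proof. by case: (c4pos cf (c4KL cf (c4u2 cf))). Qed.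

Let C0 : contact K t (0, 0) n23.
Proof.
have [k k01 hk] := c4h0 cf.
by apply: contact_edge (c4K cf) (c4u2 cf) (c4u3 cf) (c4u4 cf) (c4o2 cf) k01 hk.
Qed.

Let C1 : contact K t (1, 0) n34.
Proof.
have [k k01 hk] := c4h1 cf.
have := contact_edge (c4K cf) (c4u3 cf) (c4u4 cf) (c4u1 cf) (c4o3 cf) k01 hk.
by rewrite /n34 /A /B (c4x4 cf) sub0r.
Qed.

Let C2 : contact K t (0, 1) n12.
Proof.
have [k k01 hk] := c4h2 cf.
have := contact_edge (c4K cf) (c4u1 cf) (c4u2 cf) (c4u3 cf) (c4o1 cf) k01 hk.
by rewrite /n12 /G /D (c4x1 cf) sub0r.
Qed.

Let f34E p : orient u3 u4 p = dot2 n34 p + B * u4.2.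
Proof. by rewrite /orient /dot2 /n34 /A /B (c4x4 cf) /=; ring. Qed.

Let f12E p : orient u1 u2 p = dot2 n12 p + G * u1.1.
Proof. by rewrite /orient /dot2 /n12 /G /D (c4x1 cf) /=; ring. Qed.

Let F3 := orient u3 u4 u2.
Let F1 := orient u1 u2 u3.
Let F30 : 0 < F3.
Proof. by rewrite (_ : F3 = orient u2 u3 u4) ?(c4o2 cf) // /F3 /orient; ring. Qed.
Let F10 : 0 < F1. Proof. exact: c4o1 cf. Qed.

(** Both sides are affine in [p] and vanish at [u2] and [u3]. The factor [A * D - B * G] is the
    cross product of the inner normals [n34] and [n12]: if it is positive, the three edge lines
    bound a triangle around [K] and this is its barycentric relation; if it is zero, the outer two
    edges are parallel. *)
Let f23E p : F3 * F1 - orient u3 u4 p * F1 - orient u1 u2 p * F3 =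
  (A * D - B * G) * orient u2 u3 p.
Proof.
by rewrite /F3 /F1 /orient /A /B /G /D (c4x1 cf) (c4x4 cf); ring.
Qed.

Lemma conf4_translate : A * D < B * G -> ratio_lt2 K L.
Proof.
move=> h.
have BG : 0 < B * G by apply: lt_trans h; rewrite mulr_gt0.
have Bp : 0 < B by rewrite lt_def B0 andbT; apply: contraTneq BG => ->; rewrite mul0r ltxx.
have Gp : 0 < G by rewrite lt_def G0 andbT; apply: contraTneq BG => ->; rewrite mulr0 ltxx.
(* [e] solves [n34 . e = n12 . e = B * G - A * D]; its product with [n23] then turns out to be
   [F1 + F3]. *)
pose e : pt := (- (B + D), - (A + G)).
have h1 : 0 < dot2 n34 e.
  by rewrite (_ : dot2 _ _ = B * G - A * D) ?subr_gt0 // /dot2 /n34 /e /=; ring.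
have h2 : 0 < dot2 n12 e.
  by rewrite (_ : dot2 _ _ = B * G - A * D) ?subr_gt0 // /dot2 /n12 /e /=; ring.
have h3 : 0 < dot2 n23 e.
  have key : (B * G - A * D) * dot2 n23 e = (B * G - A * D) * (F1 + F3).
    rewrite /dot2 /n23 /e /F1 /F3 /orient /B /G /A /D (c4x1 cf) (c4x4 cf) /=.
    ring.
  have hn : B * G - A * D != 0 by rewrite gt_eqF // subr_gt0.
  by rewrite (mulfI hn key) addr_gt0.
apply: (ratio_lt2_translate (c4K cf) (c4L cf) (c4p cf) (c4KL cf) (c4half cf) (e := e)).
move=> z Lz; have [| -> | -> | -> ] := c4int cf Lz; first by left.
- by right; exists n23.
- by right; exists n34.
- by right; exists n12.
Qed.

Lemma conf4_strip : A * D = B * G -> ratio_lt2 K L.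
Proof.
move=> h.
have BG : 0 < B * G by rewrite -h mulr_gt0.
have Bp : 0 < B by rewrite lt_def B0 andbT; apply: contraTneq BG => ->; rewrite mul0r ltxx.
have Gp : 0 < G by rewrite lt_def G0 andbT; apply: contraTneq BG => ->; rewrite mulr0 ltxx.
pose ka := B / D.
have kaD : ka * D = B by rewrite /ka divfK // gt_eqF.
have kaG : ka * G = A by apply: (mulIf (lt0r_neq0 D0)); rewrite h -kaD; ring.
have ka0 : 0 < ka by rewrite divr_gt0.
have nE p : dot2 n34 p = - ka * dot2 n12 p.
  by rewrite /dot2 /n34 /n12 /= -kaD -kaG; ring.
have e12 p : K p -> - (G * u1.1) <= dot2 n12 p.
  by move=> /(c4e12 cf); rewrite f12E; lra.
have e34 p : K p -> ka * dot2 n12 p <= B * u4.2.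
  by move=> /(c4e34 cf); rewrite f34E nE; lra.
have [k k01 hk] := c4h1 cf; have [k' k01' hk'] := c4h2 cf.
have o1 : orient u3 u4 (opp_half t (1, 0)) = 0 by rewrite hk /orient /seg /=; ring.
have o2 : orient u1 u2 (opp_half t (0, 1)) = 0 by rewrite hk' /orient /seg /=; ring.
move: o1 o2; rewrite f34E f12E nE => o1 o2.
apply: (@ratio_lt2_strip _ K L t (0, 1) (1, 0) (0, 0) n12 n23 (- (G * u1.1))
  (dot2 n12 (opp_half t (1, 0)) + G * u1.1) ka (c4K cf) (c4L cf) (c4p cf) (c4KL cf)
  (c4half cf) (c4z2 cf) (c4z1 cf)) => //.
- have : 0 < F3 by [].
  rewrite /F3 f34E nE; have := e12 _ (c4u2 cf) => h2 h1.
  have : 0 < ka * (dot2 n12 (opp_half t (1, 0)) + G * u1.1).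
    have : ka * - (G * u1.1) <= ka * dot2 n12 u2 by rewrite ler_pM2l.
    by lra.
  by rewrite pmulr_rgt0.
- move=> p Kp; rewrite e12 //=; have := e34 p Kp => h1.
  by rewrite -(ler_pM2l ka0); lra.
- lra.
- lra.
- have -> : (- ka * n12.1, - ka * n12.2) = n34.
    by rewrite /n34 /n12 -kaG /=; congr pair; [ring|rewrite -kaD; ring].
  exact: C1.
- have -> : n12.1 * n23.2 - n12.2 * n23.1 = F1.
    by rewrite /n12 /n23 /F1 /G /D /orient (c4x1 cf) /=; ring.
  by rewrite gt_eqF.
move=> z Lz; have [| -> | -> | -> ] := c4int cf Lz.
- by constructor 1.
- by constructor 4.
- by constructor 3.
- by constructor 2.
Qed.

(* The barycentric coordinates of the triangle cut out by the three edge lines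
   map [K] into [conv {0, e1, e2}]; the linear part [M] has trace 2, and the
   projection improves the distance as soon as [tr (M ^ 2) > 2]. *)
Lemma conf4_project : B * G < A * D ->
  ratio_lt2 K L \/ [/\ A = F3, D = F1 & B * G = 0].
Proof.
move=> h; have F3n : F3 != 0 by rewrite gt_eqF.
have F1n : F1 != 0 by rewrite gt_eqF.
(* The rows of [M] are [n34 / F3] and [n12 / F1], so that [T p] is the pair of edge functionals of
   [p], normalised to 1 at [u2] and at [u3] respectively. *)
pose m11 := A / F3; pose m12 := - B / F3; pose m21 := - G / F1; pose m22 := D / F1.
have m11E : A = m11 * F3 by rewrite /m11 divfK.
have m22E : D = m22 * F1 by rewrite /m22 divfK.
have m12E : - B = m12 * F3 by rewrite /m12 divfK.
have m21E : - G = m21 * F1 by rewrite /m21 divfK.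
have [k k01 hk] := c4h1 cf; have [k' k01' hk'] := c4h2 cf.
have [k0 k001 hk0] := c4h0 cf.
(* The functional of the edge [u3 u4] vanishes at the half point of [(1, 0)], hence is [A / 2] at
   that of [(0, 0)]; likewise [D / 2] for [u1 u2]. The latter half point lies on the line [u2 u3],
   so the barycentric relation reads [m11 / 2 + m22 / 2 = 1]. *)
have tr2 : m11 + m22 = 2.
  have o1 : orient u3 u4 (opp_half t (1, 0)) = 0 by rewrite hk /orient /seg /=; ring.
  have o2 : orient u1 u2 (opp_half t (0, 1)) = 0 by rewrite hk' /orient /seg /=; ring.
  have o3 : orient u2 u3 (opp_half t (0, 0)) = 0 by rewrite hk0 /orient /seg /=; ring.
  have := f23E (opp_half t (0, 0)); rewrite o3 mulr0.
  have -> : orient u3 u4 (opp_half t (0, 0)) = orient u3 u4 (opp_half t (1, 0)) + A / 2.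
    by rewrite !f34E /dot2 /n34 /opp_half /=; field.
  have -> : orient u1 u2 (opp_half t (0, 0)) = orient u1 u2 (opp_half t (0, 1)) + D / 2.
    by rewrite !f12E /dot2 /n12 /opp_half /=; field.
  rewrite o1 o2 !add0r m11E m22E => E.
  have F31 : F3 * F1 != 0 by rewrite mulf_neq0.
  by apply: (mulIf F31); lra.
have mm : 0 <= m12 * m21.
  have -> : m12 * m21 = B * G / (F3 * F1) by rewrite /m12 /m21; field; rewrite ?F3n ?F1n.
  by rewrite divr_ge0 ?mulr_ge0 // ltW // mulr_gt0.
(* [P] and [Q] are the diagonal entries of [M^2 - M], so [P + Q] is [tr (M^2) - 2]. *)
pose P := m11 ^+ 2 - m11 + m12 * m21; pose Q := m22 ^+ 2 - m22 + m12 * m21.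
have PQ : P + Q = (m11 - m22) ^+ 2 / 2 + 2 * (m12 * m21).
  rewrite /P /Q (_ : m22 = 2 - m11); last by lra.
  by field.
have [PQ0|PQ0] := ltP 0 (P + Q); last first.
  right; have s0 := sqr_ge0 (m11 - m22).
  have m0 : (m11 - m22) ^+ 2 = 0 by lra.
  have mm0 : m12 * m21 = 0 by lra.
  move/eqP: m0; rewrite sqrf_eq0 => /eqP m0.
  have [m1 m2] : m11 = 1 /\ m22 = 1 by lra.
  split; first by rewrite m11E m1 mul1r.
    by rewrite m22E m2 mul1r.
  have -> : B * G = (- B) * (- G) by rewrite mulrNN.
  by rewrite m12E m21E mulrACA mm0 mul0r.
(* Up to positive factors the three conditions read [P + (M c)_1 > 0], [Q + (M c)_2 > 0] and
   [- (M c)_1 - (M c)_2 > 0]. The vector [c] shares the total [P + Q] equally among them. *)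
left; pose dl := (P + Q) / 3.
have dn : m11 * m22 - m12 * m21 != 0.
  have -> : m11 * m22 - m12 * m21 = (A * D - B * G) / (F3 * F1).
    by rewrite /m11 /m12 /m21 /m22; field; rewrite ?F3n ?F1n.
  by rewrite mulf_neq0 ?invr_eq0 ?mulf_neq0 // gt_eqF // subr_gt0.
pose det := m11 * m22 - m12 * m21.
pose c1 := ((dl - P) * m22 - (dl - Q) * m12) / det.
pose c2 := ((dl - Q) * m11 - (dl - P) * m21) / det.
have cE1 : m11 * c1 + m12 * c2 = dl - P.
  by rewrite /c1 /c2 /det; field.
have cE2 : m21 * c1 + m22 * c2 = dl - Q.
  by rewrite /c1 /c2 /det; field.
apply: (ratio_lt2_contacts (c4K cf) (c4L cf) (c4p cf) (c4KL cf) (c4half cf)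
  (m11 := m11) (m12 := m12) (m21 := m21) (m22 := m22) (b1 := B * u4.2 / F3)
  (b2 := G * u1.1 / F1) (c1 := c1) (c2 := c2)) => [p Kp|z e Lz e1 e2].
  have g1 : 0 <= orient u3 u4 p / F3 by exact: (divr_ge0 (c4e34 cf Kp) (ltW F30)).
  have g2 : 0 <= orient u1 u2 p / F1 by exact: (divr_ge0 (c4e12 cf Kp) (ltW F10)).
  have g3 : 0 <= 1 - orient u3 u4 p / F3 - orient u1 u2 p / F1.
    have -> : 1 - orient u3 u4 p / F3 - orient u1 u2 p / F1 =
      (F3 * F1 - orient u3 u4 p * F1 - orient u1 u2 p * F3) / (F3 * F1).
      by field; rewrite ?F3n ?F1n.
    have AD : 0 <= A * D - B * G by rewrite subr_ge0 ltW.
    rewrite f23E; apply: divr_ge0; first exact: mulr_ge0 AD (c4e23 cf Kp).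
    exact: mulr_ge0 (ltW F30) (ltW F10).
  have := conv3 (c4L cf) (c4z0 cf) (c4z1 cf) (c4z2 cf) g3 g1 g2.
  have -> : 1 - orient u3 u4 p / F3 - orient u1 u2 p / F1 + orient u3 u4 p / F3
    + orient u1 u2 p / F1 = 1 by ring.
  move=> /(_ erefl); congr L; rewrite f34E f12E /aff /dot2 /n34 /n12 /m11 /m12 /m21 /m22.
  by congr pair; rewrite /=; field; rewrite ?F3n ?F1n.
have [| zE | zE | zE ] := c4int cf Lz; first by left.
- right; exists n23; split; first by rewrite zE.
  have ee1 : e.1 = c1 by rewrite e1 zE /=; ring.
  have ee2 : e.2 = c2 by rewrite e2 zE /=; ring.
  have key : (A * D - B * G) * dot2 n23 e = F3 * F1 * (P + Q - 2 * dl).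
    rewrite (_ : P + Q - 2 * dl = - (m11 * c1 + m12 * c2) - (m21 * c1 + m22 * c2));
      last by lra.
    rewrite -ee1 -ee2.
    have -> : (A * D - B * G) * dot2 n23 e =
       (A * D - B * G) * (orient u2 u3 e - orient u2 u3 (0, 0)).
      by rewrite /dot2 /n23 /orient /=; ring.
    rewrite mulrBr -!f23E !f34E !f12E /dot2 /n34 /n12 /= m12E m21E m11E m22E.
    by ring.
  have : 0 < (A * D - B * G) * dot2 n23 e.
    by rewrite key mulr_gt0 ?mulr_gt0 // /dl; lra.
  by rewrite pmulr_rgt0 // subr_gt0.
- right; exists n34; split; first by rewrite zE.
  have -> : dot2 n34 e = F3 * dl.
    have -> : dl = (dl - P) + P by ring.
    by rewrite -cE1 /dot2 e1 e2 zE /n34 /= m11E m12E /P; ring.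
  by rewrite mulr_gt0 // /dl; lra.
right; exists n12; split; first by rewrite zE.
have -> : dot2 n12 e = F1 * dl.
  have -> : dl = (dl - Q) + Q by ring.
  by rewrite -cE2 /dot2 e1 e2 zE /n12 /= m22E m21E /Q; ring.
by rewrite mulr_gt0 // /dl; lra.
Qed.

(** The equality case of the projection: two vertices of [K] are themselves contact points of [L]
    with [-2K]. If [u3] is on the axis [x = 0] it is [(0, 1)], and [D = F1] then forces [G = 0],
    because [u1.1 = 0] would make [u3, u4, u1] collinear; the other case is symmetric. *)
Lemma conf4_degenerate : A = F3 -> D = F1 -> B * G = 0 ->
  u2 = (1, 0) /\ u3 = (0, 1).
Proof.
move=> AF DF /eqP; rewrite mulf_eq0.
have F3E : F3 = A * u2.1 - B * G + B * u4.2.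
  by rewrite /F3 f34E /dot2 /n34 /G /=; ring.
have F1E : F1 = D * u3.2 - B * G + G * u1.1.
  by rewrite /F1 f12E /dot2 /n12 /B /=; ring.
have fin : B = 0 -> G = 0 -> u2 = (1, 0) /\ u3 = (0, 1).
  move=> hB hG; have h2 := c4v2 cf hG; have h3 := c4v3 cf hB.
  by split; rewrite [LHS]surjective_pairing; congr pair.
case/orP => /eqP h0.
  have h3 := c4v3 cf h0; apply: fin => //.
  move: F1E; rewrite -DF h3 h0 => E.
  have /eqP : G * u1.1 = 0 by lra.
  rewrite mulf_eq0 => /orP[/eqP//|/eqP u10].
  have := c4o3 cf; rewrite /orient (c4x1 cf) (c4x4 cf) u10 -/B h0; lra.
have h2 := c4v2 cf h0; apply: fin => //.
move: F3E; rewrite -AF h2 h0 => E.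
have /eqP : B * u4.2 = 0 by lra.
rewrite mulf_eq0 => /orP[/eqP//|/eqP u40].
by have := c4o4 cf; rewrite /orient (c4x1 cf) (c4x4 cf) u40 -/G h0; lra.
Qed.

Lemma conf4_ratio_lt2 : ratio_lt2 K L \/ u2 = (1, 0) /\ u3 = (0, 1).
Proof.
have [h|h|h] := ltgtP (A * D) (B * G).
- by left; exact: conf4_translate.
- have [|[h1 h2 h3]] := conf4_project h; first by left.
  by right; exact: conf4_degenerate.
- by left; exact: conf4_strip.
Qed.

Lemma conf4_symmetric : (exists c : pt, forall z, L z -> L (c.1 - z.1, c.2 - z.2)) ->
  ratio_lt2 K L \/ tri2 K.
Proof.
move=> [c cS]; have [|[h2 h3]] := conf4_ratio_lt2; first by left.
right; have e23 p : K p -> p.1 + p.2 <= 1.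
  by move/(c4e23 cf); rewrite h2 h3 /orient /=; lra.
have [k k01 hk] := c4h1 cf; have [k' k01' hk'] := c4h2 cf.
have [k0 k001 hk0] := c4h0 cf.
have Kb z : K z -> 0 <= z.1 /\ 0 <= z.2 by move/(c4KL cf)/(c4pos cf).
have t1 : t.1 <= 1.
  move: hk; rewrite /opp_half /seg h3 /= (c4x4 cf) => -[+ _]; lra.
have t2 : t.2 <= 1.
  move: hk'; rewrite /opp_half /seg h2 /= (c4x1 cf) => -[_ +]; lra.
have Lb z : L z -> z.1 <= t.1 /\ z.2 <= t.2.
  by move=> /(c4half cf)/Kb[]; rewrite /opp_half /=; split; lra.
(* The reflected contact points lie in the box from the origin to [t], and [t <= (1, 1)]; this
   forces [c = t]. The reflection of [(0, 0)] is then [t], whose half point is the origin, so the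
   origin is in [K]. *)
have L1 := cS _ (c4z1 cf); have L2 := cS _ (c4z2 cf); have L0 := cS _ (c4z0 cf).
have [/= a1 a2] := Lb _ L0; have [/= b1 _] := c4pos cf L1; have [/= _ d2] := c4pos cf L2.
have [tE1 tE2] : c.1 = t.1 /\ c.2 = t.2 by lra.
have K0 : K (0, 0).
  have := c4half cf L0; congr K; rewrite /opp_half /= tE1 tE2; congr pair; lra.
have K2 := c4u2 cf; have K3 := c4u3 cf; rewrite h2 in K2; rewrite h3 in K3.
apply: (tri2_orient _ K0 K2 K3); first by rewrite /orient /=; lra.
by move=> p Kp; have [p1 p2] := Kb p Kp; have := e23 p Kp; rewrite /orient /=; split; lra.
Qed.

End Conf4.
End ThreeOuterContacts.

(** * John's identity with three contact pairs *)

Section JohnThree.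
Variable R : realType.
Local Notation pt := (R * R)%type.
Implicit Types (K L : pt -> Prop) (p q z : pt).

Lemma affine_indep3 (u1 u2 u3 : pt) (a1 a2 a3 x y z : R) :
  0 < a1 + a2 + a3 -> cross u1 u2 != 0 -> a3 != 0 ->
  a1 * u1.1 + a2 * u2.1 + a3 * u3.1 = 0 -> a1 * u1.2 + a2 * u2.2 + a3 * u3.2 = 0 ->
  x * u1.1 + y * u2.1 + z * u3.1 = 0 -> x * u1.2 + y * u2.2 + z * u3.2 = 0 ->
  x + y + z = 0 -> [/\ x = 0, y = 0 & z = 0].
Proof.
move=> s0 cr a30 h1 h2 h3 h4 h5.
have E1 : a3 * x - a1 * z = 0.
  apply: (mulIf cr); rewrite mul0r /cross.
  transitivity ((a3 * (x * u1.1 + y * u2.1 + z * u3.1)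
     - z * (a1 * u1.1 + a2 * u2.1 + a3 * u3.1)) * u2.2
   - (a3 * (x * u1.2 + y * u2.2 + z * u3.2)
     - z * (a1 * u1.2 + a2 * u2.2 + a3 * u3.2)) * u2.1); first by ring.
  by rewrite h1 h2 h3 h4; ring.
have E2 : a3 * y - a2 * z = 0.
  apply: (mulIf cr); rewrite mul0r /cross.
  transitivity ((a3 * (x * u1.2 + y * u2.2 + z * u3.2)
     - z * (a1 * u1.2 + a2 * u2.2 + a3 * u3.2)) * u1.1
   - (a3 * (x * u1.1 + y * u2.1 + z * u3.1)
     - z * (a1 * u1.1 + a2 * u2.1 + a3 * u3.1)) * u1.2); first by ring.
  by rewrite h1 h2 h3 h4; ring.
have z0 : z = 0.
  have : (a1 + a2 + a3) * z = a3 * (x + y + z) - (a3 * x - a1 * z) - (a3 * y - a2 * z).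
    by ring.
  rewrite h5 E1 E2 mulr0 !subr0 => /eqP; rewrite mulf_eq0 => /orP[|/eqP//].
  by rewrite gt_eqF.
have x0 : x = 0.
  by apply: (mulfI a30); rewrite mulr0; move: E1; rewrite z0 mulr0 subr0.
by split=> //; move: h5; rewrite x0 z0; lra.
Qed.

(** Every [x] is the affine combination of the [u_i] with coefficients [a_i (<x, v_i> + 1/2)]. The
    [u_i] are affinely independent, so these coefficients are unique; taking [x = u_j] gives
    [a_i = 2/3] and every off-diagonal product [-1/2]. *)
Lemma john3_weights (u1 u2 u3 v1 v2 v3 : pt) (a1 a2 a3 : R) :
  0 < a1 -> 0 < a2 -> 0 < a3 ->
  a1 * u1.1 * v1.1 + a2 * u2.1 * v2.1 + a3 * u3.1 * v3.1 = 1 ->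
  a1 * u1.1 * v1.2 + a2 * u2.1 * v2.2 + a3 * u3.1 * v3.2 = 0 ->
  a1 * u1.2 * v1.1 + a2 * u2.2 * v2.1 + a3 * u3.2 * v3.1 = 0 ->
  a1 * u1.2 * v1.2 + a2 * u2.2 * v2.2 + a3 * u3.2 * v3.2 = 1 ->
  a1 * u1.1 + a2 * u2.1 + a3 * u3.1 = 0 -> a1 * u1.2 + a2 * u2.2 + a3 * u3.2 = 0 ->
  a1 * v1.1 + a2 * v2.1 + a3 * v3.1 = 0 -> a1 * v1.2 + a2 * v2.2 + a3 * v3.2 = 0 ->
  dot2 u1 v1 = 1 -> dot2 u2 v2 = 1 -> dot2 u3 v3 = 1 ->
  [/\ cross u1 u2 != 0, u3 = (- u1.1 - u2.1, - u1.2 - u2.2),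
      [/\ dot2 u1 v2 = - (1 / 2), dot2 u2 v1 = - (1 / 2) & dot2 u1 v3 = - (1 / 2)] &
      [/\ dot2 u3 v1 = - (1 / 2), dot2 u2 v3 = - (1 / 2) & dot2 u3 v2 = - (1 / 2)]].
Proof.
move=> a10 a20 a30 I11 I12 I21 I22 U1 U2 V1 V2 d1 d2 d3.
have s0 : 0 < a1 + a2 + a3 by lra.
have an : a3 != 0 by rewrite gt_eqF.
have sum2 : a1 + a2 + a3 = 2.
  have : a1 * dot2 u1 v1 + a2 * dot2 u2 v2 + a3 * dot2 u3 v3 = 2.
    by rewrite /dot2; lra.
  by rewrite d1 d2 d3; lra.
(* Eliminating [a3 u3] writes the identity matrix as a product of two 2 by 2 matrices; comparing
   determinants excludes a vanishing [cross u1 u2]. *)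
have cr : cross u1 u2 != 0.
  apply: contraTneq isT => c0; exfalso.
  have : a1 * a2 * cross u1 u2 * ((v1.1 - v3.1) * (v2.2 - v3.2)
        - (v1.2 - v3.2) * (v2.1 - v3.1)) = 1.
    have e1 : a3 * u3.1 = - (a1 * u1.1 + a2 * u2.1) by lra.
    have e2 : a3 * u3.2 = - (a1 * u1.2 + a2 * u2.2) by lra.
    rewrite e1 in I11 I12; rewrite e2 in I21 I22.
    transitivity ((a1 * u1.1 * v1.1 + a2 * u2.1 * v2.1 + - (a1 * u1.1 + a2 * u2.1) * v3.1)
     * (a1 * u1.2 * v1.2 + a2 * u2.2 * v2.2 + - (a1 * u1.2 + a2 * u2.2) * v3.2)
     - (a1 * u1.1 * v1.2 + a2 * u2.1 * v2.2 + - (a1 * u1.1 + a2 * u2.1) * v3.2)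
     * (a1 * u1.2 * v1.1 + a2 * u2.2 * v2.1 + - (a1 * u1.2 + a2 * u2.2) * v3.1)).
      by rewrite /cross; ring.
    by rewrite I11 I12 I21 I22; ring.
  by rewrite c0 mulr0 mul0r; lra.
pose E (x : pt) (v : pt) (a : R) := a * (dot2 x v + 1 / 2).
have S (x : pt) : E x v1 a1 + E x v2 a2 + E x v3 a3 = 1.
  transitivity (x.1 * (a1 * v1.1 + a2 * v2.1 + a3 * v3.1)
     + x.2 * (a1 * v1.2 + a2 * v2.2 + a3 * v3.2) + (a1 + a2 + a3) / 2).
    by rewrite /E /dot2; field.
  by rewrite V1 V2 sum2; field.
have S1 (x : pt) : E x v1 a1 * u1.1 + E x v2 a2 * u2.1 + E x v3 a3 * u3.1 = x.1.
  transitivity (x.1 * (a1 * u1.1 * v1.1 + a2 * u2.1 * v2.1 + a3 * u3.1 * v3.1)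
     + x.2 * (a1 * u1.1 * v1.2 + a2 * u2.1 * v2.2 + a3 * u3.1 * v3.2)
     + (a1 * u1.1 + a2 * u2.1 + a3 * u3.1) / 2).
    by rewrite /E /dot2; field.
  by rewrite I11 I12 U1; field.
have S2 (x : pt) : E x v1 a1 * u1.2 + E x v2 a2 * u2.2 + E x v3 a3 * u3.2 = x.2.
  transitivity (x.1 * (a1 * u1.2 * v1.1 + a2 * u2.2 * v2.1 + a3 * u3.2 * v3.1)
     + x.2 * (a1 * u1.2 * v1.2 + a2 * u2.2 * v2.2 + a3 * u3.2 * v3.2)
     + (a1 * u1.2 + a2 * u2.2 + a3 * u3.2) / 2).
    by rewrite /E /dot2; field.
  by rewrite I21 I22 U2; field.
have half0 (a d : R) : 0 < a -> a * (d + 1 / 2) = 0 -> d = - (1 / 2).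
  move=> a0 /eqP; rewrite mulf_eq0 gt_eqF //= => /eqP; lra.
have [x1 x2 x3] : [/\ E u1 v1 a1 - 1 = 0, E u1 v2 a2 = 0 & E u1 v3 a3 = 0].
  by apply: (affine_indep3 s0 cr an U1 U2); [have := S1 u1|have := S2 u1|have := S u1]; lra.
have [y1 y2 y3] : [/\ E u2 v1 a1 = 0, E u2 v2 a2 - 1 = 0 & E u2 v3 a3 = 0].
  by apply: (affine_indep3 s0 cr an U1 U2); [have := S1 u2|have := S2 u2|have := S u2]; lra.
have [z1 z2 z3] : [/\ E u3 v1 a1 = 0, E u3 v2 a2 = 0 & E u3 v3 a3 - 1 = 0].
  by apply: (affine_indep3 s0 cr an U1 U2); [have := S1 u3|have := S2 u3|have := S u3]; lra.
have [A1 A2 A3] : [/\ a1 = 2 / 3, a2 = 2 / 3 & a3 = 2 / 3].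
  by move: x1 y2 z3; rewrite /E d1 d2 d3; split; lra.
split=> //.
- rewrite [LHS]surjective_pairing; congr pair.
    by move: U1; rewrite A1 A2 A3; lra.
  by move: U2; rewrite A1 A2 A3; lra.
- by split; [apply: half0 x2|apply: half0 y1|apply: half0 x3].
- by split; [apply: half0 z1|apply: half0 y3|apply: half0 z2].
Qed.

Lemma john3_ratio_lt2 K L (u1 u2 u3 v1 v2 v3 : pt) :
  conv2 K -> conv2 L -> cpt2 L -> (forall p, K p -> L p) ->
  K u1 -> K u2 -> K u3 ->
  (forall z, L z -> [/\ dot2 z v1 <= 1, dot2 z v2 <= 1 & dot2 z v3 <= 1]) ->
  dot2 u1 v1 = 1 -> dot2 u2 v2 = 1 -> dot2 u3 v3 = 1 ->
  [/\ cross u1 u2 != 0, u3 = (- u1.1 - u2.1, - u1.2 - u2.2),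
      [/\ dot2 u1 v2 = - (1 / 2), dot2 u2 v1 = - (1 / 2) & dot2 u1 v3 = - (1 / 2)] &
      [/\ dot2 u3 v1 = - (1 / 2), dot2 u2 v3 = - (1 / 2) & dot2 u3 v2 = - (1 / 2)]] ->
  tri2 K \/ tri2 L \/ ratio_lt2 K L.
Proof.
move=> cK cL pL KL K1 K2 K3 Lv d1 d2 d3 [cr u3E [d12 d21 d13] [d31 d23 d32]].
pose g := aff (u2.1 + 2 * u3.1) (u1.1 + 2 * u3.1) (u2.2 + 2 * u3.2) (u1.2 + 2 * u3.2)
  (- 2 * u3.1) (- 2 * u3.2).
have ag : isaff g.
  exists (u2.1 + 2 * u3.1), (u1.1 + 2 * u3.1), (u2.2 + 2 * u3.2), (u1.2 + 2 * u3.2),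
    (- 2 * u3.1), (- 2 * u3.2); split=> //.
  rewrite (_ : _ - _ = 3 * cross u1 u2); last by rewrite u3E /cross /=; ring.
  by rewrite mulf_neq0 // pnatr_eq0.
have gv p v : dot2 (g p) v = - 2 * dot2 u3 v + p.1 * (dot2 u2 v + 2 * dot2 u3 v)
    + p.2 * (dot2 u1 v + 2 * dot2 u3 v).
  by rewrite /dot2 /g /aff /=; ring.
have cf : conf3 (fun p => K (g p)) (fun p => L (g p)).
  split.
  - exact: conv2_pull ag cK.
  - exact: conv2_pull ag cL.
  - exact: cpt2_pull ag pL.
  - by move=> p; exact: KL.
  split.
  - by move: K3; congr K; rewrite [LHS]surjective_pairing u3E /g u3E /aff /=; congr pair; ring.
  - by move: K1; congr K; rewrite [LHS]surjective_pairing /g u3E /aff /=; congr pair; ring.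
  - by move: K2; congr K; rewrite [LHS]surjective_pairing /g u3E /aff /=; congr pair; ring.
  move=> z /Lv[]; rewrite !gv d1 d2 d3 d12 d21 d13 d31 d23 d32 => h1 h2 h3.
  by split; lra.
have [h|[h|h]] := conf3_ratio_lt2 cf.
- by left; exact: tri2_pull h.
- by right; left; exact: tri2_pull h.
- by right; right; exact: ratio_lt2_pull h.
Qed.

End JohnThree.

(** * Four contact pairs *)

Section JohnFour.
Variable R : realFieldType.
Local Notation pt := (R * R)%type.
Implicit Types (p q z u v : pt).

Definition extreme p u v q := forall x y z : R, 0 <= x -> 0 <= y -> 0 <= z ->
  x + y + z = 1 -> p.1 = x * u.1 + y * v.1 + z * q.1 ->
  p.2 = x * u.2 + y * v.2 + z * q.2 -> False.

Lemma extreme_perm p u v q : extreme p u v q -> extreme p v u q /\ extreme p v q u.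
Proof.
move=> h; split=> x y z x0 y0 z0 s e1 e2.
  by apply: (h y x z) => //; lra.
by apply: (h z x y) => //; lra.
Qed.

Definition affdep (u1 u2 u3 u4 : pt) (e1 e2 e3 e4 : R) :=
  [/\ e1 + e2 + e3 + e4 = 0,
      e1 * u1.1 + e2 * u2.1 + e3 * u3.1 + e4 * u4.1 = 0 &
      e1 * u1.2 + e2 * u2.2 + e3 * u3.2 + e4 * u4.2 = 0].

Lemma affdepN u1 u2 u3 u4 e1 e2 e3 e4 : affdep u1 u2 u3 u4 e1 e2 e3 e4 ->
  affdep u1 u2 u3 u4 (- e1) (- e2) (- e3) (- e4).
Proof. by case=> h1 h2 h3; split; lra. Qed.

Lemma affdep_neg1 u1 u2 u3 u4 e1 e2 e3 e4 : extreme u1 u2 u3 u4 ->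
  affdep u1 u2 u3 u4 e1 e2 e3 e4 -> e1 < 0 -> 0 <= e2 -> 0 <= e3 -> 0 <= e4 -> False.
Proof.
move=> ext [h1 h2 h3] n1 p2 p3 p4.
have n0 : 0 < - e1 by lra.
have en : - e1 != 0 by rewrite gt_eqF.
apply: (ext (e2 / - e1) (e3 / - e1) (e4 / - e1)).
- by rewrite divr_ge0 // ltW.
- by rewrite divr_ge0 // ltW.
- by rewrite divr_ge0 // ltW.
- by rewrite -!mulrDl (_ : e2 + e3 + e4 = - e1) ?divff //; lra.
- by apply: (mulfI en); rewrite !mulrDr ![_ / - e1]mulrC !mulrA divff // !mul1r; lra.
- by apply: (mulfI en); rewrite !mulrDr ![_ / - e1]mulrC !mulrA divff // !mul1r; lra.
Qed.

Definition extreme4 u1 u2 u3 u4 := [/\ extreme u1 u2 u3 u4, extreme u2 u3 u4 u1,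
  extreme u3 u4 u1 u2 & extreme u4 u1 u2 u3].

Lemma affdep_rot u1 u2 u3 u4 e1 e2 e3 e4 : affdep u1 u2 u3 u4 e1 e2 e3 e4 ->
  affdep u2 u3 u4 u1 e2 e3 e4 e1.
Proof. by case=> h1 h2 h3; split; lra. Qed.

Lemma two_neg (a b c d : R) : a + b + c + d = 0 ->
  (0 < a -> b <= 0 -> c <= 0 -> d <= 0 -> False) ->
  (0 < b -> a <= 0 -> c <= 0 -> d <= 0 -> False) ->
  0 <= a -> 0 <= b -> c < 0 -> d < 0 -> 0 < a /\ 0 < b.
Proof.
move=> s ma mb a0 b0 c0 d0; have [c1 d1] := (ltW c0, ltW d0).
have [a1|a1] := ltP 0 a; last by case: mb => //; lra.
by split=> //; have [//|b1] := ltP 0 b; case: ma.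
Qed.

(** A single coefficient of one sign would put that point into the convex hull of the others. Hence
    a non-zero dependency has two positive and two negative coefficients, and the pairing tells
    which segments cross. *)
Lemma affdep_pattern u1 u2 u3 u4 e1 e2 e3 e4 : extreme4 u1 u2 u3 u4 ->
  affdep u1 u2 u3 u4 e1 e2 e3 e4 ->
  [/\ e1 = 0, e2 = 0, e3 = 0 & e4 = 0] \/
  [\/ [\/ [/\ 0 < e1, e2 < 0, 0 < e3 & e4 < 0] | [/\ e1 < 0, 0 < e2, e3 < 0 & 0 < e4]],
      [\/ [/\ 0 < e1, 0 < e2, e3 < 0 & e4 < 0] | [/\ e1 < 0, e2 < 0, 0 < e3 & 0 < e4]] |
      [\/ [/\ 0 < e1, e2 < 0, e3 < 0 & 0 < e4] | [/\ e1 < 0, 0 < e2, 0 < e3 & e4 < 0]]].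
Proof.
move=> [x1 x2 x3 x4] d1; have d2 := affdep_rot d1; have d3 := affdep_rot d2.
have d4 := affdep_rot d3.
have n1 := affdep_neg1 x1 d1; have n2 := affdep_neg1 x2 d2.
have n3 := affdep_neg1 x3 d3; have n4 := affdep_neg1 x4 d4.
have m1 := affdep_neg1 x1 (affdepN d1); have m2 := affdep_neg1 x2 (affdepN d2).
have m3 := affdep_neg1 x3 (affdepN d3); have m4 := affdep_neg1 x4 (affdepN d4).
have [s _ _] := d1; clear - n1 n2 n3 n4 m1 m2 m3 m4 s.
rewrite !oppr_lt0 !oppr_ge0 in m1 m2 m3 m4.
have s12 : e1 + e2 + e3 + e4 = 0 by [].
have s13 : e1 + e3 + e2 + e4 = 0 by lra.
have s14 : e1 + e4 + e2 + e3 = 0 by lra.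
have s23 : e2 + e3 + e1 + e4 = 0 by lra.
have s24 : e2 + e4 + e1 + e3 = 0 by lra.
have s34 : e3 + e4 + e1 + e2 = 0 by lra.
have [a|a] := leP 0 e1; have [b|b] := leP 0 e2;
  have [c|c] := leP 0 e3; have [d|d] := leP 0 e4.
- by left; clear - a b c d s; split; lra.
- by case: n4.
- by case: n3.
- have [||p1 p2] := two_neg s12 _ _ a b c d; [exact: m1|move=> *; exact: m2|].
  by right; constructor 2; left.
- by case: n2.
- have [||p1 p2] := two_neg s13 _ _ a c b d;
    [by move=> *; exact: m1|by move=> *; exact: m3|].
  by right; constructor 1; left.
- have [||p1 p2] := two_neg s14 _ _ a d b c;
    [by move=> *; exact: m1|by move=> *; exact: m4|].
  by right; constructor 3; left.
- by case: m1; try exact: ltW; clear - a b c d s; lra.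
- by case: n1.
- have [||p1 p2] := two_neg s23 _ _ b c a d;
    [by move=> *; exact: m2|by move=> *; exact: m3|].
  by right; constructor 3; right.
- have [||p1 p2] := two_neg s24 _ _ b d a c;
    [by move=> *; exact: m2|by move=> *; exact: m4|].
  by right; constructor 1; right.
- by case: m2; try exact: ltW; clear - a b c d s; lra.
- have [||p1 p2] := two_neg s34 _ _ c d a b;
    [by move=> *; exact: m3|by move=> *; exact: m4|].
  by right; constructor 2; right.
- by case: m3; try exact: ltW; clear - a b c d s; lra.
- by case: m4; try exact: ltW; clear - a b c d s; lra.
- by exfalso; clear - a b c d s; lra.
Qed.

(** Consequently two dependencies with one coefficient in common coincide, which is where the rank
    one below comes from. *)
Lemma affdep0 u1 u2 u3 u4 e1 e2 e3 e4 : extreme4 u1 u2 u3 u4 ->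
  affdep u1 u2 u3 u4 e1 e2 e3 e4 -> [\/ e1 = 0, e2 = 0, e3 = 0 | e4 = 0] ->
  [/\ e1 = 0, e2 = 0, e3 = 0 & e4 = 0].
Proof.
move=> x d h; have [//|] := affdep_pattern x d.
by move=> [] [] [h1 h2 h3 h4]; case: h => h; move: h1 h2 h3 h4; rewrite h ltxx.
Qed.

Lemma extreme_orient u1 u2 u3 u4 : extreme4 u1 u2 u3 u4 -> orient u1 u2 u3 != 0.
Proof.
move=> x; apply/eqP => o.
have d1 : affdep u1 u2 u3 u4 (u2.1 - u3.1) (u3.1 - u1.1) (u1.1 - u2.1) 0.
  by move: o; rewrite /orient => o; split; [ring|ring|lra].
have d2 : affdep u1 u2 u3 u4 (u2.2 - u3.2) (u3.2 - u1.2) (u1.2 - u2.2) 0.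
  by move: o; rewrite /orient => o; split; [ring|lra|ring].
have [_ _ h1 _] := affdep0 x d1 (Or44 _ _ _ erefl).
have [_ _ h2 _] := affdep0 x d2 (Or44 _ _ _ erefl).
have d3 : affdep u1 u2 u3 u4 1 (-1) 0 0 by split; lra.
have [h3 _ _ _] := affdep0 x d3 (Or44 _ _ _ erefl).
by have := oner_neq0 R; rewrite h3 eqxx.
Qed.

End JohnFour.

(** * The common cyclic order of the contact pairs *)

Section JohnFourLabels.
Variable R : realFieldType.
Local Notation pt := (R * R)%type.
Implicit Types (p q z u v : pt).

(** John's identity is kept in transposed form, [x = sum a_i <x, v_i> u_i], because points are to be
    expressed through the [u_i]. *)
Record john4 (u1 u2 u3 u4 v1 v2 v3 v4 : pt) (a1 a2 a3 a4 : R) : Prop := John4 {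
  j_pos : [/\ 0 < a1, 0 < a2, 0 < a3 & 0 < a4];
  j_id1 : forall x, x.1 = a1 * dot2 x v1 * u1.1 + a2 * dot2 x v2 * u2.1 +
                          a3 * dot2 x v3 * u3.1 + a4 * dot2 x v4 * u4.1;
  j_id2 : forall x, x.2 = a1 * dot2 x v1 * u1.2 + a2 * dot2 x v2 * u2.2 +
                          a3 * dot2 x v3 * u3.2 + a4 * dot2 x v4 * u4.2;
  j_u1 : a1 * u1.1 + a2 * u2.1 + a3 * u3.1 + a4 * u4.1 = 0;
  j_u2 : a1 * u1.2 + a2 * u2.2 + a3 * u3.2 + a4 * u4.2 = 0;
  j_v : forall x, a1 * dot2 x v1 + a2 * dot2 x v2 + a3 * dot2 x v3 + a4 * dot2 x v4 = 0;
  j_sum : a1 + a2 + a3 + a4 = 2;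
  j_le1 : [/\ dot2 u1 v1 = 1, dot2 u1 v2 <= 1, dot2 u1 v3 <= 1 & dot2 u1 v4 <= 1];
  j_le2 : [/\ dot2 u2 v1 <= 1, dot2 u2 v2 = 1, dot2 u2 v3 <= 1 & dot2 u2 v4 <= 1];
  j_le3 : [/\ dot2 u3 v1 <= 1, dot2 u3 v2 <= 1, dot2 u3 v3 = 1 & dot2 u3 v4 <= 1];
  j_le4 : [/\ dot2 u4 v1 <= 1, dot2 u4 v2 <= 1, dot2 u4 v3 <= 1 & dot2 u4 v4 = 1];
  j_extu : extreme4 u1 u2 u3 u4;
  j_extv : extreme4 v1 v2 v3 v4 }.

Lemma extreme4_swap23 u1 u2 u3 u4 : extreme4 u1 u2 u3 u4 -> extreme4 u1 u3 u2 u4.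
Proof.
move=> [h1 h2 h3 h4]; split.
- by have [h _] := extreme_perm h1.
- by have [_ h] := extreme_perm h3; have [_ g] := extreme_perm h.
- by have [_ h] := extreme_perm h2.
- by have [h _] := extreme_perm h4; have [_ g] := extreme_perm h.
Qed.

Lemma extreme4_rot u1 u2 u3 u4 : extreme4 u1 u2 u3 u4 -> extreme4 u2 u3 u4 u1.
Proof. by case. Qed.

Lemma john4_swap23 u1 u2 u3 u4 v1 v2 v3 v4 a1 a2 a3 a4 :
  john4 u1 u2 u3 u4 v1 v2 v3 v4 a1 a2 a3 a4 ->
  john4 u1 u3 u2 u4 v1 v3 v2 v4 a1 a3 a2 a4.
Proof.
case=> [[? ? ? ?] i1 i2 U1 U2 V s [? ? ? ?] [? ? ? ?] [? ? ? ?] [? ? ? ?] eu ev].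
split => //; try lra; try exact: extreme4_swap23.
- by move=> x; rewrite {1}(i1 x); ring.
- by move=> x; rewrite {1}(i2 x); ring.
- by move=> x; rewrite -[RHS](V x); ring.
Qed.

Lemma john4_rot u1 u2 u3 u4 v1 v2 v3 v4 a1 a2 a3 a4 :
  john4 u1 u2 u3 u4 v1 v2 v3 v4 a1 a2 a3 a4 ->
  john4 u2 u3 u4 u1 v2 v3 v4 v1 a2 a3 a4 a1.
Proof.
case=> [[? ? ? ?] i1 i2 U1 U2 V s [? ? ? ?] [? ? ? ?] [? ? ? ?] [? ? ? ?] eu ev].
split => //; try lra; try exact: extreme4_rot.
- by move=> x; rewrite {1}(i1 x); ring.
- by move=> x; rewrite {1}(i2 x); ring.
- by move=> x; rewrite -[RHS](V x); ring.
Qed.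

(* The defect [delta_ij - a_j (<u_i, v_j> + 1 / 2)] is a rank one matrix
   [y_i e_j] with [e] an affine dependency of the [u_i]. *)
Lemma john4_rank1 u1 u2 u3 u4 v1 v2 v3 v4 a1 a2 a3 a4 e1 e2 e3 e4 :
  john4 u1 u2 u3 u4 v1 v2 v3 v4 a1 a2 a3 a4 ->
  affdep u1 u2 u3 u4 e1 e2 e3 e4 -> e1 != 0 ->
  forall x (d1 d2 d3 d4 : R), d1 + d2 + d3 + d4 = 1 ->
   x.1 = d1 * u1.1 + d2 * u2.1 + d3 * u3.1 + d4 * u4.1 ->
   x.2 = d1 * u1.2 + d2 * u2.2 + d3 * u3.2 + d4 * u4.2 ->
   exists y : R, [/\ a1 * (dot2 x v1 + 1 / 2) = d1 - y * e1,
     a2 * (dot2 x v2 + 1 / 2) = d2 - y * e2,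
     a3 * (dot2 x v3 + 1 / 2) = d3 - y * e3 &
     a4 * (dot2 x v4 + 1 / 2) = d4 - y * e4].
Proof.
move=> j [E0 E1 E2] en x d1 d2 d3 d4 ds x1 x2.
pose y := (d1 - a1 * (dot2 x v1 + 1 / 2)) / e1.
exists y.
have ye : y * e1 = d1 - a1 * (dot2 x v1 + 1 / 2) by rewrite /y divfK.
have dep : affdep u1 u2 u3 u4 (d1 - a1 * (dot2 x v1 + 1 / 2) - y * e1)
   (d2 - a2 * (dot2 x v2 + 1 / 2) - y * e2)
   (d3 - a3 * (dot2 x v3 + 1 / 2) - y * e3)
   (d4 - a4 * (dot2 x v4 + 1 / 2) - y * e4).
  split.
  - transitivity ((d1 + d2 + d3 + d4) - (a1 * dot2 x v1 + a2 * dot2 x v2 +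
       a3 * dot2 x v3 + a4 * dot2 x v4) - (a1 + a2 + a3 + a4) / 2
       - y * (e1 + e2 + e3 + e4)); first by field.
    by rewrite ds (j_v j) (j_sum j) E0; field.
  - transitivity ((d1 * u1.1 + d2 * u2.1 + d3 * u3.1 + d4 * u4.1) -
       (a1 * dot2 x v1 * u1.1 + a2 * dot2 x v2 * u2.1 +
                          a3 * dot2 x v3 * u3.1 + a4 * dot2 x v4 * u4.1)
       - (a1 * u1.1 + a2 * u2.1 + a3 * u3.1 + a4 * u4.1) / 2
       - y * (e1 * u1.1 + e2 * u2.1 + e3 * u3.1 + e4 * u4.1)); first by field.
    by rewrite -x1 -(j_id1 j) (j_u1 j) E1; field.
  - transitivity ((d1 * u1.2 + d2 * u2.2 + d3 * u3.2 + d4 * u4.2) -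
       (a1 * dot2 x v1 * u1.2 + a2 * dot2 x v2 * u2.2 +
                          a3 * dot2 x v3 * u3.2 + a4 * dot2 x v4 * u4.2)
       - (a1 * u1.2 + a2 * u2.2 + a3 * u3.2 + a4 * u4.2) / 2
       - y * (e1 * u1.2 + e2 * u2.2 + e3 * u3.2 + e4 * u4.2)); first by field.
    by rewrite -x2 -(j_id2 j) (j_u2 j) E2; field.
have [|h1 h2 h3 h4] := affdep0 (j_extu j) dep.
  by constructor 1; rewrite ye subrr.
by clear - h1 h2 h3 h4; split; lra.
Qed.

(** In a rank one matrix the off-diagonal product [(y_i e_k)(y_k e_i)] equals the diagonal product
    [(1 - b_i)(1 - b_k)]. The bounds [<u_i, v_k> <= 1] give the off-diagonal product the upper bound
    [b_i b_k], with [b = 3 a / 2]. *)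
Lemma bad_pair (yi yk ei ek bi bk : R) : yi * ei = 1 - bi -> yk * ek = 1 - bk ->
  yi * ek <= 0 -> - bk <= yi * ek -> yk * ei <= 0 -> - bi <= yk * ei -> 1 <= bi + bk.
Proof.
move=> h1 h2 n1 b1 n2 b2.
have : - (yi * ek) * - (yk * ei) <= bk * bi by rewrite ler_pM ?oppr_ge0 // lerNl.
have -> : - (yi * ek) * - (yk * ei) = (yi * ei) * (yk * ek) by ring.
by rewrite h1 h2; lra.
Qed.

(** The [y_i] are absolute values here, the alternating signs being written out. The last four
    fields say that neighbouring rows of the matrix are proportional. *)
Record ordered4 (u1 u2 u3 u4 v1 v2 v3 v4 : pt) (a1 a2 a3 a4 y1 y2 y3 y4 : R) : Prop :=
 Ordered4 {
  o_y : [/\ 0 < y1, 0 < y2, 0 < y3 & 0 < y4];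
  o_dep0 : a1 * y1 - a2 * y2 + a3 * y3 - a4 * y4 = 0;
  o_dep : forall x, a1 * y1 * dot2 x v1 - a2 * y2 * dot2 x v2 + a3 * y3 * dot2 x v3
     - a4 * y4 * dot2 x v4 = 0;
  o_opp : [/\ dot2 u1 v3 < - (1 / 2), dot2 u3 v1 < - (1 / 2),
              dot2 u2 v4 < - (1 / 2) & dot2 u4 v2 < - (1 / 2)];
  o_adj1 : [/\ - (1 / 2) < dot2 u1 v2, - (1 / 2) < dot2 u2 v1,
              - (1 / 2) < dot2 u2 v3 & - (1 / 2) < dot2 u3 v2];
  o_adj2 : [/\ - (1 / 2) < dot2 u3 v4, - (1 / 2) < dot2 u4 v3,
              - (1 / 2) < dot2 u4 v1 & - (1 / 2) < dot2 u1 v4];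
  o_12 : y2 * (dot2 u1 v3 + 1 / 2) + y1 * (dot2 u2 v3 + 1 / 2) = 0 /\
         y2 * (dot2 u1 v4 + 1 / 2) + y1 * (dot2 u2 v4 + 1 / 2) = 0;
  o_23 : y3 * (dot2 u2 v4 + 1 / 2) + y2 * (dot2 u3 v4 + 1 / 2) = 0 /\
         y3 * (dot2 u2 v1 + 1 / 2) + y2 * (dot2 u3 v1 + 1 / 2) = 0;
  o_34 : y4 * (dot2 u3 v1 + 1 / 2) + y3 * (dot2 u4 v1 + 1 / 2) = 0 /\
         y4 * (dot2 u3 v2 + 1 / 2) + y3 * (dot2 u4 v2 + 1 / 2) = 0;
  o_41 : y1 * (dot2 u4 v2 + 1 / 2) + y4 * (dot2 u1 v2 + 1 / 2) = 0 /\
         y1 * (dot2 u4 v3 + 1 / 2) + y4 * (dot2 u1 v3 + 1 / 2) = 0 }.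

Lemma pos_of_mul (a x c : R) : 0 < a -> a * x = c -> (0 < c -> 0 < x) /\ (c < 0 -> x < 0).
Proof. by move=> a0 <-; rewrite pmulr_rgt0 // pmulr_rlt0. Qed.

Lemma adj_rel (a g g' y y' e : R) : 0 < a -> a * g = 0 - y * e -> a * g' = 0 - y' * e ->
  - y' * g + y * g' = 0.
Proof.
move=> a0 h h'; apply: (mulfI (lt0r_neq0 a0)); rewrite mulr0.
transitivity (- y' * (a * g) + y * (a * g')); first by ring.
by rewrite h h'; ring.
Qed.

(** The numbers [a_i y_i] form an affine dependency of the [v_i], so six sign patterns are possible.
    The pattern opposite to that of [e] contradicts the trace [sum y_i e_i = 1]. In the four
    patterns with another pairing, two diagonal entries are negative, so the other two indices have
    [b_i + b_k < 1] because all four [b_i] add up to 3; this contradicts [bad_pair]. *)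
Lemma john4_ordered u1 u2 u3 u4 v1 v2 v3 v4 a1 a2 a3 a4 e1 e2 e3 e4 :
  john4 u1 u2 u3 u4 v1 v2 v3 v4 a1 a2 a3 a4 ->
  affdep u1 u2 u3 u4 e1 e2 e3 e4 -> 0 < e1 -> e2 < 0 -> 0 < e3 -> e4 < 0 ->
  exists y1 y2 y3 y4, ordered4 u1 u2 u3 u4 v1 v2 v3 v4 a1 a2 a3 a4 y1 y2 y3 y4.
Proof.
move=> j dep p1 p2 p3 p4.
have e1n : e1 != 0 by rewrite gt_eqF.
have rk := john4_rank1 j dep e1n.
have [||| y1 [E11 E12 E13 E14]] := rk u1 1 0 0 0; [by ring..|].
have [||| y2 [E21 E22 E23 E24]] := rk u2 0 1 0 0; [by ring..|].
have [||| y3 [E31 E32 E33 E34]] := rk u3 0 0 1 0; [by ring..|].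
have [||| y4 [E41 E42 E43 E44]] := rk u4 0 0 0 1; [by ring..|].
have [a10 a20 a30 a40] := j_pos j.
have [d1 d12 d13 d14] := j_le1 j; have [d21 d2 d23 d24] := j_le2 j.
have [d31 d32 d3 d34] := j_le3 j; have [d41 d42 d43 d4] := j_le4 j.
have sj := j_sum j.
have bound (a g : R) : 0 < a -> g <= 1 -> a * (g + 1 / 2) <= 3 / 2 * a.
  by move=> a0 g1; rewrite mulrC ler_pM2r //; lra.
have b12 := bound _ _ a20 d12; have b13 := bound _ _ a30 d13.
have b14 := bound _ _ a40 d14; have b21 := bound _ _ a10 d21.
have b23 := bound _ _ a30 d23; have b24 := bound _ _ a40 d24.
have b31 := bound _ _ a10 d31; have b32 := bound _ _ a20 d32.
have b34 := bound _ _ a40 d34; have b41 := bound _ _ a10 d41.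
have b42 := bound _ _ a20 d42; have b43 := bound _ _ a30 d43.
rewrite d1 in E11; rewrite d2 in E22; rewrite d3 in E33; rewrite d4 in E44.
have f1 : y1 * e1 = 1 - 3 / 2 * a1 by clear - E11; lra.
have f2 : y2 * e2 = 1 - 3 / 2 * a2 by clear - E22; lra.
have f3 : y3 * e3 = 1 - 3 / 2 * a3 by clear - E33; lra.
have f4 : y4 * e4 = 1 - 3 / 2 * a4 by clear - E44; lra.
rewrite E12 in b12; rewrite E13 in b13; rewrite E14 in b14.
rewrite E21 in b21; rewrite E23 in b23; rewrite E24 in b24.
rewrite E31 in b31; rewrite E32 in b32; rewrite E34 in b34.
rewrite E41 in b41; rewrite E42 in b42; rewrite E43 in b43.
(* After multiplication by [e1] the sums run over the first column of the rank one matrix, where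
   John's identity and the balance of the [u_i] evaluate them. *)
have vdep : (a1 * y1 + a2 * y2 + a3 * y3 + a4 * y4 = 0) /\
   forall x, a1 * y1 * dot2 x v1 + a2 * y2 * dot2 x v2 + a3 * y3 * dot2 x v3
     + a4 * y4 * dot2 x v4 = 0.
  split.
    apply: (mulIf e1n); rewrite mul0r.
    transitivity (a1 * (1 - a1 * (1 + 1 / 2)) - a2 * (a1 * (dot2 u2 v1 + 1 / 2))
      - a3 * (a1 * (dot2 u3 v1 + 1 / 2)) - a4 * (a1 * (dot2 u4 v1 + 1 / 2))).
      by rewrite E11 E21 E31 E41; ring.
    transitivity (a1 - a1 * ((a1 * u1.1 + a2 * u2.1 + a3 * u3.1 + a4 * u4.1) * v1.1
      + (a1 * u1.2 + a2 * u2.2 + a3 * u3.2 + a4 * u4.2) * v1.2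
      + (a1 + a2 + a3 + a4) / 2) - a1 * a1 * (1 - dot2 u1 v1)).
      by rewrite /dot2; field.
    by rewrite (j_u1 j) (j_u2 j) sj d1; field.
  move=> x; apply: (mulIf e1n); rewrite mul0r.
  transitivity (a1 * dot2 x v1 * (1 - a1 * (1 + 1 / 2))
      - a2 * dot2 x v2 * (a1 * (dot2 u2 v1 + 1 / 2))
      - a3 * dot2 x v3 * (a1 * (dot2 u3 v1 + 1 / 2))
      - a4 * dot2 x v4 * (a1 * (dot2 u4 v1 + 1 / 2))).
    by rewrite E11 E21 E31 E41; ring.
  transitivity (a1 * dot2 x v1 - a1 * ((a1 * dot2 x v1 * u1.1 + a2 * dot2 x v2 * u2.1 +
        a3 * dot2 x v3 * u3.1 + a4 * dot2 x v4 * u4.1) * v1.1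
      + (a1 * dot2 x v1 * u1.2 + a2 * dot2 x v2 * u2.2 +
        a3 * dot2 x v3 * u3.2 + a4 * dot2 x v4 * u4.2) * v1.2
      + (a1 * dot2 x v1 + a2 * dot2 x v2 + a3 * dot2 x v3 + a4 * dot2 x v4) / 2)
      - a1 * a1 * dot2 x v1 * (1 - dot2 u1 v1)).
    by rewrite [dot2 u1 v1]/dot2 [dot2 u2 v1]/dot2 [dot2 u3 v1]/dot2 [dot2 u4 v1]/dot2; field.
  by rewrite -(j_id1 j) -(j_id2 j) (j_v j) d1 /dot2; field.
have [v0 vx] := vdep.
have vd : affdep v1 v2 v3 v4 (a1 * y1) (a2 * y2) (a3 * y3) (a4 * y4).
  split; first exact: v0.
    by have := vx (1, 0); rewrite /dot2 /= !mul1r !mul0r !addr0.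
  by have := vx (0, 1); rewrite /dot2 /= !mul1r !mul0r !add0r.
have sy : y1 * e1 + y2 * e2 + y3 * e3 + y4 * e4 = 1.
  by rewrite f1 f2 f3 f4; clear - sj; lra.
clear E11 E22 E33 E44 rk vdep dep bound d12 d13 d14 d21 d23 d24 d31 d32 d34 d41 d42 d43.
have sgp (y e : R) : 0 < y -> 0 < e -> 0 < y * e by exact: mulr_gt0.
have sgn1 (y e : R) : 0 < y -> e < 0 -> y * e < 0 by move=> *; rewrite pmulr_rlt0.
have sgn2 (y e : R) : y < 0 -> 0 < e -> y * e < 0 by move=> *; rewrite pmulr_llt0.
have sgn3 (y e : R) : y < 0 -> e < 0 -> 0 < y * e by move=> *; rewrite nmulr_rgt0.
have [[h1 h2 h3 h4]|] := affdep_pattern (j_extv j) vd.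
  have yy (a y : R) : 0 < a -> a * y = 0 -> y = 0.
    by move=> a0 /eqP; rewrite mulf_eq0 gt_eqF //= => /eqP.
  exfalso; move: sy; rewrite (yy _ _ a10 h1) (yy _ _ a20 h2) (yy _ _ a30 h3) (yy _ _ a40 h4).
  by clear; lra.
rewrite !pmulr_rgt0 // !pmulr_rlt0 //.
case=> [] [] [h1 h2 h3 h4].
- exists y1, (- y2), y3, (- y4).
  have m13 := sgp _ _ h1 p3; have m31 := sgp _ _ h3 p1.
  have m24 := sgn3 _ _ h2 p4; have m42 := sgn3 _ _ h4 p2.
  have m12 := sgn1 _ _ h1 p2; have m14 := sgn1 _ _ h1 p4.
  have m32 := sgn1 _ _ h3 p2; have m34 := sgn1 _ _ h3 p4.
  have m21 := sgn2 _ _ h2 p1; have m23 := sgn2 _ _ h2 p3.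
  have m41 := sgn2 _ _ h4 p1; have m43 := sgn2 _ _ h4 p3.
  have low (a g m : R) : 0 < a -> a * (g + 1 / 2) = 0 - m -> 0 < m -> g < - (1 / 2).
    move=> a0 E m0; have [_ h] := pos_of_mul a0 E.
    have : g + 1 / 2 < 0 by apply: h; clear - m0; lra.
    by clear; lra.
  have upp (a g m : R) : 0 < a -> a * (g + 1 / 2) = 0 - m -> m < 0 -> - (1 / 2) < g.
    move=> a0 E m0; have [h _] := pos_of_mul a0 E.
    have : 0 < g + 1 / 2 by apply: h; clear - m0; lra.
    by clear; lra.
  split.
  + by rewrite !oppr_gt0.
  + by rewrite -[RHS]v0; ring.
  + by move=> x; rewrite -[RHS](vx x); ring.
  + split; [exact: low E13 m13|exact: low E31 m31|exact: low E24 m24|exact: low E42 m42].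
  + split; [exact: upp E12 m12|exact: upp E21 m21|exact: upp E23 m23|exact: upp E32 m32].
  + split; [exact: upp E34 m34|exact: upp E43 m43|exact: upp E41 m41|exact: upp E14 m14].
  + split; [have := adj_rel a30 E13 E23|have := adj_rel a40 E14 E24] => //.
  + split; [have := adj_rel a40 E24 E34|have := adj_rel a10 E21 E31] => h;
      apply: oppr_inj; rewrite oppr0 -[RHS]h; ring.
  + split; [have := adj_rel a10 E31 E41|have := adj_rel a20 E32 E42] => //.
  + split; [have := adj_rel a20 E42 E12|have := adj_rel a30 E43 E13] => h;
      apply: oppr_inj; rewrite oppr0 -[RHS]h; ring.
- have m1 := sgn2 _ _ h1 p1; have m2 := sgn1 _ _ h2 p2.
  have m3 := sgn2 _ _ h3 p3; have m4 := sgn1 _ _ h4 p4.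
  by exfalso; clear - m1 m2 m3 m4 sy; lra.
- have m2 := sgn1 _ _ h2 p2; have m3 := sgn2 _ _ h3 p3.
  have m14 := sgn1 _ _ h1 p4; have m41 := sgn2 _ _ h4 p1.
  have : 1 <= 3 / 2 * a1 + 3 / 2 * a4.
    by apply: (bad_pair f1 f4); [exact: ltW|clear - b14|exact: ltW|clear - b41]; lra.
  by clear - m2 m3 f2 f3 sj; lra.
- have m1 := sgn2 _ _ h1 p1; have m4 := sgn1 _ _ h4 p4.
  have m23 := sgn2 _ _ h2 p3; have m32 := sgn1 _ _ h3 p2.
  have : 1 <= 3 / 2 * a2 + 3 / 2 * a3.
    by apply: (bad_pair f2 f3); [exact: ltW|clear - b23|exact: ltW|clear - b32]; lra.
  by clear - m1 m4 f1 f4 sj; lra.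
- have m3 := sgn2 _ _ h3 p3; have m4 := sgn1 _ _ h4 p4.
  have m12 := sgn1 _ _ h1 p2; have m21 := sgn2 _ _ h2 p1.
  have : 1 <= 3 / 2 * a1 + 3 / 2 * a2.
    by apply: (bad_pair f1 f2); [exact: ltW|clear - b12|exact: ltW|clear - b21]; lra.
  by clear - m3 m4 f3 f4 sj; lra.
have m1 := sgn2 _ _ h1 p1; have m2 := sgn1 _ _ h2 p2.
have m34 := sgn1 _ _ h3 p4; have m43 := sgn2 _ _ h4 p3.
have : 1 <= 3 / 2 * a3 + 3 / 2 * a4.
  by apply: (bad_pair f3 f4); [exact: ltW|clear - b34|exact: ltW|clear - b43]; lra.
by clear - m1 m2 f1 f2 sj; lra.
Qed.

End JohnFourLabels.

(** * Contact points as vertices of the outer quadrilateral *)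

Section FourContactPairs.
Variable R : realFieldType.
Local Notation pt := (R * R)%type.
Local Notation o2 := ((0, 0) : pt).
Implicit Types (K L : pt -> Prop) (p q z u v n : pt).

(** Once [L] is known to lie in [-2K] and 0 is interior to [K], these are the common boundary points
    of [L] and [-2K]; see [boundary_tight]. *)
Definition tight K L z := L z /\ ~ int2 K (opp_half o2 z).

Record lab K L u1 u2 u3 u4 v1 v2 v3 v4 (a1 a2 a3 a4 y1 y2 y3 y4 : R) : Prop := Lab {
  lK : conv2 K; lL : conv2 L; lp : cpt2 L; lKL : forall p, K p -> L p;
  lu : [/\ K u1, K u2, K u3 & K u4];
  lv : forall z, L z -> [/\ dot2 z v1 <= 1, dot2 z v2 <= 1, dot2 z v3 <= 1 & dot2 z v4 <= 1];
  lj : john4 u1 u2 u3 u4 v1 v2 v3 v4 a1 a2 a3 a4;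
  lo : ordered4 u1 u2 u3 u4 v1 v2 v3 v4 a1 a2 a3 a4 y1 y2 y3 y4;
  lor : [/\ 0 < orient u1 u2 u3, 0 < orient u2 u3 u4, 0 < orient u3 u4 u1 &
            0 < orient u4 u1 u2] }.

Lemma ordered4_rot u1 u2 u3 u4 v1 v2 v3 v4 a1 a2 a3 a4 y1 y2 y3 y4 :
  ordered4 u1 u2 u3 u4 v1 v2 v3 v4 a1 a2 a3 a4 y1 y2 y3 y4 ->
  ordered4 u2 u3 u4 u1 v2 v3 v4 v1 a2 a3 a4 a1 y2 y3 y4 y1.
Proof.
case=> [[? ? ? ?] h1 h2 [? ? ? ?] [? ? ? ?] [? ? ? ?] [? ?] [? ?] [? ?] [? ?]].
split => //.
  by apply: oppr_inj; rewrite oppr0 -[RHS]h1; ring.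
by move=> x; apply: oppr_inj; rewrite oppr0 -[RHS](h2 x); ring.
Qed.

Lemma lab_rot K L u1 u2 u3 u4 v1 v2 v3 v4 a1 a2 a3 a4 y1 y2 y3 y4 :
  lab K L u1 u2 u3 u4 v1 v2 v3 v4 a1 a2 a3 a4 y1 y2 y3 y4 ->
  lab K L u2 u3 u4 u1 v2 v3 v4 v1 a2 a3 a4 a1 y2 y3 y4 y1.
Proof.
case=> cK cL pL KL [? ? ? ?] Lv j o [? ? ? ?]; split => //.
- by move=> z /Lv[].
- exact: john4_rot.
- exact: ordered4_rot.
Qed.

(* The vertex of [{v_1 <= 1, ..., v_4 <= 1}] opposite to the edge [u, u']. *)
Definition vertex (y y' : R) u u' : pt :=
  (- 2 * (y' * u.1 + y * u'.1) / (y + y'), - 2 * (y' * u.2 + y * u'.2) / (y + y')).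

Lemma half_vertex (y y' : R) u u' : 0 < y -> 0 < y' ->
  opp_half o2 (vertex y y' u u') = seg (y / (y + y')) u u'.
Proof.
move=> y0 y'0; have s : y + y' != 0 by rewrite gt_eqF // addr_gt0.
by rewrite /opp_half /vertex /seg /=; congr pair; field.
Qed.

Lemma ratio01 (y y' : R) : 0 < y -> 0 < y' -> 0 < y / (y + y') < 1.
Proof.
move=> y0 y'0; have s : 0 < y + y' by rewrite addr_gt0.
by rewrite divr_gt0 //= ltr_pdivrMr // mul1r ltrDl.
Qed.

Definition defect (a : R) z v : R := a / 2 * (1 - dot2 z v).

Section Lab.
Variables (K L : pt -> Prop) (u1 u2 u3 u4 v1 v2 v3 v4 : pt).
Variables (a1 a2 a3 a4 y1 y2 y3 y4 : R).
Hypothesis l : lab K L u1 u2 u3 u4 v1 v2 v3 v4 a1 a2 a3 a4 y1 y2 y3 y4.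

Local Notation z12 := (vertex y3 y4 u3 u4).

(** The two equalities are the proportionality of the rows of [u3] and [u4] in the columns of [v1]
    and [v2]; the strict inequalities use that neighbouring products exceed [-1/2]. *)
Lemma vertex_dot : [/\ dot2 z12 v1 = 1, dot2 z12 v2 = 1, dot2 z12 v3 < 1 & dot2 z12 v4 < 1].
Proof.
have [Y1 Y2 Y3 Y4] := o_y (lo l); have [e1 e2] := o_34 (lo l).
have [_ _ _ d3] := j_le3 (lj l); have [_ _ d43 d4] := j_le4 (lj l).
have [_ _ d33 _] := j_le3 (lj l); have [g34 g43 _ _] := o_adj2 (lo l).
have s : 0 < y3 + y4 by rewrite addr_gt0.
have sn : y3 + y4 != 0 by rewrite gt_eqF.
have dE v : dot2 z12 v = - 2 * (y4 * dot2 u3 v + y3 * dot2 u4 v) / (y3 + y4).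
  by rewrite /vertex /dot2 /=; field.
split; rewrite dE.
- by apply: (mulIf sn); rewrite divfK // mul1r; lra.
- by apply: (mulIf sn); rewrite divfK // mul1r; lra.
- rewrite ltr_pdivrMr // mul1r d33.
  have : y3 * - (1 / 2) < y3 * dot2 u4 v3 by rewrite ltr_pM2l.
  by lra.
- rewrite ltr_pdivrMr // mul1r d4.
  have : y4 * - (1 / 2) < y4 * dot2 u3 v4 by rewrite ltr_pM2l.
  by lra.
Qed.

Lemma half_comb z : defect a1 z v1 + defect a2 z v2 + defect a3 z v3 + defect a4 z v4 = 1 /\
  opp_half o2 z = (defect a1 z v1 * u1.1 + defect a2 z v2 * u2.1 + defect a3 z v3 * u3.1 + defect a4 z v4 * u4.1,
               defect a1 z v1 * u1.2 + defect a2 z v2 * u2.2 + defect a3 z v3 * u3.2 + defect a4 z v4 * u4.2).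
Proof.
have j := lj l; split.
  transitivity ((a1 + a2 + a3 + a4) / 2 - (a1 * dot2 z v1 + a2 * dot2 z v2 +
     a3 * dot2 z v3 + a4 * dot2 z v4) / 2); first by rewrite /defect; field.
  by rewrite (j_sum j) (j_v j); field.
rewrite /opp_half; congr pair.
  transitivity ((a1 * u1.1 + a2 * u2.1 + a3 * u3.1 + a4 * u4.1) / 2
     - (a1 * dot2 z v1 * u1.1 + a2 * dot2 z v2 * u2.1 +
        a3 * dot2 z v3 * u3.1 + a4 * dot2 z v4 * u4.1) / 2); last by rewrite /defect; field.
  by rewrite (j_u1 j) -(j_id1 j) /=; field.
transitivity ((a1 * u1.2 + a2 * u2.2 + a3 * u3.2 + a4 * u4.2) / 2
     - (a1 * dot2 z v1 * u1.2 + a2 * dot2 z v2 * u2.2 +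
        a3 * dot2 z v3 * u3.2 + a4 * dot2 z v4 * u4.2) / 2); last by rewrite /defect; field.
by rewrite (j_u2 j) -(j_id2 j) /=; field.
Qed.

Lemma comb_ge0 z : L z -> [/\ 0 <= defect a1 z v1, 0 <= defect a2 z v2, 0 <= defect a3 z v3 & 0 <= defect a4 z v4].
Proof.
have [p1 p2 p3 p4] := j_pos (lj l).
move=> /(lv l)[h1 h2 h3 h4]; rewrite /defect; split; apply: mulr_ge0;
  rewrite ?subr_ge0 //; apply: divr_ge0 => //; exact: ltW.
Qed.

(** The weights of [u1] and [u2] in [-z/2] vanish, and the dependency of the [v_i] fixes the ratio
    of the other two. *)
Lemma vertex_unique z : dot2 z v1 = 1 -> dot2 z v2 = 1 -> z = z12.
Proof.
move=> h1 h2; have [s zE] := half_comb z.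
have [Y1 Y2 Y3 Y4] := o_y (lo l).
have c1 : defect a1 z v1 = 0 by rewrite /defect h1 subrr mulr0.
have c2 : defect a2 z v2 = 0 by rewrite /defect h2 subrr mulr0.
rewrite c1 c2 !mul0r !add0r in s zE.
have e : y3 * defect a3 z v3 = y4 * defect a4 z v4.
  have := o_dep (lo l) z; have := o_dep0 (lo l); rewrite h1 h2 /defect => k1 k2.
  by lra.
have sn : y3 + y4 != 0 by rewrite gt_eqF // addr_gt0.
have c3 : defect a3 z v3 = y4 / (y3 + y4).
  apply: (mulIf sn); rewrite divfK //.
  have e4 : defect a4 z v4 = 1 - defect a3 z v3 by lra.
  rewrite e4 in e.
  by lra.
have c4 : defect a4 z v4 = y3 / (y3 + y4).
  by rewrite (_ : defect a4 z v4 = 1 - defect a3 z v3); [rewrite c3; field|lra].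
rewrite c3 c4 in zE; move: zE; rewrite /opp_half /= => -[f1 f2].
rewrite [LHS]surjective_pairing /vertex; congr pair.
  have -> : z.1 = - 2 * ((0 - z.1) / 2) by field.
  by rewrite f1; field.
have -> : z.2 = - 2 * ((0 - z.2) / 2) by field.
by rewrite f2; field.
Qed.

Lemma orient_half z : orient u1 u2 (opp_half o2 z) =
  defect a3 z v3 * orient u1 u2 u3 + defect a4 z v4 * orient u4 u1 u2.
Proof.
have [s ->] := half_comb z.
have -> : defect a1 z v1 = 1 - defect a2 z v2 - defect a3 z v3 - defect a4 z v4 by lra.
by rewrite /orient /=; ring.
Qed.

Lemma orient_half_ge0 z : L z -> 0 <= orient u1 u2 (opp_half o2 z).
Proof.
have [or1 _ _ or4] := lor l.
by move=> /comb_ge0[c1 c2 c3 c4]; rewrite orient_half addr_ge0 // mulr_ge0 // ltW.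
Qed.

Lemma orient_half_eq0 z : L z -> orient u1 u2 (opp_half o2 z) = 0 ->
  dot2 z v3 = 1 /\ dot2 z v4 = 1.
Proof.
have [or1 _ _ or4] := lor l; have [_ _ p3 p4] := j_pos (lj l).
move=> /comb_ge0[c1 c2 c3 c4]; rewrite orient_half => h.
have g3 := mulr_ge0 c3 (ltW or1); have g4 := mulr_ge0 c4 (ltW or4).
have one (x a b : R) : 0 < a -> 0 < b -> a / 2 * (1 - x) * b = 0 -> x = 1.
  move=> a0 b0 /eqP; rewrite !mulf_eq0 (gt_eqF b0) (gt_eqF a0) orbF invr_eq0 pnatr_eq0 /=.
  by rewrite subr_eq0 => /eqP.
by split; [apply: (one _ _ _ p3 or1)|apply: (one _ _ _ p4 or4)]; move: h g3 g4; rewrite /defect; lra.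
Qed.

(** The half point of this vertex is strictly between [u1] and [u2]. A point of [K] beyond the edge
    would make it interior by [edge_int]. *)
Lemma tight_edge p : tight K L (vertex y1 y2 u1 u2) -> K p -> 0 <= orient u1 u2 p.
Proof.
have [K1 K2 K3 K4] := lu l; have [Y1 Y2 _ _] := o_y (lo l); have [or1 _ _ _] := lor l.
move=> [Lz ni] Kp; rewrite leNgt; apply/negP => h; apply: ni.
exact: (edge_int (lK l) K1 K2 K3 Kp or1 h (ratio01 Y1 Y2) (half_vertex _ _ Y1 Y2)).
Qed.

Lemma vertex_contact : contact K o2 (vertex y1 y2 u1 u2) (u1.2 - u2.2, u2.1 - u1.1).
Proof.
have [K1 K2 K3 K4] := lu l; have [Y1 Y2 _ _] := o_y (lo l); have [or1 _ _ _] := lor l.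
exact: (contact_edge (lK l) K1 K2 K3 or1 (ratio01 Y1 Y2) (half_vertex _ _ Y1 Y2)).
Qed.

Lemma half_orient0 : orient u1 u2 (opp_half o2 (vertex y1 y2 u1 u2)) = 0.
Proof.
have [Y1 Y2 _ _] := o_y (lo l).
by rewrite half_vertex // /orient /seg /=; ring.
Qed.

End Lab.

(* What the improvement lemmas need to know about a contact of [L] with [-2 K]. *)
Definition edge_contact K L z n := [/\ L z, contact K o2 z n, n <> o2,
  forall p, K p -> dot2 n (opp_half o2 z) <= dot2 n p &
  exists2 p, K p & dot2 n (opp_half o2 z) < dot2 n p].

Lemma lab_edge K L u1 u2 u3 u4 v1 v2 v3 v4 a1 a2 a3 a4 y1 y2 y3 y4 :
  lab K L u1 u2 u3 u4 v1 v2 v3 v4 a1 a2 a3 a4 y1 y2 y3 y4 ->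
  tight K L (vertex y1 y2 u1 u2) ->
  exists n, edge_contact K L (vertex y1 y2 u1 u2) n.
Proof.
move=> l g; exists (u1.2 - u2.2, u2.1 - u1.1).
have [K1 K2 K3 K4] := lu l; have [or1 _ _ _] := lor l.
have h0 := half_orient0 l.
have oE p : orient u1 u2 p = dot2 (u1.2 - u2.2, u2.1 - u1.1) p
   - dot2 (u1.2 - u2.2, u2.1 - u1.1) u1 by rewrite /orient /dot2 /=; ring.
split; first by case: g.
- exact: vertex_contact l.
- by move=> [h1 h2]; move: or1; rewrite oE /dot2 /= h1 h2; clear; lra.
- by move=> p /(tight_edge l g); move: h0; rewrite !oE; clear; lra.
- by exists u3 => //; move: h0 or1; rewrite !oE; clear; lra.
Qed.

Lemma dot2_gt0 n : n <> o2 -> 0 < dot2 n n.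
Proof.
move=> n0; rewrite /dot2 -!expr2 lt_def addr_ge0 ?sqr_ge0 // andbT.
rewrite paddr_eq0 ?sqr_ge0 // !sqrf_eq0; apply/negP => /andP[/eqP h1 /eqP h2].
by apply: n0; rewrite [LHS]surjective_pairing h1 h2.
Qed.

Lemma ratio_lt2_edges2 K L z z' n n' : conv2 K -> conv2 L -> cpt2 L ->
  (forall p, K p -> L p) -> (forall z, L z -> K (opp_half o2 z)) ->
  edge_contact K L z n -> edge_contact K L z' n' ->
  (forall w, L w -> [\/ int2 K (opp_half o2 w), w = z | w = z']) -> ratio_lt2 K L.
Proof.
move=> cK cL pL KL hK [Lz cz n0 Kz ez] [Lz' cz' n0' Kz' ez'] rest.
exact: (ratio_lt2_two cK cL pL KL hK Lz Lz' Kz Kz' erefl erefl cz cz' n0 n0' ez rest).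
Qed.

Lemma ratio_lt2_edges1 K L z n : conv2 K -> conv2 L -> cpt2 L ->
  (forall p, K p -> L p) -> (forall z, L z -> K (opp_half o2 z)) ->
  edge_contact K L z n ->
  (forall w, L w -> int2 K (opp_half o2 w) \/ w = z) -> ratio_lt2 K L.
Proof.
move=> cK cL pL KL hK [Lz cz n0 Kz ez] rest.
apply: (ratio_lt2_translate cK cL pL KL hK (e := n)) => w /rest[h|->]; first by left.
by right; exists n; split=> //; exact: dot2_gt0.
Qed.

Lemma ratio_lt2_edges0 K L : conv2 K -> conv2 L -> cpt2 L ->
  (forall p, K p -> L p) -> (forall z, L z -> K (opp_half o2 z)) ->
  (forall w, L w -> int2 K (opp_half o2 w)) -> ratio_lt2 K L.
Proof.
move=> cK cL pL KL hK rest.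
by apply: (ratio_lt2_translate cK cL pL KL hK (e := o2)) => w /rest h; left.
Qed.

Lemma lab_half K L u1 u2 u3 u4 v1 v2 v3 v4 a1 a2 a3 a4 y1 y2 y3 y4 :
  lab K L u1 u2 u3 u4 v1 v2 v3 v4 a1 a2 a3 a4 y1 y2 y3 y4 ->
  forall z, L z -> K (opp_half o2 z).
Proof.
move=> l z Lz; have [K1 K2 K3 K4] := lu l; have [or1 or2 or3 or4] := lor l.
have l2 := lab_rot l; have l3 := lab_rot l2; have l4 := lab_rot l3.
exact: (quad_in (lK l) K1 K2 K3 K4 or1 or3 (orient_half_ge0 l Lz)
  (orient_half_ge0 l2 Lz) (orient_half_ge0 l3 Lz) (orient_half_ge0 l4 Lz)).
Qed.

Lemma lab_cases K L u1 u2 u3 u4 v1 v2 v3 v4 a1 a2 a3 a4 y1 y2 y3 y4 :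
  lab K L u1 u2 u3 u4 v1 v2 v3 v4 a1 a2 a3 a4 y1 y2 y3 y4 ->
  forall z, L z -> int2 K (opp_half o2 z) \/
   [\/ z = vertex y1 y2 u1 u2, z = vertex y2 y3 u2 u3,
       z = vertex y3 y4 u3 u4 | z = vertex y4 y1 u4 u1].
Proof.
move=> l z Lz; have [K1 K2 K3 K4] := lu l; have [or1 or2 or3 or4] := lor l.
have l2 := lab_rot l; have l3 := lab_rot l2; have l4 := lab_rot l3.
have := orient_half_ge0 l Lz; rewrite le_eqVlt => /orP[/eqP/esym h1|h1].
  right; constructor 1; have [k1 k2] := orient_half_eq0 l Lz h1.
  exact: (vertex_unique l3 k1 k2).
have := orient_half_ge0 l2 Lz; rewrite le_eqVlt => /orP[/eqP/esym h2|h2].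
  right; constructor 2; have [k1 k2] := orient_half_eq0 l2 Lz h2.
  exact: (vertex_unique l4 k1 k2).
have := orient_half_ge0 l3 Lz; rewrite le_eqVlt => /orP[/eqP/esym h3|h3].
  right; constructor 3; have [k1 k2] := orient_half_eq0 l3 Lz h3.
  exact: (vertex_unique l k1 k2).
have := orient_half_ge0 l4 Lz; rewrite le_eqVlt => /orP[/eqP/esym h4|h4].
  right; constructor 4; have [k1 k2] := orient_half_eq0 l4 Lz h4.
  exact: (vertex_unique l2 k1 k2).
by left; exact: (quad_int (lK l) K1 K2 K3 K4).
Qed.

End FourContactPairs.

(** * Coordinates at three of the vertices *)

Section FourContactPairsCases.
Variable R : realFieldType.
Local Notation pt := (R * R)%type.
Local Notation o2 := ((0, 0) : pt).
Implicit Types (K L : pt -> Prop) (p q z u v n : pt).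

Definition frame (o e e' : pt) : pt -> pt :=
  aff (e.1 - o.1) (e'.1 - o.1) (e.2 - o.2) (e'.2 - o.2) o.1 o.2.

Lemma frame0 o e e' : frame o e e' (0, 0) = o.
Proof. by rewrite [RHS]surjective_pairing /frame /aff /=; congr pair; ring. Qed.

Lemma frame1 o e e' : frame o e e' (1, 0) = e.
Proof. by rewrite [RHS]surjective_pairing /frame /aff /=; congr pair; ring. Qed.

Lemma frame2 o e e' : frame o e e' (0, 1) = e'.
Proof. by rewrite [RHS]surjective_pairing /frame /aff /=; congr pair; ring. Qed.

Lemma frame_dot o e e' p v : dot2 (frame o e e' p) v = dot2 o v +
  p.1 * (dot2 e v - dot2 o v) + p.2 * (dot2 e' v - dot2 o v).
Proof. by rewrite /dot2 /frame /aff /=; ring. Qed.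

Lemma frame_orient o e e' A B C : orient (frame o e e' A) (frame o e e' B)
  (frame o e e' C) = orient o e e' * orient A B C.
Proof. by rewrite /orient /frame /aff /=; ring. Qed.

Lemma frame_seg o e e' k p q : frame o e e' (seg k p q) =
  seg k (frame o e e' p) (frame o e e' q).
Proof. by rewrite /seg /frame /aff /=; congr pair; ring. Qed.

Lemma isaff_frame o e e' : orient o e e' != 0 -> isaff (frame o e e').
Proof.
move=> h; exists (e.1 - o.1), (e'.1 - o.1), (e.2 - o.2), (e'.2 - o.2), o.1, o.2.
split=> //; rewrite (_ : _ - _ = orient o e e') //.
by rewrite /orient; ring.
Qed.

(* [t] plays the role of three times the origin in the new coordinates. *)
Lemma frame_half o e e' t z : frame o e e' t = (- 2 * o.1, - 2 * o.2) ->
  frame o e e' (opp_half t z) = opp_half o2 (frame o e e' z).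
Proof.
by rewrite /frame /aff => -[h1 h2]; rewrite /opp_half /=; congr pair; lra.
Qed.

Lemma frame_sub o e e' p q : frame o e e' (p.1 - q.1, p.2 - q.2) =
  ((frame o e e' p).1 - (frame o e e' q).1 + o.1,
   (frame o e e' p).2 - (frame o e e' q).2 + o.2).
Proof. by rewrite /frame /aff /=; congr pair; ring. Qed.

Section Lab.
Variables (K L : pt -> Prop) (u1 u2 u3 u4 v1 v2 v3 v4 : pt).
Variables (a1 a2 a3 a4 y1 y2 y3 y4 : R).
Hypothesis l : lab K L u1 u2 u3 u4 v1 v2 v3 v4 a1 a2 a3 a4 y1 y2 y3 y4.
Local Notation z12 := (vertex y3 y4 u3 u4).
Local Notation z23 := (vertex y4 y1 u4 u1).
Local Notation z34 := (vertex y1 y2 u1 u2).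
Local Notation z41 := (vertex y2 y3 u2 u3).
Local Notation h := (frame z41 z12 z34).

Lemma z12_dot : [/\ dot2 z12 v1 = 1, dot2 z12 v2 = 1, dot2 z12 v3 < 1 & dot2 z12 v4 < 1].
Proof. exact: (vertex_dot l). Qed.

Lemma z23_dot : [/\ dot2 z23 v2 = 1, dot2 z23 v3 = 1, dot2 z23 v4 < 1 & dot2 z23 v1 < 1].
Proof. exact: (vertex_dot (lab_rot l)). Qed.

Lemma z34_dot : [/\ dot2 z34 v3 = 1, dot2 z34 v4 = 1, dot2 z34 v1 < 1 & dot2 z34 v2 < 1].
Proof. exact: (vertex_dot (lab_rot (lab_rot l))). Qed.

Lemma z41_dot : [/\ dot2 z41 v4 = 1, dot2 z41 v1 = 1, dot2 z41 v2 < 1 & dot2 z41 v3 < 1].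
Proof. exact: (vertex_dot (lab_rot (lab_rot (lab_rot l)))). Qed.

Lemma frame_nondeg : orient z41 z12 z34 != 0.
Proof.
have [c1 c2 c3 c4] := z12_dot; have [d3 d4 d1 d2] := z34_dot.
have [e4 e1 e2 e3] := z41_dot.
(* The product is the determinant of the values of [v4] and [v1] along the frame, and that matrix is
   diagonal. *)
suff : orient z41 z12 z34 * cross v4 v1 != 0 by rewrite mulf_eq0 negb_or => /andP[].
have -> : orient z41 z12 z34 * cross v4 v1 =
   (dot2 z12 v4 - dot2 z41 v4) * (dot2 z34 v1 - dot2 z41 v1) -
   (dot2 z34 v4 - dot2 z41 v4) * (dot2 z12 v1 - dot2 z41 v1).
  by rewrite /orient /cross /dot2; ring.
rewrite c1 d4 e4 e1 !subrr mulr0 subr0 mulf_neq0 // subr_eq0 lt_eqF //.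
Qed.

Let ah := isaff_frame frame_nondeg.

Lemma frame_v1 p : dot2 (h p) v1 = 1 - p.2 * (1 - dot2 z34 v1).
Proof.
have [c1 _ _ _] := z12_dot; have [_ e1 _ _] := z41_dot.
by rewrite frame_dot c1 e1; ring.
Qed.

Lemma frame_v4 p : dot2 (h p) v4 = 1 - p.1 * (1 - dot2 z12 v4).
Proof.
have [_ c4 _ _] := z34_dot; have [e4 _ _ _] := z41_dot.
by rewrite frame_dot c4 e4; ring.
Qed.

Lemma frame_v2 p : dot2 (h p) v2 = dot2 z41 v2 + p.1 * (1 - dot2 z41 v2)
  + p.2 * (dot2 z34 v2 - dot2 z41 v2).
Proof. by have [_ c2 _ _] := z12_dot; rewrite frame_dot c2. Qed.

Lemma frame_v3 p : dot2 (h p) v3 = dot2 z41 v3 + p.1 * (dot2 z12 v3 - dot2 z41 v3)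
  + p.2 * (1 - dot2 z41 v3).
Proof. by have [c3 _ _ _] := z34_dot; rewrite frame_dot c3. Qed.

Lemma frame_pos z : L (h z) -> 0 <= z.1 /\ 0 <= z.2.
Proof.
have [_ _ _ c4] := z12_dot; have [_ _ c1 _] := z34_dot.
move=> /(lv l)[h1 _ _ h4]; move: h1 h4; rewrite frame_v1 frame_v4 => h1 h4.
have p4 : 0 < 1 - dot2 z12 v4 by rewrite subr_gt0.
have p1 : 0 < 1 - dot2 z34 v1 by rewrite subr_gt0.
by split; [rewrite -(pmulr_lge0 _ p4)|rewrite -(pmulr_lge0 _ p1)]; lra.
Qed.

Lemma lab_quad4 : L z12 -> L z23 -> L z34 -> L z41 ->
  exists c d : R, quad (fun p => L (h p)) (0, 0) (1, 0) (c, d) (0, 1).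
Proof.
move=> L12 L23 L34 L41; have [g [ag hK gK]] := isaff_inv ah.
have [_ _ f3 f4] := z12_dot; have [_ _ g1 g2] := z34_dot.
have [_ _ e2 e3] := z41_dot.
have [k2 k3 k4 k1] := z23_dot.
pose c := (g z23).1; pose d := (g z23).2.
have hcd : h (c, d) = z23 by rewrite -surjective_pairing gK.
rewrite -hcd in k1 k2 k3 k4.
rewrite frame_v1 /= in k1; rewrite frame_v4 /= in k4.
rewrite frame_v2 /= in k2; rewrite frame_v3 /= in k3.
have p4 : 0 < 1 - dot2 z12 v4 by rewrite subr_gt0.
have p1 : 0 < 1 - dot2 z34 v1 by rewrite subr_gt0.
have p2 : 0 < 1 - dot2 z41 v2 by rewrite subr_gt0.
have p3 : 0 < 1 - dot2 z41 v3 by rewrite subr_gt0.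
have q2 : 0 < 1 - dot2 z34 v2 by rewrite subr_gt0.
have c0 : 0 < c by rewrite -(pmulr_lgt0 _ p4); lra.
have d0 : 0 < d by rewrite -(pmulr_lgt0 _ p1); lra.
have cd1 : 0 < c + d - 1.
  rewrite -(pmulr_lgt0 _ p2).
  have : 0 < d * (1 - dot2 z34 v2) by rewrite mulr_gt0.
  by lra.
exists c, d; split => //; rewrite ?frame0 ?frame1 ?frame2 ?hcd //.
- by rewrite /orient /=; lra.
- by rewrite /orient /=; lra.
- by rewrite /orient /=; lra.
- by rewrite /orient /=; lra.
- by move=> p /frame_pos[x0 x1]; rewrite /orient /=; lra.
- move=> p Lp; have [_ + _ _] := lv l Lp; rewrite frame_v2 => hv.
  rewrite /orient /= -(pmulr_lge0 _ p2).
  have : 0 <= d * (1 - (dot2 z41 v2 + p.1 * (1 - dot2 z41 v2)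
    + p.2 * (dot2 z34 v2 - dot2 z41 v2))) by rewrite mulr_ge0 ?subr_ge0 // ltW.
  have : p.2 * (dot2 z41 v2 + c * (1 - dot2 z41 v2)
    + d * (dot2 z34 v2 - dot2 z41 v2)) = p.2 * 1 by rewrite k2.
  by lra.
- move=> p Lp; have [_ _ + _] := lv l Lp; rewrite frame_v3 => hv.
  rewrite /orient /= -(pmulr_lge0 _ p3).
  have : 0 <= c * (1 - (dot2 z41 v3 + p.1 * (dot2 z12 v3 - dot2 z41 v3)
    + p.2 * (1 - dot2 z41 v3))) by rewrite mulr_ge0 ?subr_ge0 // ltW.
  have : p.1 * (dot2 z41 v3 + c * (dot2 z12 v3 - dot2 z41 v3)
    + d * (1 - dot2 z41 v3)) = p.1 * 1 by rewrite k3.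
  by lra.
- by move=> p /frame_pos[x0 x1]; rewrite /orient /=; lra.
Qed.

Lemma lab_ratio4_lt2 : tight K L z12 -> tight K L z23 -> tight K L z34 -> tight K L z41 ->
  ratio_lt2 K L.
Proof.
move=> t12 t23 t34 t41.
have [K1 K2 K3 K4] := lu l; have [or1 or2 or3 or4] := lor l.
have l2 := lab_rot l; have l3 := lab_rot l2; have l4 := lab_rot l3.
have qK : quad K u1 u2 u3 u4.
  by split => //; move=> p Kp; [apply: (tight_edge l)|apply: (tight_edge l2)|
    apply: (tight_edge l3)|apply: (tight_edge l4)].
have [|||| c [d qL]] := lab_quad4; [by case: t12|by case: t23|by case: t34|by case: t41|].
apply: (ratio_lt2_pull (isaff_id R) ah).
exact: (ratio_lt2_quads (lK l) (conv2_pull ah (lL l)) qK qL).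
Qed.

Lemma lab_conf4 : tight K L z12 -> tight K L z34 -> tight K L z41 ->
  ~ tight K L z23 -> exists t w1 w2 w3 w4,
  conf4 (fun p => K (h p)) (fun p => L (h p)) t w1 w2 w3 w4.
Proof.
move=> t12 t34 t41 n23; have [g [ag hK gK]] := isaff_inv ah.
have [K1 K2 K3 K4] := lu l; have [or1 or2 or3 or4] := lor l.
have [Y1 Y2 Y3 Y4] := o_y (lo l).
have l2 := lab_rot l; have l3 := lab_rot l2; have l4 := lab_rot l3.
have [_ _ f3 f4] := z12_dot; have [_ _ g1 g2] := z34_dot.
have [_ _ e2 e3] := z41_dot.
have p4 : 0 < 1 - dot2 z12 v4 by rewrite subr_gt0.
have p1 : 0 < 1 - dot2 z34 v1 by rewrite subr_gt0.
have p2 : 0 < 1 - dot2 z41 v2 by rewrite subr_gt0.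
have p3 : 0 < 1 - dot2 z41 v3 by rewrite subr_gt0.
have [d1 _ _ _] := j_le1 (lj l); have [_ d2 _ _] := j_le2 (lj l).
have [_ _ d3 _] := j_le3 (lj l); have [_ _ _ d4] := j_le4 (lj l).
have [_ d31 d24 _] := o_opp (lo l); have [_ _ d41 d14] := o_adj2 (lo l).
pose w1 := g u1; pose w2 := g u2; pose w3 := g u3; pose w4 := g u4.
have hw1 : h w1 = u1 by exact: gK.
have hw2 : h w2 = u2 by exact: gK.
have hw3 : h w3 = u3 by exact: gK.
have hw4 : h w4 = u4 by exact: gK.
pose t := g (- 2 * z41.1, - 2 * z41.2).
have ht z : h (opp_half t z) = opp_half o2 (h z) by apply: frame_half; exact: gK.
have inj p q : h p = h q -> p = q by move/(congr1 g); rewrite !hK.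
have Lpos := frame_pos.
have [x1 _] : 0 <= w1.1 /\ 0 <= w1.2 by apply: Lpos; rewrite hw1; exact: (lKL l).
have [x3 _] : 0 <= w3.1 /\ 0 <= w3.2 by apply: Lpos; rewrite hw3; exact: (lKL l).
have [_ x4] : 0 <= w4.1 /\ 0 <= w4.2 by apply: Lpos; rewrite hw4; exact: (lKL l).
have D1 w u : h w = u -> dot2 u v1 = 1 - w.2 * (1 - dot2 z34 v1).
  by move=> <-; rewrite frame_v1.
have D4 w u : h w = u -> dot2 u v4 = 1 - w.1 * (1 - dot2 z12 v4).
  by move=> <-; rewrite frame_v4.
have w12 : w1.2 = 0.
  have /eqP := d1; rewrite (D1 _ _ hw1) -subr_eq0 addrAC subrr sub0r oppr_eq0 mulf_eq0.
  by rewrite (gt_eqF p1) orbF => /eqP.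
have w41 : w4.1 = 0.
  have /eqP := d4; rewrite (D4 _ _ hw4) -subr_eq0 addrAC subrr sub0r oppr_eq0 mulf_eq0.
  by rewrite (gt_eqF p4) orbF => /eqP.
have w1w2 : w1.1 < w2.1.
  by rewrite -(ltr_pM2r p4); move: d24 d14; rewrite (D4 _ _ hw1) (D4 _ _ hw2); lra.
have w4w3 : w4.2 < w3.2.
  by rewrite -(ltr_pM2r p1); move: d31 d41; rewrite (D1 _ _ hw3) (D1 _ _ hw4); lra.
have orE A B C A' B' C' : h A = A' -> h B = B' -> h C = C' ->
    orient A' B' C' = orient z41 z12 z34 * orient A B C.
  by move=> <- <- <-; rewrite frame_orient.
have orw3 : 0 <= orient w3 w4 w1.
  have -> : orient w3 w4 w1 = w1.1 * (w3.2 - w4.2) + w4.2 * w3.1.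
    by rewrite /orient w12 w41; ring.
  by rewrite addr_ge0 ?mulr_ge0 // subr_ge0 ltW.
(* The frame inherits the orientation of [u3, u4, u1]: in the new coordinates [w1] and [w4] lie on
   the non-negative axes and [w3] is above [w4], so their orientation is not negative. *)
have det0 : 0 < orient z41 z12 z34.
  have := or3; rewrite (orE _ _ _ _ _ _ hw3 hw4 hw1) => h3.
  rewrite lt_def frame_nondeg /= leNgt; apply/negP => hn.
  by have := mulr_le0_ge0 (ltW hn) orw3; lra.
have orw A B C A' B' C' : h A = A' -> h B = B' -> h C = C' ->
    0 <= orient A' B' C' -> 0 <= orient A B C.
  by move=> hA hB hC; rewrite (orE _ _ _ _ _ _ hA hB hC) pmulr_rge0.
have orw' A B C A' B' C' : h A = A' -> h B = B' -> h C = C' ->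
    0 < orient A' B' C' -> 0 < orient A B C.
  by move=> hA hB hC; rewrite (orE _ _ _ _ _ _ hA hB hC) pmulr_rgt0.
exists t, w1, w2, w3, w4; split; rewrite ?hw1 ?hw2 ?hw3 ?hw4 ?frame0 ?frame1 ?frame2 //.
- exact: conv2_pull ah (lK l).
- exact: conv2_pull ah (lL l).
- exact: cpt2_pull ah (lp l).
- by move=> p; exact: (lKL l).
- by move=> z Lz; rewrite ht; exact: (lab_half l).
- exact: (orw' _ _ _ _ _ _ hw1 hw2 hw3 or1).
- exact: (orw' _ _ _ _ _ _ hw2 hw3 hw4 or2).
- exact: (orw' _ _ _ _ _ _ hw3 hw4 hw1 or3).
- exact: (orw' _ _ _ _ _ _ hw4 hw1 hw2 or4).
- by case: t41.
- by case: t12.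
- by case: t34.
- by move=> p Kp; exact: (orw _ _ _ _ _ _ hw1 hw2 erefl (tight_edge l t34 Kp)).
- by move=> p Kp; exact: (orw _ _ _ _ _ _ hw2 hw3 erefl (tight_edge l2 t41 Kp)).
- by move=> p Kp; exact: (orw _ _ _ _ _ _ hw3 hw4 erefl (tight_edge l3 t12 Kp)).
- exists (y2 / (y2 + y3)); first exact: ratio01.
  by apply: inj; rewrite ht frame_seg frame0 hw2 hw3 half_vertex.
- exists (y3 / (y3 + y4)); first exact: ratio01.
  by apply: inj; rewrite ht frame_seg frame1 hw3 hw4 half_vertex.
- exists (y1 / (y1 + y2)); first exact: ratio01.
  by apply: inj; rewrite ht frame_seg frame2 hw1 hw2 half_vertex.
- move=> z Lz; have [hi|[zE|zE|zE|zE]] := lab_cases l Lz.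
  + by constructor 1; apply: int2_pull => //; rewrite ht.
  + by constructor 4; apply: inj; rewrite frame2.
  + by constructor 2; apply: inj; rewrite frame0.
  + by constructor 3; apply: inj; rewrite frame1.
  + constructor 1; apply: int2_pull => //; rewrite ht.
    by apply: contrapT => ni; apply: n23; split; rewrite -zE.
- move=> w20; have := d2; rewrite -[u2 in LHS]hw2 frame_v2 w20 mul0r addr0 => hx.
  by apply: (mulIf (lt0r_neq0 p2)); rewrite mul1r; lra.
- move=> w30; have := d3; rewrite -[u3 in LHS]hw3 frame_v3 w30 mul0r addr0 => hx.
  by apply: (mulIf (lt0r_neq0 p3)); rewrite mul1r; lra.
Qed.

Lemma lab_symmetric3 : tight K L z12 -> tight K L z34 -> tight K L z41 ->
  ~ tight K L z23 -> (exists c : pt, forall z, L z -> L (c.1 - z.1, c.2 - z.2)) ->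
  ratio_lt2 K L \/ tri2 K.
Proof.
move=> t12 t34 t41 n23 [c sL].
have [t [w1 [w2 [w3 [w4 cf]]]]] := lab_conf4 t12 t34 t41 n23.
have [g [ag hK gK]] := isaff_inv ah.
have [||] := conf4_symmetric cf.
- exists (g (c.1 - z41.1, c.2 - z41.2)); set w := g _.
  have hw : h w = (c.1 - z41.1, c.2 - z41.2) by exact: gK.
  by move=> z /sL; congr L; rewrite frame_sub hw; congr pair; rewrite /fst /snd; ring.
- by move=> cl; left; exact: (ratio_lt2_pull ah ah cl).
- by move=> tK; right; exact: (tri2_pull ah tK).
Qed.

End Lab.

End FourContactPairsCases.

(** * Counting the contact points *)

Section FourContactPairsConclusion.
Variable R : realFieldType.
Local Notation pt := (R * R)%type.
Local Notation o2 := ((0, 0) : pt).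
Implicit Types (K L : pt -> Prop) (p q z u v n : pt).

(** The one outcome without an unconditional improvement: exactly three contacts, where central
    symmetry of [L] gives an improvement or a triangle. *)
Definition three_tight K L := (forall z, L z -> K (opp_half o2 z)) /\
  (exists z1 z2 z3, [/\ z1 <> z2, z1 <> z3, z2 <> z3 &
     forall z, tight K L z <-> [\/ z = z1, z = z2 | z = z3]]) /\
  ((exists c : pt, forall z, L z -> L (c.1 - z.1, c.2 - z.2)) -> ratio_lt2 K L \/ tri2 K).

Lemma lab_three K L u1 u2 u3 u4 v1 v2 v3 v4 a1 a2 a3 a4 y1 y2 y3 y4 :
  lab K L u1 u2 u3 u4 v1 v2 v3 v4 a1 a2 a3 a4 y1 y2 y3 y4 ->
  tight K L (vertex y3 y4 u3 u4) -> tight K L (vertex y1 y2 u1 u2) ->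
  tight K L (vertex y2 y3 u2 u3) -> ~ tight K L (vertex y4 y1 u4 u1) ->
  three_tight K L.
Proof.
move=> l t12 t34 t41 n23; split; first exact: (lab_half l).
split; last exact: (lab_symmetric3 l).
have [_ c2 _ _] := z12_dot l; have [d3 _ d1 _] := z34_dot l.
have [_ e1 e2 e3] := z41_dot l; have [c1 _ _ _] := z12_dot l.
exists (vertex y3 y4 u3 u4), (vertex y1 y2 u1 u2), (vertex y2 y3 u2 u3); split.
- by move=> E; move: d1; rewrite -E c1 ltxx.
- by move=> E; move: e2; rewrite -E c2 ltxx.
- by move=> E; move: e3; rewrite -E d3 ltxx.
move=> z; split=> [tz|[-> //|-> //|-> //]].
have [Lz nz] := tz; have [//|[E|E|E|E]] := lab_cases l Lz.
- by constructor 2.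
- by constructor 3.
- by constructor 1.
- by case: n23; rewrite -E.
Qed.

Lemma lab_conclusion K L u1 u2 u3 u4 v1 v2 v3 v4 a1 a2 a3 a4 y1 y2 y3 y4 :
  lab K L u1 u2 u3 u4 v1 v2 v3 v4 a1 a2 a3 a4 y1 y2 y3 y4 ->
  ratio_lt2 K L \/ three_tight K L.
Proof.
move=> l; have l2 := lab_rot l; have l3 := lab_rot l2; have l4 := lab_rot l3.
pose z34 := vertex y1 y2 u1 u2; pose z41 := vertex y2 y3 u2 u3.
pose z12 := vertex y3 y4 u3 u4; pose z23 := vertex y4 y1 u4 u1.
have rest z : L z -> int2 K (opp_half o2 z) \/
    [\/ z = z34 /\ tight K L z34, z = z41 /\ tight K L z41,
        z = z12 /\ tight K L z12 | z = z23 /\ tight K L z23].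
  move=> Lz; have [h|h] := pselect (int2 K (opp_half o2 z)); first by left.
  have [//|hz] := lab_cases l Lz; right.
  have tz : tight K L z by [].
  by case: hz => E; rewrite -/z34 -/z41 -/z12 -/z23 in E; rewrite E in tz *;
    [constructor 1|constructor 2|constructor 3|constructor 4].
have c2 := @ratio_lt2_edges2 R K L _ _ _ _ (lK l) (lL l) (lp l) (lKL l) (lab_half l).
have c1 := @ratio_lt2_edges1 R K L _ _ (lK l) (lL l) (lp l) (lKL l) (lab_half l).
have c0 := @ratio_lt2_edges0 R K L (lK l) (lL l) (lp l) (lKL l) (lab_half l).
have [t34|n34] := pselect (tight K L z34); have [t41|n41] := pselect (tight K L z41);
  have [t12|n12] := pselect (tight K L z12); have [t23|n23] := pselect (tight K L z23);
  (try have [m34 e34] := lab_edge l t34); (try have [m41 e41] := lab_edge l2 t41);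
  (try have [m12 e12] := lab_edge l3 t12); (try have [m23 e23] := lab_edge l4 t23).
- by left; exact: (lab_ratio4_lt2 l t12 t23 t34 t41).
- by right; exact: (lab_three l t12 t34 t41 n23).
- by right; exact: (lab_three l4 t41 t23 t34 n12).
- left; apply: (c2 _ _ _ _ e34 e41) => z /rest[h|[[h t]|[h t]|[h t]|[h t]]] //;
    by [constructor 1|constructor 2|constructor 3].
- by right; exact: (lab_three l3 t34 t12 t23 n41).
- left; apply: (c2 _ _ _ _ e34 e12) => z /rest[h|[[h t]|[h t]|[h t]|[h t]]] //;
    by [constructor 1|constructor 2|constructor 3].
- left; apply: (c2 _ _ _ _ e34 e23) => z /rest[h|[[h t]|[h t]|[h t]|[h t]]] //;
    by [constructor 1|constructor 2|constructor 3].
- left; apply: (c1 _ _ e34) => z /rest[h|[[h t]|[h t]|[h t]|[h t]]] //; by [left|right].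
- by right; exact: (lab_three l2 t23 t41 t12 n34).
- left; apply: (c2 _ _ _ _ e41 e12) => z /rest[h|[[h t]|[h t]|[h t]|[h t]]] //;
    by [constructor 1|constructor 2|constructor 3].
- left; apply: (c2 _ _ _ _ e41 e23) => z /rest[h|[[h t]|[h t]|[h t]|[h t]]] //;
    by [constructor 1|constructor 2|constructor 3].
- left; apply: (c1 _ _ e41) => z /rest[h|[[h t]|[h t]|[h t]|[h t]]] //; by [left|right].
- left; apply: (c2 _ _ _ _ e12 e23) => z /rest[h|[[h t]|[h t]|[h t]|[h t]]] //;
    by [constructor 1|constructor 2|constructor 3].
- left; apply: (c1 _ _ e12) => z /rest[h|[[h t]|[h t]|[h t]|[h t]]] //; by [left|right].
- left; apply: (c1 _ _ e23) => z /rest[h|[[h t]|[h t]|[h t]|[h t]]] //; by [left|right].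
- by left; apply: c0 => z /rest[h|[[h t]|[h t]|[h t]|[h t]]].
Qed.

Lemma affdep_orient A B u1 u2 u3 u4 e1 e2 e3 e4 : affdep u1 u2 u3 u4 e1 e2 e3 e4 ->
  e1 * orient A B u1 + e2 * orient A B u2 + e3 * orient A B u3 + e4 * orient A B u4 = 0.
Proof.
move=> [E0 E1 E2].
transitivity ((B.1 - A.1) * ((e1 * u1.2 + e2 * u2.2 + e3 * u3.2 + e4 * u4.2)
    - A.2 * (e1 + e2 + e3 + e4))
  - (B.2 - A.2) * ((e1 * u1.1 + e2 * u2.1 + e3 * u3.1 + e4 * u4.1)
    - A.1 * (e1 + e2 + e3 + e4))); first by rewrite /orient; ring.
by rewrite E0 E1 E2; ring.
Qed.

(** Cramer's rule: the signed areas of the four triangles are the coefficients of the dependency, so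
    their signs encode the cyclic order of the points. *)
Lemma affdep_areas u1 u2 u3 u4 : affdep u1 u2 u3 u4 (orient u2 u3 u4)
  (- orient u3 u4 u1) (orient u4 u1 u2) (- orient u1 u2 u3).
Proof. by split; rewrite /orient; ring. Qed.

Lemma john4_swap34 u1 u2 u3 u4 v1 v2 v3 v4 a1 a2 a3 a4 :
  john4 u1 u2 u3 u4 v1 v2 v3 v4 a1 a2 a3 a4 ->
  john4 u1 u2 u4 u3 v1 v2 v4 v3 a1 a2 a4 a3 (R := R).
Proof.
by move=> j; exact: (john4_rot (john4_rot (john4_rot (john4_swap23 (john4_rot j))))).
Qed.

Lemma john4_labelled K L u1 u2 u3 u4 v1 v2 v3 v4 a1 a2 a3 a4 e1 e2 e3 e4 :
  conv2 K -> conv2 L -> cpt2 L -> (forall p, K p -> L p) ->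
  [/\ K u1, K u2, K u3 & K u4] ->
  (forall z, L z -> [/\ dot2 z v1 <= 1, dot2 z v2 <= 1, dot2 z v3 <= 1 & dot2 z v4 <= 1]) ->
  john4 u1 u2 u3 u4 v1 v2 v3 v4 a1 a2 a3 a4 ->
  affdep u1 u2 u3 u4 e1 e2 e3 e4 -> 0 < e1 -> e2 < 0 -> 0 < e3 -> e4 < 0 ->
  0 < orient u1 u2 u3 -> ratio_lt2 K L \/ three_tight K L.
Proof.
move=> cK cL pL KL Ku Lv j d p1 p2 p3 p4 o1.
have [y1 [y2 [y3 [y4 o]]]] := john4_ordered j d p1 p2 p3 p4.
apply: (@lab_conclusion K L u1 u2 u3 u4 v1 v2 v3 v4 a1 a2 a3 a4 y1 y2 y3 y4).
have pos (a x c : R) : a < 0 -> a * x = c -> c < 0 -> 0 < x.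
  by move=> a0 <-; rewrite nmulr_rlt0.
split => //; split=> //.
- apply: (pos e4 _ (- (e1 * orient u1 u2 u3))) => //; last by rewrite oppr_lt0 mulr_gt0.
  apply/eqP; rewrite -addr_eq0; apply/eqP; rewrite -[RHS](affdep_orient u2 u3 d).
  by rewrite /orient; ring.
- apply: (pos e4 _ (e2 * orient u1 u2 u3)) => //; last by rewrite pmulr_llt0.
  apply/eqP; rewrite -subr_eq0; apply/eqP; apply: oppr_inj; rewrite oppr0.
  by rewrite -[RHS](affdep_orient u3 u1 d) /orient; ring.
- apply: (pos e4 _ (- (e3 * orient u1 u2 u3))) => //; last by rewrite oppr_lt0 mulr_gt0.
  apply/eqP; rewrite -addr_eq0; apply/eqP; rewrite -[RHS](affdep_orient u1 u2 d).
  by rewrite /orient; ring.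
Qed.

(** With [u1] fixed, the six sign patterns are the six counterclockwise orders of the remaining
    points, and each is undone by a relabelling of the pairs. *)
Lemma john4_conclusion K L u1 u2 u3 u4 v1 v2 v3 v4 a1 a2 a3 a4 :
  conv2 K -> conv2 L -> cpt2 L -> (forall p, K p -> L p) ->
  [/\ K u1, K u2, K u3 & K u4] ->
  (forall z, L z -> [/\ dot2 z v1 <= 1, dot2 z v2 <= 1, dot2 z v3 <= 1 & dot2 z v4 <= 1]) ->
  john4 u1 u2 u3 u4 v1 v2 v3 v4 a1 a2 a3 a4 -> ratio_lt2 K L \/ three_tight K L.
Proof.
move=> cK cL pL KL [K1 K2 K3 K4] Lv j.
have j34 := john4_swap34 j; have j23 := john4_swap23 j.
have j1423 := john4_swap23 j34; have j1342 := john4_swap34 j23.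
have j1432 := john4_swap34 j1423.
have on := extreme_orient (j_extu j).
have d := affdep_areas u1 u2 u3 u4; have [E0 E1 E2] := d; have dN := affdepN d.
have [[_ _ _ /eqP]|] := affdep_pattern (j_extu j) d.
  by rewrite oppr_eq0 (negPf on).
rewrite !oppr_lt0 !oppr_gt0.
case=> [] [] [h1 h2 h3 h4].
- apply: (john4_labelled cK cL pL KL _ _ j d) => //; by rewrite oppr_lt0.
- apply: (john4_labelled cK cL pL KL _ _ j1432 (e1 := - orient u2 u3 u4)
    (e2 := - - orient u1 u2 u3) (e3 := - orient u4 u1 u2) (e4 := - - orient u3 u4 u1));
    rewrite ?opprK ?oppr_gt0 //.
  + by move=> z /Lv[].
  + by split; rewrite /orient; ring.
  + by rewrite (_ : orient _ _ _ = - orient u3 u4 u1) ?oppr_gt0 // /orient; ring.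
- apply: (john4_labelled cK cL pL KL _ _ j1423 (e1 := orient u2 u3 u4)
    (e2 := - orient u1 u2 u3) (e3 := - orient u3 u4 u1) (e4 := orient u4 u1 u2));
    rewrite ?oppr_gt0 ?oppr_lt0 //.
  + by move=> z /Lv[].
  + by split; rewrite /orient; ring.
  + by rewrite (_ : orient _ _ _ = - orient u4 u1 u2) ?oppr_gt0 // /orient; ring.
- apply: (john4_labelled cK cL pL KL _ _ j23 (e1 := - orient u2 u3 u4)
    (e2 := - orient u4 u1 u2) (e3 := orient u3 u4 u1) (e4 := orient u1 u2 u3));
    rewrite ?oppr_gt0 ?oppr_lt0 //.
  + by move=> z /Lv[].
  + by split; rewrite /orient; ring.
  + by rewrite (_ : orient _ _ _ = - orient u1 u2 u3) ?oppr_gt0 // /orient; ring.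
- apply: (john4_labelled cK cL pL KL _ _ j1342 (e1 := orient u2 u3 u4)
    (e2 := orient u4 u1 u2) (e3 := - orient u1 u2 u3) (e4 := - orient u3 u4 u1));
    rewrite ?oppr_gt0 ?oppr_lt0 //.
  + by move=> z /Lv[].
  + by split; rewrite /orient; ring.
  + by rewrite (_ : orient _ _ _ = orient u3 u4 u1) // /orient; ring.
- apply: (john4_labelled cK cL pL KL _ _ j34 (e1 := - orient u2 u3 u4)
    (e2 := orient u3 u4 u1) (e3 := orient u1 u2 u3) (e4 := - orient u4 u1 u2));
    rewrite ?oppr_gt0 ?oppr_lt0 //.
  + by move=> z /Lv[].
  + by split; rewrite /orient; ring.
  + by rewrite (_ : orient _ _ _ = orient u4 u1 u2) // /orient; ring.
Qed.

End FourContactPairsConclusion.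

(** * Row vectors and the Grünbaum distance *)

Section RowVectors.
Variable R : realType.
Local Notation pt := (R * R)%type.
Local Notation V := 'rV[R]_2.
Implicit Types (K L : set V) (p q : pt) (x y : V).

Definition pt_of x : pt := (x 0 0, x 0 1).
Definition rv_of p : V := \row_j (if j == 0 then p.1 else p.2).
Definition planar K : pt -> Prop := fun p => K (rv_of p).

Lemma ord2P (j : 'I_2) : j = 0 \/ j = 1.
Proof. by case: j => [[|[|//]]] h; [left|right]; apply/val_inj. Qed.

Lemma rv_ofK : cancel rv_of pt_of.
Proof. by move=> [a b]; rewrite /pt_of /rv_of !mxE. Qed.

Lemma pt_ofK : cancel pt_of rv_of.
Proof. by move=> x; apply/rowP => j; rewrite mxE; case: (ord2P j) => ->. Qed.

Lemma planarE K x : planar K (pt_of x) = K x.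
Proof. by rewrite /planar pt_ofK. Qed.

Lemma dotvE x y : dotv x y = dot2 (pt_of x) (pt_of y).
Proof.
rewrite /dotv /dot2 big_ord_recl big_ord1 /pt_of /=.
by congr (_ + x 0 _ * y 0 _); apply/val_inj.
Qed.

Lemma rv_of_comb p q (a b : R) : a *: rv_of p + b *: rv_of q =
  rv_of (a * p.1 + b * q.1, a * p.2 + b * q.2).
Proof. by apply/rowP => j; rewrite !mxE; case: ifP. Qed.

Lemma convex_setP (K : set V) : convex_set (K : set (convex_lmodType V)) <->
  forall x y (t : R), 0 <= t <= 1 -> K x -> K y -> K ((1 - t) *: x + t *: y).
Proof.
split=> [cK x y t /andP[t0 t1] Kx Ky|cK x y t].
  have := set_mem (cK y x (Itv01 t0 t1) (mem_set Ky) (mem_set Kx)).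
  by rewrite addrC.
move=> /set_mem Kx /set_mem Ky; apply: mem_set.
have t01 : 0 <= 1 - t%:num <= 1 by rewrite subr_ge0 le1 gerBl ge0.
by have := cK x y _ t01 Kx Ky; rewrite subKr.
Qed.

Lemma conv2_planar K : convex_set (K : set (convex_lmodType V)) -> conv2 (planar K).
Proof.
move=> /convex_setP cK p q t Kp Kq t01.
by rewrite /planar -rv_of_comb; exact: cK.
Qed.

Lemma near2_nbhs x (P : V -> Prop) :
  near2 (pt_of x) (fun p => P (rv_of p)) <-> (\forall y \near x, P y).
Proof.
split=> [[d [d0 h]]|/nbhs_ballP[d /= d0 h]].
  apply/nbhs_ballP; exists d => //= y [_ xy].
  by have := h (pt_of y); rewrite pt_ofK; apply;
    [have := xy 0 0|have := xy 0 1]; rewrite -ball_normE /= distrC.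
exists d; split=> // q h1 h2; apply: h; split=> // i j.
rewrite !ord1 -ball_normE /= mxE distrC.
by case: (ord2P j) => ->.
Qed.

Lemma interior_planar K x : interior K x <-> int2 (planar K) (pt_of x).
Proof. by split=> /near2_nbhs. Qed.

(** Compactness in its near-covering form, for the filter of right neighbourhoods of 0, is the
    uniformity principle [cpt2]. *)
Lemma cpt2_planar K : compact K -> cpt2 (planar K).
Proof.
move=> /compact_near_coveringP cK P Pn.
have h : \forall s \near (0 : R)^'+, K `<=` (fun x => P s (pt_of x)).
  apply: (cK R (0 : R)^'+ (fun s x => P s (pt_of x))) => x Kx.
  have [|d [d0 Pd]] := Pn (pt_of x); first by rewrite planarE.
  have {}Pd : \forall y \near x, forall s, 0 < s -> s < d -> P s (pt_of y).
    by apply/near2_nbhs; apply: near2_sub Pd => q h s s0 sd; rewrite rv_ofK; exact: h.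
  exists ([set y | forall s, 0 < s -> s < d -> P s (pt_of y)], [set s : R | 0 < s < d]).
    split=> //=; near=> s; apply/andP; split; near: s.
      exact: nbhs_right_gt.
    exact: nbhs_right_lt.
  by move=> [y s] [/= hy /andP[s0 sd]]; exact: hy.
have /nbhs_ballP[d /= d0 hd] := h; exists d; split=> // s q s0 sd Kq.
rewrite -[q]rv_ofK; apply: (hd s _ s0) => //.
by rewrite -ball_normE /= sub0r normrN gtr0_norm.
Unshelve. all: by end_near. Qed.

Lemma det_mx22 (A : 'M[R]_2) : \det A = A 0 0 * A 1 1 - A 0 1 * A 1 0.
Proof.
rewrite (expand_det_row _ 0) big_ord_recl big_ord1 /cofactor !det_mx11 !mxE.
rewrite /= expr0 expr1 mul1r mulN1r mulrN.
by congr (A _ _ * A _ _ - A _ _ * A _ _); exact/val_inj.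
Qed.

Lemma ratio_lt2_grunbaum K L : ratio_lt2 (planar K) (planar L) -> grunbaum_distance K L < 2.
Proof.
move=> [f [r [c [[a [b [a' [b' [e [e' [D fE]]]]]]] r2 r1 KL LK]]]].
apply: le_lt_trans r2; rewrite /grunbaum_distance; apply: ge_inf.
  by exists 0 => _ [x _ <-]; exact: normr_ge0.
exists r => //=.
have rn : 1 - r != 0 by rewrite subr_eq0 eq_sym.
(* The translation making the outer homothety linear. *)
pose w : pt := (c.1 / (1 - r), c.2 / (1 - r)).
(* The transpose of the linear part of [f], since row vectors are multiplied by matrices on the
   right. *)
pose M : 'M[R]_2 := \matrix_(i, j) (if i == 0 then (if j == 0 then a else a')
  else (if j == 0 then b else b')).
have MU : M \in unitmx.
  rewrite unitmxE unitfE det_mx22 !mxE /=.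
  by rewrite [a' * b]mulrC.
have ME (x : V) : x *m M + rv_of (e - w.1, e' - w.2) =
    rv_of ((f (pt_of x)).1 - w.1, (f (pt_of x)).2 - w.2).
  apply/rowP => j; rewrite !mxE big_ord_recl big_ord1 !mxE fE /aff /pt_of /=.
  rewrite (_ : lift ord0 ord0 = 1); last exact/val_inj.
  by case: (ord2P j) => -> /=; ring.
exists [set x *m M + rv_of (e - w.1, e' - w.2) | x in K].
exists [set x *m 1%:M + rv_of (- w.1, - w.2) | x in L]; split.
- by exists M, (rv_of (e - w.1, e' - w.2)).
- by exists 1%:M, (rv_of (- w.1, - w.2)); rewrite unitmx1.
- move=> _ [x Kx <-]; rewrite ME.
  exists (rv_of (f (pt_of x))); first by apply: KL; rewrite planarE.
  rewrite mulmx1; apply/rowP => j; rewrite !mxE.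
  by case: ifP.
move=> _ [x Lx <-]; have := Lx; rewrite -(planarE L) => /LK[p [Kp xE]].
exists (rv_of p *m M + rv_of (e - w.1, e' - w.2)); first by exists (rv_of p).
rewrite ME rv_ofK mulmx1 -[x]pt_ofK xE; apply/rowP => j; rewrite !mxE.
by rewrite /w; case: ifP => _ /=; field.
Qed.

Lemma hull_sub (A C : set V) : convex_set (C : set (convex_lmodType V)) ->
  A `<=` C -> convex_hull A `<=` C.
Proof. by move=> cC AC; exact: smallest_sub. Qed.

Lemma convex_comb3 (C : set V) x y z (a b c : R) :
  convex_set (C : set (convex_lmodType V)) -> C x -> C y -> C z ->
  0 <= a -> 0 <= b -> 0 <= c -> a + b + c = 1 -> C (a *: x + b *: y + c *: z).
Proof.
move=> cC Cx Cy Cz a0 b0 c0 abc.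
have : planar C (pt_of (a *: x + b *: y + c *: z)).
  rewrite /pt_of !mxE.
  by apply: (@conv3 R (planar C) (pt_of x) (pt_of y) (pt_of z)) => //;
    rewrite ?planarE //; exact: conv2_planar.
by rewrite planarE.
Qed.

Lemma convex_hull_comb3 (A : set V) x y z (a b c : R) : A x -> A y -> A z ->
  0 <= a -> 0 <= b -> 0 <= c -> a + b + c = 1 ->
  convex_hull A (a *: x + b *: y + c *: z).
Proof.
move=> Ax Ay Az a0 b0 c0 abc C [cC AC].
by apply: convex_comb3 => //; exact: AC.
Qed.

Lemma tri2_triangle K : convex_set (K : set (convex_lmodType V)) ->
  tri2 (planar K) -> is_triangle K.
Proof.
move=> cK [A [B [C [oABC KA KB KC Kp]]]].
exists (rv_of A), (rv_of B), (rv_of C); split.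
  set X := rv_of B - rv_of A; set Y := rv_of C - rv_of A.
  have E0 (j : 'I_2) : col_mx X Y (0 : 'I_2) j = X 0 j.
    rewrite (_ : (0 : 'I_2) = lshift 1 (0 : 'I_1)) ?col_mxEu //; exact/val_inj.
  have E1 (j : 'I_2) : col_mx X Y (1 : 'I_2) j = Y 0 j.
    rewrite (_ : (1 : 'I_2) = rshift 1 (0 : 'I_1)) ?col_mxEd //; exact/val_inj.
  have -> := @row_free_unit R 2 (col_mx X Y).
  rewrite unitmxE unitfE det_mx22 !E0 !E1 !mxE /=.
  by move: oABC; rewrite /orient.
apply/seteqP; split=> x.
  rewrite -planarE => /Kp[a [b [c [a0 b0 c0 abc xE]]]].
  have -> : x = a *: rv_of A + b *: rv_of B + c *: rv_of C.
    by rewrite -[LHS]pt_ofK xE; apply/rowP => j; rewrite !mxE; case: ifP.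
  by apply: convex_hull_comb3 => //; [by left; left|by left; right|by right].
by apply: hull_sub => // y /= [[->|->]|->].
Qed.

End RowVectors.

(** * John position *)

Section JohnPosition.
Variable R : realType.
Local Notation pt := (R * R)%type.
Local Notation V := 'rV[R]_2.
Implicit Types (K L : set V) (p q : pt) (x y : V).

Lemma near2_dot p q (c : R) : c < dot2 p q -> near2 p (fun w => c < dot2 w q).
Proof.
move=> h; set s := 1 + `|q.1| + `|q.2|.
have n1 := normr_ge0 q.1; have n2 := normr_ge0 q.2.
have s0 : 0 < s by rewrite /s; lra.
have d0 : 0 < (dot2 p q - c) / s by rewrite divr_gt0 // subr_gt0.
have dE : (dot2 p q - c) / s * s = dot2 p q - c by rewrite divfK // gt_eqF.
exists ((dot2 p q - c) / s); split=> // w; set d := _ / s in d0 dE *.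
move=> h1 h2.
have k1 : `|q.1 * (w.1 - p.1)| <= `|q.1| * d by rewrite normrM ler_wpM2l // ltW.
have k2 : `|q.2 * (w.2 - p.2)| <= `|q.2| * d by rewrite normrM ler_wpM2l // ltW.
move: k1 k2; rewrite !ler_norml => /andP[k1 _] /andP[k2 _].
move: dE k1 k2; rewrite /dot2 /s; lra.
Qed.

Lemma compact_closure K : compact K -> closure K `<=` K.
Proof. by move=> /(compact_closed (@norm_hausdorff _ _))/closure_id <-. Qed.

Lemma closure_polar K x y : closure (polar K) x -> K y -> dotv x y <= 1.
Proof.
move=> cx Ky; rewrite leNgt; apply/negP => h.
have nb : \forall w \near x, 1 < dotv w y.
  apply/near2_nbhs; rewrite dotvE in h; apply: near2_sub (near2_dot h) => w.
  by rewrite dotvE rv_ofK.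
have [w [/= pw hw]] := cx _ nb.
by move: hw; rewrite ltNge => /negP; apply; exact: pw.
Qed.

Lemma extreme_planar (m : nat) (u : 'I_m -> V) (i j k l : 'I_m) :
  (~ convex_hull [set u j | j in [set j : 'I_m | j != i]] (u i)) ->
  j != i -> k != i -> l != i ->
  extreme (pt_of (u i)) (pt_of (u j)) (pt_of (u k)) (pt_of (u l)).
Proof.
move=> ext ji ki li x y z x0 y0 z0 s e1 e2; apply: ext.
have -> : u i = x *: u j + y *: u k + z *: u l.
  rewrite -[LHS]pt_ofK [pt_of (u i)]surjective_pairing e1 e2.
  by apply/rowP => n; rewrite !mxE; case: (ord2P n) => ->.
by apply: convex_hull_comb3 => //; [exists j|exists k|exists l].
Qed.

Lemma john_planar K L (m : nat) (u v : 'I_m -> V) : compact K -> compact L ->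
  john_position K L u v ->
  [/\ forall i, planar K (pt_of (u i)),
      forall i z, planar L z -> dot2 z (pt_of (v i)) <= 1,
      forall i, dot2 (pt_of (u i)) (pt_of (v i)) = 1 &
      exists a : 'I_m -> R, [/\ forall i, 0 < a i,
        forall x : pt, x.1 = \sum_i a i * dot2 x (pt_of (u i)) * (pt_of (v i)).1 /\
                  x.2 = \sum_i a i * dot2 x (pt_of (u i)) * (pt_of (v i)).2,
        0 = \sum_i a i * (pt_of (u i)).1 /\ 0 = \sum_i a i * (pt_of (u i)).2 &
        0 = \sum_i a i * (pt_of (v i)).1 /\ 0 = \sum_i a i * (pt_of (v i)).2]].
Proof.
move=> cK cL [KL m0 bu bv [a [a0 id su sv duv]]]; split.
- by move=> i; rewrite planarE; apply: compact_closure => //; have [[]] := bu i.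
- move=> i z Lz; rewrite -[z]rv_ofK -dotvE.
  have := @closure_polar L (v i) (rv_of z).
  rewrite !dotvE; set e := dot2 _ _ <= 1; rewrite /dot2 mulrC [X in _ + X]mulrC.
  by apply=> //; have [_ []] := bv i.
- by move=> i; rewrite -dotvE.
have co (w : 'I_m -> V) (b : 'I_m -> R) (j : 'I_2) :
    (\sum_i b i *: w i) 0 j = \sum_i b i * w i 0 j.
  by rewrite summxE; apply: eq_bigr => i _; rewrite mxE.
exists a; split=> //.
- move=> x; have := id (rv_of x).
  move=> /(congr1 (@pt_of R)); rewrite rv_ofK => xE.
  split; rewrite {1}xE /pt_of /= co; apply: eq_bigr => i _; by rewrite dotvE rv_ofK.
- by split; rewrite -co -su mxE.
- by split; rewrite -co -sv mxE.
Qed.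

(** A point [x] of [L] outside the interior of [-2K] is automatically on the boundary of [L].
    Otherwise some [(1 + e) x] is in [L], and [-x/2] is a point of [K] contracted towards the
    interior point 0, hence interior to [K]. *)
Lemma boundary_tight K L x : compact L -> (forall y, L y -> K (- (1 / 2) *: y)) ->
  convex_set (K : set (convex_lmodType V)) -> interior K 0 ->
  (boundary L `&` boundary (dilate (-2) K)) x <-> tight (planar K) (planar L) (pt_of x).
Proof.
move=> cL LK cK K0.
have dil y : dilate (-2) K y <-> K (- (1 / 2) *: y).
  split=> [[w Kw <-]|Ky].
    by rewrite scalerA (_ : _ * _ = 1) ?scale1r //; field.
  exists (- (1 / 2) *: y) => //.
  by rewrite scalerA (_ : _ * _ = 1) ?scale1r //; field.
have hE y : opp_half (0, 0) (pt_of y) = pt_of (- (1 / 2) *: y).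
  by rewrite /opp_half /pt_of !mxE /=; congr pair; field.
have aE p : opp_half (0, 0) p = aff (- (1 / 2)) 0 0 (- (1 / 2)) 0 0 p.
  by rewrite /opp_half /aff; congr pair => /=; field.
have intE : interior (dilate (-2) K) x <-> int2 (planar K) (opp_half (0, 0) (pt_of x)).
  rewrite interior_planar; split.
    move=> h; have {}h : near2 (aff (-2) 0 0 (-2) 0 0 (opp_half (0, 0) (pt_of x)))
        (planar (dilate (-2) K)).
      by move: h; congr near2; rewrite aE /aff /=; congr pair; field.
    apply: near2_sub (near2_aff h) => p /dil; congr K.
    by apply/rowP => j; rewrite !mxE /aff /=; case: ifP => _; field.
  rewrite aE => /near2_aff; apply: near2_sub => p.
  rewrite -aE => h; apply/dil; move: h; congr K.
  by apply/rowP => j; rewrite !mxE /opp_half /=; case: ifP => _; field.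
split.
  move=> [[clL _] [_ nint]]; split.
    by rewrite planarE; exact: compact_closure clL.
  by move/intE.
move=> [Lx nint]; rewrite planarE in Lx; split; split.
- exact: subset_closure.
- move=> /interior_planar[d [d0 Ld]]; apply: nint.
  set p := pt_of x in Ld *.
  have n0 : 0 < 1 + `|p.1| + `|p.2|.
    by have := normr_ge0 p.1; have := normr_ge0 p.2; lra.
  pose e := d / (2 * (1 + `|p.1| + `|p.2|)).
  have e0 : 0 < e by rewrite divr_gt0 // mulr_gt0.
  have eE : e * (1 + `|p.1| + `|p.2|) = d / 2 by rewrite /e; field; rewrite gt_eqF.
  have Lq : planar L ((1 + e) * p.1, (1 + e) * p.2).
    have k1 : 0 <= e * `|p.1| by rewrite mulr_ge0 // ltW.
    have k2 : 0 <= e * `|p.2| by rewrite mulr_ge0 // ltW.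
    apply: Ld => /=; rewrite mulrDl mul1r addrAC subrr add0r normrM (gtr0_norm e0); lra.
  have := LK _ Lq; rewrite -planarE -hE rv_ofK => Kq.
  have K0' : int2 (planar K) (0, 0).
    by move: K0; rewrite interior_planar; congr near2; rewrite /pt_of !mxE.
  have en : 1 + e != 0 by rewrite gt_eqF //; lra.
  have t0 : 0 < e / (1 + e) by rewrite divr_gt0 //; lra.
  have t1 : e / (1 + e) <= 1 by rewrite ler_pdivrMr; lra.
  have := conv_int (conv2_planar cK) Kq K0' t0 t1.
  by congr near2; rewrite /opp_half /=; congr pair; field.
- by apply: subset_closure; apply/dil; exact: LK.
- by move/intE.
Qed.

Lemma john_three K L (u v : 'I_3 -> V) : convex_body K -> convex_body L ->
  john_position K L u v ->
  [\/ is_triangle K, is_triangle L | grunbaum_distance K L < 2].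
Proof.
move=> [cK vK _] [cL vL _] J; have [KL _ _ _ _] := J.
have [uK vL1 duv [a [a0 id [su1 su2] [sv1 sv2]]]] := john_planar cK cL J.
pose i0 := ord0 : 'I_3; pose i1 := lift ord0 ord0 : 'I_3.
pose i2 := lift ord0 (lift ord0 ord0) : 'I_3.
have sum3 (f : 'I_3 -> R) : \sum_i f i = f i0 + f i1 + f i2.
  by rewrite !big_ord_recl big_ord0 addr0 addrA.
rewrite !sum3 in su1 su2 sv1 sv2.
have [e11 e12] := id (1, 0); have [e21 e22] := id (0, 1).
rewrite !sum3 /dot2 !mul1r !mul0r !addr0 in e11 e12.
rewrite !sum3 /dot2 !mul1r !mul0r !add0r in e21 e22.
have [h|[h|h]] := john3_ratio_lt2 (conv2_planar vK) (conv2_planar vL) (cpt2_planar cL)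
  (fun p => KL (rv_of p)) (uK i0) (uK i1) (uK i2)
  (fun z Lz => And3 (vL1 i0 z Lz) (vL1 i1 z Lz) (vL1 i2 z Lz))
  (duv i0) (duv i1) (duv i2)
  (john3_weights (a0 i0) (a0 i1) (a0 i2) (esym e11) (esym e12) (esym e21) (esym e22)
    (esym su1) (esym su2) (esym sv1) (esym sv2) (duv i0) (duv i1) (duv i2)).
- by constructor 1; exact: tri2_triangle.
- by constructor 2; exact: tri2_triangle.
- by constructor 3; exact: ratio_lt2_grunbaum.
Qed.

Lemma john_four K L (u v : 'I_4 -> V) : convex_body K -> convex_body L ->
  interior K 0 -> john_position K L u v ->
  (forall i, ~ convex_hull [set u j | j in [set j : 'I_4 | j != i]] (u i)) ->
  (forall i, ~ convex_hull [set v j | j in [set j : 'I_4 | j != i]] (v i)) ->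
  grunbaum_distance K L < 2 \/
  boundary L `&` boundary (dilate (-2) K) #= `I_3 /\
  (centrally_symmetric L -> grunbaum_distance K L < 2 \/ is_triangle K).
Proof.
move=> [cK vK _] [cL vL _] K0 J eu ev; have [KL _ _ _ _] := J.
have [uK vL1 duv [a [a0 id [su1 su2] [sv1 sv2]]]] := john_planar cK cL J.
pose i0 := ord0 : 'I_4; pose i1 := lift ord0 ord0 : 'I_4.
pose i2 := lift ord0 (lift ord0 ord0) : 'I_4.
pose i3 := lift ord0 (lift ord0 (lift ord0 ord0)) : 'I_4.
have sum4 (f : 'I_4 -> R) : \sum_i f i = f i0 + f i1 + f i2 + f i3.
  by rewrite !big_ord_recl big_ord0 addr0 !addrA.
rewrite !sum4 in su1 su2 sv1 sv2.
have [e11 e12] := id (1, 0); have [e21 e22] := id (0, 1).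
rewrite !sum4 /dot2 !mul1r !mul0r !addr0 in e11 e12.
rewrite !sum4 /dot2 !mul1r !mul0r !add0r in e21 e22.
pose U i := pt_of (u i); pose W i := pt_of (v i).
rewrite -!/(U _) -!/(W _) /= in e11 e12 e21 e22 su1 su2 sv1 sv2.
have d i : dot2 (U i) (W i) = 1 := duv i.
have b i j : dot2 (U i) (W j) <= 1 by apply: vL1; apply: KL; exact: uK.
have j : john4 (U i0) (U i1) (U i2) (U i3) (W i0) (W i1) (W i2) (W i3)
    (a i0) (a i1) (a i2) (a i3).
  split => //.
  (* The identity at the basis vectors gives the entries of the identity matrix; recombining them
     with [x] transposes it. *)
  - move=> x; have := congr1 ( *%R x.1) e11; have := congr1 ( *%R x.2) e12.
    by rewrite /dot2 /U /W /=; lra.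
  - move=> x; have := congr1 ( *%R x.1) e21; have := congr1 ( *%R x.2) e22.
    by rewrite /dot2 /U /W /=; lra.
  - move=> x; have := congr1 ( *%R x.1) sv1; have := congr1 ( *%R x.2) sv2.
    by rewrite /dot2 /U /W /=; lra.
  (* The trace of John's identity is the dimension 2. *)
  - have := congr1 ( *%R (a i0)) (d i0); have := congr1 ( *%R (a i1)) (d i1).
    have := congr1 ( *%R (a i2)) (d i2); have := congr1 ( *%R (a i3)) (d i3).
    by rewrite /dot2 /U /W /=; lra.
  - by split; apply: extreme_planar.
  - by split; apply: extreme_planar.
have [h|[hK [[z1 [z2 [z3 [n12 n13 n23 tE]]]] hsym]]] :=
    john4_conclusion (conv2_planar vK) (conv2_planar vL) (cpt2_planar cL)
      (fun p => KL (rv_of p)) (And4 (uK i0) (uK i1) (uK i2) (uK i3))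
      (fun z Lz => And4 (vL1 i0 z Lz) (vL1 i1 z Lz) (vL1 i2 z Lz) (vL1 i3 z Lz)) j.
  by left; exact: ratio_lt2_grunbaum.
right; split.
  have LK y : L y -> K (- (1 / 2) *: y).
    rewrite -planarE => /hK; congr K; apply/rowP => n; rewrite !mxE /opp_half /=.
    by case: (ord2P n) => -> /=; field.
  have inj p q : p <> q -> rv_of p != rv_of q.
    by move=> pq; apply/eqP => /(congr1 (@pt_of R)); rewrite !rv_ofK.
  have -> : boundary L `&` boundary (dilate (-2) K) =
      [set` [fset rv_of z1; rv_of z2; rv_of z3]%fset].
    apply/seteqP; split=> x; rewrite /= !inE.
      move/(boundary_tight x cL LK vK K0)/tE => h.
      by rewrite -[x]pt_ofK; case: h => ->; rewrite eqxx ?orbT.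
    move=> h; apply/(boundary_tight x cL LK vK K0)/tE.
    by case/orP: h => [/orP[]|] /eqP ->; rewrite rv_ofK;
      [constructor 1|constructor 2|constructor 3].
  apply/card_eq_fsetP; rewrite fsetUC cardfsU1 cardfs2 !inE negb_or (inj _ _ n12).
  by rewrite eq_sym (inj _ _ n13) eq_sym (inj _ _ n23).
move=> [c cS]; have [|h|h] := hsym _.
- exists (pt_of (c *+ 2)) => z; rewrite -[z]rv_ofK planarE => /cS.
  rewrite /planar; congr L; apply/rowP => n.
  by rewrite /pt_of !mxE; case: (ord2P n) => ->.
- by left; exact: ratio_lt2_grunbaum.
- by right; exact: tri2_triangle.
Qed.

End JohnPosition.

Theorem mainTheorem2 (R : realType) (K L : set 'rV[R]_2)
    (m : nat) (u v : 'I_m -> 'rV[R]_2)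
    (bodyK : convex_body K) (bodyL : convex_body L)
    (maxKL : maximal_volume_position K L)
    (intK0 : interior K 0)
    (johnKL : john_position K L u v)
    (u_extreme : forall i : 'I_m,
       ~ convex_hull [set u j | j in [set j : 'I_m | j != i]] (u i))
    (v_extreme : forall i : 'I_m,
       ~ convex_hull [set v j | j in [set j : 'I_m | j != i]] (v i)) :
  [/\ m = 3%N -> grunbaum_distance K L = 2 ->
        is_triangle K \/ is_triangle L,
      m = 4%N ->
        boundary L `&` boundary (dilate (-2) K) #!= `I_3 ->
        grunbaum_distance K L = 2 ->
        is_triangle K \/ is_triangle L &
      m = 4%N ->
        boundary L `&` boundary (dilate (-2) K) #= `I_3 ->
        centrally_symmetric L ->
        grunbaum_distance K L = 2 ->
        is_triangle K].
Proof.
split=> [m3 d2|m4 n3 d2|m4 _ symL d2]; subst m.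
- have [?|?|] := john_three bodyK bodyL johnKL; [by left|by right|].
  by rewrite d2 ltxx.
- have [|[c3 _]] := john_four bodyK bodyL intK0 johnKL u_extreme v_extreme.
    by rewrite d2 ltxx.
  by rewrite c3 in n3.
have [|[_ h]] := john_four bodyK bodyL intK0 johnKL u_extreme v_extreme.
  by rewrite d2 ltxx.
by have [|//] := h symL; rewrite d2 ltxx.
Qed.
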